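(* Let $0<\Delta<\infty$. There exist a constant $C=C(\Delta)>0$ and $h_0=h_0(\Delta)>0$ such that for all $0<h<h_0$ $$2\pi\Delta^2h^2\left(\log\frac1h-2\log\log\frac1h-C\right)\le\inf_{(U,W)} I^{vK}_{h,\Delta}(U,W)\le 6\pi\Delta^2h^2\left(\log\frac1h+C\right),$$ where the infimum is over all $(U,W)\in W^{1,2}(B_1,\mathbb{R}^2)\times W^{2,2}(B_1)$.
   Context: $B_1=\{x\in\mathbb{R}^2:|x|<1\}$ and, for $x\ne0$, $\hat x^\perp=\frac{1}{|x|}(-x_2,x_1)$. $W^{2,2}(B_1)$ denotes real-valued functions. For $h>0$, $0<\Delta<\infty$, $U:B_1\to\mathbb{R}^2$ and $W:B_1\to\mathbb{R}$, the Föppl-von Kármán energy of the singular e-cone is $$I^{vK}_{h,\Delta}(U,W)=\int_{B_1}\left(\left|2\,\mathrm{sym}\,DU+\nabla W\otimes\nabla W-\Delta^2\,\hat x^\perp\otimes\hat x^\perp\right|^2+h^2|\nabla^2W|^2\right)dx,$$ where $\mathrm{sym}\,DU=(DU+DU^T)/2$ and $|\cdot|$ is the Euclidean (Frobenius) norm. *)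

(* Defs.v *)
From mathcomp Require Import all_boot all_order all_algebra.
From mathcomp Require Import all_classical all_reals all_analysis.

Set Implicit Arguments.
Unset Strict Implicit.
Unset Printing Implicit Defensive.

Import Order.TTheory GRing.Theory Num.Theory.
Import numFieldNormedType.Exports.

Local Open Scope classical_set_scope.
Local Open Scope ring_scope.

(* Points of the plane are pairs, which carry the product topology and the
   product Lebesgue measure; vector and matrix values of fields are column
   vectors 'cV[R]_2 and matrices 'M[R]_2.  Fields are total functions of which
   only the values on the unit disc matter. *)

Definition plane_measure (R : realType) :
    {measure set (measurableTypeR R * measurableTypeR R) -> \bar R} :=
  (lebesgue_measure \x lebesgue_measure)%E.

(* The library norm on a product is the sup norm, hence this one. *)
Definition euclid (R : realType) (x : R * R) : R :=
  Num.sqrt (x.1 ^+ 2 + x.2 ^+ 2).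

Definition disc (R : realType) : set (R * R) := [set x | euclid x < 1].

Definition basis_vec (R : realType) (i : 'I_2) : R * R :=
  if i == 0 then (1, 0) else (0, 1).

Definition partial (R : realType) (i : 'I_2) (f : R * R -> R) : R * R -> R :=
  fun x => 'D_(basis_vec R i) f x.

Definition iter_partial (R : realType) (s : seq 'I_2) (f : R * R -> R) :
  R * R -> R := foldr (@partial R) f s.

(* The partial derivative 'D is a junk value where it does not exist, so
   existence is required separately. *)
Definition smooth (R : realType) (f : R * R -> R) : Prop :=
  forall s : seq 'I_2,
    continuous (iter_partial s f) /\
    forall (i : 'I_2) (x : R * R),
      derivable (iter_partial s f) x (basis_vec R i).

Definition test_function (R : realType) (phi : R * R -> R) : Prop :=
  smooth phi /\
  exists K : set (R * R),
    [/\ compact K, K `<=` @disc R & forall x, ~ K x -> phi x = 0].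

Definition locally_L1 (R : realType) (f : R * R -> R) : Prop :=
  forall K : set (R * R), compact K -> K `<=` @disc R ->
    (plane_measure R).-integrable K (EFin \o f).

(* Extension by zero reduces L^2 of the disc to Lfun, which is global. *)
Definition L2 (R : realType) (f : R * R -> R) : Prop :=
  f \_ (@disc R) \in Lfun (plane_measure R) 2%:E.

Definition is_weak_partial (R : realType) (i : 'I_2) (f g : R * R -> R) : Prop :=
  [/\ locally_L1 f, locally_L1 g &
      forall phi : R * R -> R, test_function phi ->
        \int[plane_measure R]_(x in @disc R) (f x * partial i phi x) =
        - \int[plane_measure R]_(x in @disc R) (g x * phi x)].

(* Weak derivatives are unique up to a null set; this picks a representative
   (the zero function if f has no i-th weak derivative). *)
Definition weak_partial (R : realType) (i : 'I_2) (f : R * R -> R) :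
  R * R -> R := xget (cst 0) [set g | is_weak_partial i f g].

Definition W12 (R : realType) (f : R * R -> R) : Prop :=
  L2 f /\
  forall i : 'I_2, exists g : R * R -> R, is_weak_partial i f g /\ L2 g.

Definition W12_vec (R : realType) (U : R * R -> 'cV[R]_2) : Prop :=
  forall i : 'I_2, W12 (fun x => U x i 0).

Definition W22 (R : realType) (f : R * R -> R) : Prop :=
  W12 f /\ forall i : 'I_2, W12 (weak_partial i f).

Definition weak_grad (R : realType) (f : R * R -> R) (x : R * R) : 'cV[R]_2 :=
  \col_i weak_partial i f x.

Definition weak_jacobian (R : realType) (U : R * R -> 'cV[R]_2) (x : R * R) :
  'M[R]_2 := \matrix_(i, j) weak_partial j (fun y => U y i 0) x.

Definition weak_hessian (R : realType) (f : R * R -> R) (x : R * R) : 'M[R]_2 :=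
  \matrix_(i, j) weak_partial j (weak_partial i f) x.

Definition sym (R : realType) (A : 'M[R]_2) : 'M[R]_2 := 2^-1 *: (A + A^T).

Definition tensor (R : realType) (a b : 'cV[R]_2) : 'M[R]_2 := a *m b^T.

Definition frobenius (R : realType) (A : 'M[R]_2) : R :=
  Num.sqrt (\sum_i \sum_j A i j ^+ 2).

(* The value at the origin is 0. *)
Definition hat_perp (R : realType) (x : R * R) : 'cV[R]_2 :=
  (euclid x)^-1 *: \col_i (if i == 0 then - x.2 else x.1).

(* The integrand is nonnegative, so the integral is taken in [0, +oo]. *)
Definition energy_vK (R : realType) (h Delta : R) (U : R * R -> 'cV[R]_2)
    (W : R * R -> R) : \bar R :=
  (\int[plane_measure R]_(x in @disc R)
    (frobenius (2 *: sym (weak_jacobian U x)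
                + tensor (weak_grad W x) (weak_grad W x)
                - Delta ^+ 2 *: tensor (hat_perp x) (hat_perp x)) ^+ 2
     + h ^+ 2 * frobenius (weak_hessian W x) ^+ 2)%:E)%E.

Definition inf_energy_vK (R : realType) (h Delta : R) : \bar R :=
  ereal_inf [set e | exists (U : R * R -> 'cV[R]_2) (W : R * R -> R),
    [/\ W12_vec U, W22 W & e = energy_vK h Delta U W]].

(* Main.v *)
(* Lower bound.  Let phi be a radial cutoff of ln (1 / (2 sqrt (|x|^2 + h^2))),
   supported in |x| <= 1/2, and N the cofactor matrix of its Hessian.  N is
   divergence free, so the integral of sym DU : N vanishes; the integral of N
   against the tensor square of hat_perp is 2 pi phi(0); and the integral of
   |N|^2 is at most C / h^2.  The integral of (grad W (x) grad W) : N is at most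
   that of |D^2 W|^2: for smooth W an integration by parts turns it into the
   integral, against a radial weight at most |x|^-2, of the area swept by grad W
   along circles about 0, which the isoperimetric inequality bounds by the squared
   angular derivative; mollification gives the general case.  Completing the
   square in strain + h^2 / 2 * N then bounds the energy from below by
   h^2 (2 pi Delta^2 phi(0) - C).

   Upper bound.  For a^2 = 2 Delta^2 / 3 the cone W = a |x| cos 2 theta has an
   in-plane displacement U of zero strain, and so has its rotation by pi / 4.  The
   squared Hessians of these two cones add up to 9 a^2 / |x|^2, so that one of the
   two, regularised at scale h, has energy at most
   6 pi Delta^2 h^2 (log (1 / h) + C). *)
Require Import Defs.
From HB Require Import structures.
From mathcomp Require Import all_boot all_order all_algebra.
From mathcomp Require Import all_classical all_reals all_analysis.
From mathcomp Require Import measurable_realfun lebesgue_integral_under.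
From mathcomp Require Import ring lra.
Import Order.TTheory GRing.Theory Num.Theory.
Import numFieldNormedType.Exports.
Set Implicit Arguments.
Unset Strict Implicit.
Unset Printing Implicit Defensive.
Local Open Scope classical_set_scope.
Local Open Scope ring_scope.

(** * Measure-preserving maps and polar coordinates *)

(** Pairing the strain with a fixed divergence-free [N] is linear, so the in-plane displacement
    disappears from the lower bound. The price is h^4 / 4 times the integral of |N|^2, that is
    O(h^2), while phi(0) keeps the whole logarithm. The delicate term is that of grad W: for W in
    W^{2,2} it has no classical restriction to circles, so the isoperimetric step needs mollified
    gradients, and a cutoff supported in |x| <= 1/2 leaves room for kernels of size 1/4 inside the
    disc.

    For W = r f(theta), zero strain forces the radial displacement - r f^2 / 2 and a tangential one
    r g with 2 g' = Delta^2 + f^2 - f'^2. Hence f'^2 - f^2 has mean Delta^2; frequency 1 gives mean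
    zero, and a cos 2 theta gives 3 a^2 / 2, which fixes a. The Hessian of W has the single entry
    (f'' + f) / r, of square 9 a^2 cos^2(2 theta) / r^2. Adding the rotated cone makes this radial,
    so that the integrals to be computed on the disc reduce to one variable; half of the sum
    contributes 9 a^2 / 2 times 2 pi log(1/h), that is 6 pi Delta^2 log(1/h). *)

Section LebesgueShift.
Context {R : realType}.
Local Notation L := (@lebesgue_measure R).

Lemma lebesgue_measure_shift (a : R) (A : set (measurableTypeR R)) :
  measurable A -> L ((fun x => x + a) @^-1` A) = L A.
Proof.
have ms : measurable_fun [set: measurableTypeR R]
    ((fun x => x + a) : measurableTypeR R -> measurableTypeR R).
  exact: measurable_realfun.measurable_funD.
move=> mA; rewrite -[LHS]/(pushforward L _ A); apply/esym.
apply: (@lebesgue_measure_unique R (pushforward L _)) => //.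
move=> _ [[x y]] /= _ <-.
rewrite /pushforward.
have -> : (fun z => z + a) @^-1` `]x, y] = `](x - a), (y - a)]%classic.
  apply/seteqP; split=> z /=; rewrite !in_itv/=; lra.
rewrite !lebesgue_measure_itv/= !lte_fin ltrD2r.
by case: ifP => // _; rewrite -!EFinD; congr (_%:E); ring.
Qed.
End LebesgueShift.

Section MeasurePreserving.
Context {R : realType} d (X : measurableType d) (mu : {measure set X -> \bar R}).

Definition measure_preserving (T : X -> X) :=
  measurable_fun setT T /\
  forall A : set X, measurable A -> mu (T @^-1` A) = mu A.

Lemma measure_preserving_comp (S T : X -> X) :
  measure_preserving S -> measure_preserving T ->
  measure_preserving (S \o T).
Proof.
move=> [mS pS] [mT pT]; split; first exact: measurableT_comp.
move=> A mA; rewrite comp_preimage pT ?pS//.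
by rewrite -[X in measurable X]setTI; exact: mS.
Qed.

Lemma ge0_integral_preserving T (f : X -> \bar R) :
  measure_preserving T -> measurable_fun setT f -> (forall x, (0 <= f x)%E) ->
  (\int[mu]_x f (T x) = \int[mu]_x f x)%E.
Proof.
move=> [mT pT] mf f0.
transitivity (\int[pushforward mu T]_x f x)%E.
  by rewrite ge0_integral_pushforward.
by apply: eq_measure_integral => A mA _ /=; exact: pT.
Qed.

Lemma integrable_preserving T (f : X -> R) :
  measure_preserving T -> mu.-integrable setT (EFin \o f) ->
  mu.-integrable setT (EFin \o (f \o T)) /\
  \int[mu]_x f (T x) = \int[mu]_x f x.
Proof.
move=> [mT pT] /integrableP[mf fi].
have fiT : mu.-integrable setT (EFin \o (f \o T)).
  apply/integrableP; split; first exact: (measurableT_comp mf mT).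
  by rewrite (@ge0_integral_preserving T (fun x => `|(f x)%:E|%E))//; exact: measurableT_comp.
split=> //; rewrite /Rintegral; congr fine.
transitivity (\int[pushforward mu T]_x (EFin \o f) x)%E.
  by rewrite integral_pushforward.
by apply: eq_measure_integral => A mA _ /=; exact: pT.
Qed.

End MeasurePreserving.

Arguments measure_preserving {R d X} mu T.

Section PlaneMeasure.
Context {R : realType}.
Local Notation L := (@lebesgue_measure R).
Local Notation plane := (measurableTypeR R * measurableTypeR R)%type.
Local Notation mu := (L \x L)%E.

Definition obox (a b c d : R) : set (R * R) := `]a, b[ `*` `]c, d[.

Definition oboxes : set (set (R * R)) :=
  [set B | exists a b c d, B = obox a b c d].

(** Boxes with rational centre and radius that lie in [U] cover it and are countable in number. *)
Lemma open_sigma_oboxes (U : set (R * R)) : open U -> <<s oboxes >> U.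
Proof.
move=> oU.
pose B (p : rat * rat * rat) : set (R * R) :=
  ball (ratr p.1.1 : R) (ratr p.2) `*` ball (ratr p.1.2 : R) (ratr p.2).
have mB p : @measurable _ (g_sigma_algebraType oboxes) (B p).
  apply: sub_sigma_algebra; rewrite /B !ball_itv.
  by do 4 eexists.
have -> : U = \bigcup_(p in [set p | B p `<=` U]) B p.
  apply/seteqP; split => [[x y] Uxy|z [p pU Bz]]; last exact: pU.
  have /nbhs_ballP[e /= e0 eU] : nbhs (x, y) U by exact: open_nbhs_nbhs.
  have [r /andP[r0 re]] : exists r : rat, (0 < ratr r :> R) && (ratr r < e / 2).
    have [r] := @rat_in_itvoo R 0 (e / 2) ltac:(lra).
    by rewrite in_itv /=; exists r.
  have near_rat (z : R) : exists q : rat, `|ratr q - z| < ratr r.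
    have [q] := @rat_in_itvoo R (z - ratr r) (z + ratr r) ltac:(lra).
    by rewrite in_itv /= => /andP[q1 q2]; exists q; rewrite ltr_norml; lra.
  have [q1 xq] := near_rat x; have [q2 yq] := near_rat y.
  exists (q1, q2, r) => //=.
  move=> [a b] [] /=; rewrite /ball /= => aq bq; apply: eU; split => /=; rewrite /ball /=.
    have -> : x - a = - (ratr q1 - x) + (ratr q1 - a) by ring.
    by rewrite (le_lt_trans (ler_normD _ _))// normrN; lra.
  have -> : y - b = - (ratr q2 - y) + (ratr q2 - b) by ring.
  by rewrite (le_lt_trans (ler_normD _ _))// normrN; lra.
rewrite bigcup_mkcond.
apply: (@countable_bigcupT_measurable _ (g_sigma_algebraType oboxes)).
  by [].
by move=> p; case: ifP.
Qed.

Lemma measurable_obox a b c d : measurable (obox a b c d : set plane).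
Proof. by apply: measurableX; exact: measurable_itv. Qed.

Lemma plane_open_measurable (U : set (R * R)) :
  open U -> measurable (U : set plane).
Proof.
move=> /open_sigma_oboxes; apply: smallest_sub.
  exact: (@sigma_algebra_measurable _ plane).
by move=> _ [a [b [c [d ->]]]]; exact: measurable_obox.
Qed.

(** The projections are continuous, hence measurable for the sigma-algebra of the boxes. As open
    boxes are stable under intersection, they serve as the generator in the Dynkin arguments
    below. *)
Lemma measurable_sigma_oboxes : @measurable _ plane = <<s oboxes >>.
Proof.
apply/seteqP; split; last first.
  apply: smallest_sub; first exact: (@sigma_algebra_measurable _ plane).
  by move=> _ [a [b [c [d ->]]]]; exact: measurable_obox.
have gen (f : R * R -> R) : continuous f ->
    measurable_fun setT (f : g_sigma_algebraType oboxes -> measurableTypeR R).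
  move=> /continuousP cf.
  apply: (measurability _ (RGenOpens.measurableE R)) => //.
  move=> _ [_ [a [b ->]] <-]; rewrite setTI.
  by apply: open_sigma_oboxes; apply: cf; exact: interval_open.
have mfst : measurable_fun setT (fst : g_sigma_algebraType oboxes -> measurableTypeR R).
  by apply: gen => x; exact: cvg_fst.
have msnd : measurable_fun setT (snd : g_sigma_algebraType oboxes -> measurableTypeR R).
  by apply: gen => x; exact: cvg_snd.
apply: smallest_sub; first exact: smallest_sigma_algebra.
by move=> _ [] [A mA <-]; [exact: mfst|exact: msnd].
Qed.

Lemma setI_closed_oboxes : setI_closed oboxes.
Proof.
move=> _ _ [a [b [c [d ->]]]] [a' [b' [c' [d' ->]]]].
exists (Num.max a a'), (Num.min b b'), (Num.max c c'), (Num.min d d').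
apply/seteqP; split => -[x y]; rewrite /obox /= !in_itv /= !gt_max !lt_min.
  by move=> [[/andP[-> ->] /andP[-> ->]] [/andP[-> ->] /andP[-> ->]]].
by move=> [/andP[/andP[-> ->] /andP[-> ->]] /andP[/andP[-> ->] /andP[-> ->]]].
Qed.

Lemma plane_closed_measurable (U : set (R * R)) :
  closed U -> measurable (U : set plane).
Proof.
move=> cU; rewrite -(setCK U); apply: measurableC.
by apply: plane_open_measurable; exact: closed_openC.
Qed.

Lemma plane_compact_measurable (U : set (R * R)) :
  compact U -> measurable (U : set plane).
Proof.
move=> cU; apply: plane_closed_measurable; apply: compact_closed => //; exact: norm_hausdorff.
Qed.

Lemma plane_continuous_measurable (f : R * R -> R) :
  continuous f -> measurable_fun [set: plane] (f : plane -> measurableTypeR R).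
Proof.
move=> /continuousP cf.
apply: (measurability _ (RGenOpens.measurableE R)) => //.
move=> _ [_ [a [b ->]] <-]; rewrite setTI.
by apply: plane_open_measurable; apply: cf; exact: interval_open.
Qed.

(** A shear translates each vertical section, and the product measure integrates the lengths of
    these sections. *)
Lemma shear_preserving (g : measurableTypeR R -> measurableTypeR R) :
  measurable_fun setT g -> measure_preserving mu (fun p => (p.1, p.2 + g p.1)).
Proof.
move=> mg.
have mS : measurable_fun setT
    ((fun p => (p.1, p.2 + g p.1)) : plane -> plane).
  apply: measurable_fun_pair; first exact: measurable_fst.
  apply: measurable_realfun.measurable_funD; first exact: measurable_snd.
  exact: measurableT_comp measurable_fst.
split=> // A mA.
rewrite /product_measure1 /=; apply: eq_integral => x _ /=.
have -> : xsection ((fun p : R * R => (p.1, p.2 + g p.1)) @^-1` A) x =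
  (fun y => y + g x) @^-1` (xsection A x).
  by apply/seteqP; split=> y; rewrite /xsection /= !inE.
by apply: lebesgue_measure_shift; exact: measurable_xsection.
Qed.

Lemma swap_preserving : measure_preserving mu (fun p => (p.2, p.1)).
Proof.
have mS : measurable_fun setT ((fun p => (p.2, p.1)) : plane -> plane).
  by apply: measurable_fun_pair; [exact: measurable_snd|exact: measurable_fst].
split=> // A mA; apply/esym.
rewrite -[RHS]/(pushforward mu ((fun p => (p.2, p.1)) : plane -> plane) A).
apply: (@product_measure_unique _ _ _ _ R L L (pushforward mu ((fun p => (p.2, p.1)) : plane -> plane))) => //.
move=> X Y mX mY; rewrite /pushforward.
transitivity (mu (Y `*` X)); last by rewrite product_measure1E// muleC.
by congr (mu _); apply/seteqP; split=> -[a b] [].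
Qed.

Lemma shear2_preserving (g : measurableTypeR R -> measurableTypeR R) :
  measurable_fun setT g -> measure_preserving mu (fun p => (p.1 + g p.2, p.2)).
Proof.
move=> mg.
exact: (measure_preserving_comp swap_preserving
  (measure_preserving_comp (shear_preserving mg) swap_preserving)).
Qed.

Lemma translation_preserving (a : R * R) :
  measure_preserving mu (fun p => (p.1 + a.1, p.2 + a.2)).
Proof.
exact: (measure_preserving_comp (shear_preserving (measurable_cst a.2))
  (shear2_preserving (measurable_cst a.1))).
Qed.

Definition rot (c s : R) (p : plane) : plane :=
  (c * p.1 - s * p.2, s * p.1 + c * p.2).

(* A rotation other than the half turn is a product of three shears. *)
Lemma rot_preserving c s : c ^+ 2 + s ^+ 2 = 1 -> measure_preserving mu (rot c s).
Proof.
have ml (a : R) : measurable_fun setT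
    ((fun x => a * x) : measurableTypeR R -> measurableTypeR R).
  exact: measurable_funM.
have main (c' s' : R) : c' ^+ 2 + s' ^+ 2 = 1 -> c' != -1 ->
    measure_preserving mu (rot c' s').
  move=> cs c1; have c10 : 1 + c' != 0 by apply: contra_neq c1 => ?; lra.
  (* [t] is minus the tangent of half the angle, so that the first and the third shear coincide. *)
  pose t := - (s' / (1 + c')).
  rewrite (_ : rot c' s' = (fun p => (p.1 + t * p.2, p.2)) \o
     ((fun p => (p.1, p.2 + s' * p.1)) \o (fun p => (p.1 + t * p.2, p.2)))).
    exact: (measure_preserving_comp (shear2_preserving (ml t))
      (measure_preserving_comp (shear_preserving (ml s')) (shear2_preserving (ml t)))).
  have st : s' * t = c' - 1.
    apply: (mulIf c10); rewrite /t.
    have -> : s' * - (s' / (1 + c')) * (1 + c') = - s' ^+ 2 by field.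
    have -> : s' ^+ 2 = 1 - c' ^+ 2 by lra.
    by ring.
  have t1 : t * (1 + c') = - s' by rewrite /t; field.
  apply/funext => -[x y]; rewrite /rot /=; congr (_, _).
    have -> : x + t * y + t * (y + s' * (x + t * y)) =
      (1 + s' * t) * x + t * (1 + (1 + s' * t)) * y by ring.
    by rewrite st subrKC t1; ring.
  have -> : y + s' * (x + t * y) = s' * x + (1 + s' * t) * y by ring.
  by rewrite st subrKC.
move=> cs; have [c1|] := eqVneq c (-1); last exact: main.
have s0 : s = 0.
  by apply/eqP; rewrite -sqrf_eq0; apply/eqP; move: cs; rewrite c1; lra.
(* The half turn is two quarter turns. *)
have -> : rot c s = rot 0 1 \o rot 0 1.
  by apply/funext => -[x y]; rewrite /rot /= c1 s0; congr (_, _); ring.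
by apply: measure_preserving_comp; apply: main; rewrite ?expr0n ?expr1n ?add0r// eq_sym oppr_eq0 oner_eq0.
Qed.
End PlaneMeasure.

Section Radial.
Context {R : realType}.
Local Notation L := (@lebesgue_measure R).
Local Notation plane := (measurableTypeR R * measurableTypeR R)%type.
Local Notation mu := (L \x L)%E.

Lemma derivable_oo_LRcontinuousT (f : R -> R) a b :
  (forall x, derivable f x 1) -> derivable_oo_LRcontinuous f a b.
Proof.
move=> df; have cf x : {for x, continuous f}.
  by apply: differentiable_continuous; exact/derivable1_diffP.
split; first by move=> x _; exact: df.
- exact/cvg_at_right_filter/cf.
- exact/cvg_at_left_filter/cf.
Qed.

Lemma continuous_is_derive (f f' : R -> R) :
  (forall x : R, is_derive x (1 : R) f (f' x)) -> continuous f.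
Proof.
move=> df x; apply: differentiable_continuous; apply/derivable1_diffP.
by have [] := df x.
Qed.

Lemma integral_is_derive (f f' : R -> R) a b : a <= b ->
  (forall x : R, is_derive x (1 : R) f (f' x)) -> continuous f' ->
  (\int[L]_(x in `[a, b]) (f' x)%:E = (f b - f a)%:E)%E.
Proof.
rewrite le_eqVlt => /predU1P[->|ab] df cf.
  by rewrite set_itv1 integral_set1 subrr.
rewrite EFinB (@continuous_FTC2 _ f' f)//.
- exact: continuous_subspaceT.
- by apply: derivable_oo_LRcontinuousT => x; have [] := df x.
- by move=> x _; rewrite derive1E; have [_] := df x.
Qed.

Lemma Rintegral_is_derive (f f' : R -> R) a b : a <= b ->
  (forall x : R, is_derive x (1 : R) f (f' x)) -> continuous f' ->
  \int[L]_(x in `[a, b]) f' x = f b - f a.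
Proof. by move=> ab df cf; rewrite /Rintegral (integral_is_derive ab df cf). Qed.

Lemma integral_half_disc (a : R) : 0 < a ->
  (\int[L]_(x in `[(- a)%R, a]) (2 * Num.sqrt (a ^+ 2 - x ^+ 2))%:E =
   (pi * a ^+ 2)%:E)%E.
Proof.
move=> a0.
pose F (t : R) := a * sin t.
have dF (x : R) : is_derive x 1 F (a * cos x).
  by rewrite /F; apply: is_derive_eq; rewrite /GRing.scale /=; ring.
have F'E : (derive1 F) = (fun x => a * cos x).
  by apply/funext => x; rewrite derive1E; have [_] := dF x.
have cF' : continuous (derive1 F).
  rewrite F'E => x; apply: cvgM; first exact: cvg_cst.
  exact: continuous_cos.
have pi0 := pi_gt0 R.
have Fl : F (- (pi / 2)) = - a by rewrite /F sinN sin_pihalf mulrN1.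
have Fr : F (pi / 2) = a by rewrite /F sin_pihalf mulr1.
transitivity (\int[L]_(x in `[F (- (pi / 2))%R, F (pi / 2)%R])
  (2 * Num.sqrt (a ^+ 2 - x ^+ 2))%:E)%E; first by rewrite Fl Fr.
rewrite (@integration_by_substitution_increasing R F
    (fun x => 2 * Num.sqrt (a ^+ 2 - x ^+ 2))).
- transitivity (\int[L]_(x in `[(- (pi / 2))%R, (pi / 2)%R])
      (2 * a ^+ 2 * cos x ^+ 2)%:E)%E.
    apply: eq_integral => x; rewrite inE /= in_itv /= => xI.
    congr (_%:E); rewrite F'E !fctE /= /F.
    have -> : a ^+ 2 - (a * sin x) ^+ 2 = (a * cos x) ^+ 2.
      by rewrite !exprMn cos2sin2; ring.
    by rewrite sqrtr_sqr ger0_norm ?mulr_ge0 ?(ltW a0) ?cos_ge0_pihalf//; ring.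
  have dG (x : R) : is_derive x (1 : R) (fun x => a ^+ 2 * (x + sin x * cos x))
      (2 * a ^+ 2 * cos x ^+ 2).
    apply: is_derive_eq; rewrite /GRing.scale /=.
    have := cos2Dsin2 x => h.
    have -> : 2 * a ^+ 2 * cos x ^+ 2 =
      a ^+ 2 * (cos x ^+ 2 + sin x ^+ 2 + cos x ^+ 2 - sin x ^+ 2) by ring.
    by rewrite h; ring.
  rewrite (integral_is_derive _ dG).
  + congr (_%:E).
    by rewrite cosN !cos_pihalf !mulr0 !addr0; field.
  + lra.
  + move=> x; apply: cvgM; first exact: cvg_cst.
    by apply: (@cvgM _ _ _ _ cos cos); exact: continuous_cos.
- lra.
- move=> x y xI yI xy; rewrite /F ltr_pM2l// ltr_sin//.
- by move=> x _; exact: cF'.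
- by apply/cvg_ex; exists ((derive1 F) (- (pi / 2))); exact/cvg_at_right_filter/cF'.
- by apply/cvg_ex; exists ((derive1 F) (pi / 2)); exact/cvg_at_left_filter/cF'.
- by apply: derivable_oo_LRcontinuousT => x; have [] := dF x.
- apply: continuous_subspaceT => x.
  apply: cvgM; first exact: cvg_cst.
  apply: (@cvg_comp _ _ _ (fun x => a ^+ 2 - x ^+ 2)); last exact: sqrt_continuous.
    apply: cvgB; first exact: cvg_cst.
    exact: exprn_continuous.
Qed.

Lemma measurable_sqnorm : measurable_fun setT
  ((fun p => p.1 ^+ 2 + p.2 ^+ 2) : plane -> measurableTypeR R).
Proof.
apply: measurable_realfun.measurable_funD.
  by apply: measurable_funX; exact: measurable_fst.
by apply: measurable_funX; exact: measurable_snd.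
Qed.

Lemma disc_area (s : R) : 0 <= s ->
  mu [set p : plane | p.1 ^+ 2 + p.2 ^+ 2 < s] = (pi * s)%:E.
Proof.
rewrite le_eqVlt => /predU1P[<-|s0].
  rewrite mulr0 [X in mu X](_ : _ = set0) ?measure0//.
  apply/seteqP; split=> // -[x y] /=.
  by rewrite ltNge addr_ge0 ?sqr_ge0.
set a := Num.sqrt s; have a0 : 0 < a by rewrite sqrtr_gt0.
have -> : s = a ^+ 2 by rewrite sqr_sqrtr ?ltW.
rewrite -integral_half_disc//.
transitivity (\int[L]_x (2 * Num.sqrt (a ^+ 2 - x ^+ 2))%:E)%E.
  rewrite /product_measure1 /=; apply: eq_integral => x _ /=.
  set t := a ^+ 2 - x ^+ 2.
  have -> : xsection [set p : plane | p.1 ^+ 2 + p.2 ^+ 2 < a ^+ 2] x =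
      `](- Num.sqrt t), (Num.sqrt t)[%classic.
    apply/seteqP; split=> y; rewrite /xsection /= inE /= in_itv /= -ltr_norml.
      move=> h; have t0 : 0 < t by have := sqr_ge0 y; rewrite /t; lra.
      by rewrite -sqrtr_sqr ltr_sqrt// /t; lra.
    move=> h; have t0 : 0 < t.
      by rewrite -sqrtr_gt0 (le_lt_trans _ h).
    by move: h; rewrite -sqrtr_sqr ltr_sqrt// /t; lra.
  rewrite lebesgue_measure_itv /= lte_fin.
  have := sqrtr_ge0 t; rewrite le_eqVlt => /predU1P[<-|t0].
    by rewrite oppr0 ltxx mulr0.
  by rewrite ifT; [rewrite -EFinD; congr (_%:E); ring|lra].
rewrite [RHS]integral_mkcond; apply: eq_integral => x _.
rewrite patchE; case: ifPn => //; rewrite notin_setE /= in_itv /= => /negP.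
rewrite -ler_norml -ltNge => ax.
rewrite ler0_sqrtr ?mulr0// subr_le0.
rewrite -[leRHS]real_normK ?num_real//.
by apply: lerXn2r; rewrite ?nnegrE ?normr_ge0// ltW.
Qed.

(** The disc |x|^2 < s has area pi s, so the image of the plane measure under |x|^2 agrees with pi
    times Lebesgue measure of the half line on all sets ]-oo, s[, and these determine a measure. In
    the variable |x|^2 there is no Jacobian. *)
Lemma ge0_integral_radial (f : measurableTypeR R -> \bar R) :
  measurable_fun setT f -> (forall s, (0 <= f s)%E) ->
  (\int[mu]_p f (p.1 ^+ 2 + p.2 ^+ 2)%R =
   pi%:E * \int[L]_(s in `[0%R, +oo[) f s)%E.
Proof.
move=> mf f0.
pose n := (fun p => p.1 ^+ 2 + p.2 ^+ 2) : plane -> measurableTypeR R.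
have n0 p : 0 <= n p by rewrite addr_ge0 ?sqr_ge0.
pose D : set (measurableTypeR R) := `[0%R, +oo[%classic.
have mD : measurable D by exact: measurable_itv.
pose piN : {nonneg R} := NngNum (pi_ge0 R).
have Nf : {in D, forall y, (0 <= f y)%E} by move=> *; exact: f0.
transitivity (\int[pushforward mu n]_(y in D) f y)%E.
  rewrite (ge0_integral_pushforward measurable_sqnorm)//; last first.
    exact: measurable_funTS.
  rewrite (_ : n @^-1` D = setT)//.
  by apply/seteqP; split => // p _; rewrite /D /= in_itv /= n0.
rewrite -[pi%:E]/(piN%:num%:E) -ge0_integral_mscale//; last exact: measurable_funTS.
apply: eq_measure_integral => [|mn A mA AD]; first exact: measurable_sqnorm.
transitivity (mscale piN (mrestr L mD) A); last first.
  by rewrite /= /mscale /= /mrestr; congr (_ * L _)%E; apply/setIidPl.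
have mG : @measurable _ (measurableTypeR R) = <<s @RGenInftyO.G R >>.
  exact: RGenInftyO.measurableE.
apply: (@measure_unique _ R (measurableTypeR R) (@RGenInftyO.G R)
  (fun k => `]-oo, k%:R[%classic) mG _ _ _ (pushforward mu n) (mscale piN (mrestr L mD))) => //.
- move=> _ _ [x ->] [y ->]; exists (Num.min x y).
  by apply/seteqP; split=> z /=; rewrite !in_itv/= lt_min => /andP.
- by move=> i; exists i%:R.
- apply/seteqP; split=> // x _; exists (Num.bound `|x|) => //=.
  rewrite in_itv /= (le_lt_trans (ler_norm _))//.
  exact: archi_boundP.
- move=> _ [x ->]; rewrite /= /mscale /= /pushforward /mrestr /=.
  have [x0|x0] := leP x 0.
    rewrite [X in L X](_ : _ = set0) ?measure0 ?mule0; last first.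
      by apply/seteqP; split=> // z; rewrite /D /= !in_itv /=; case; lra.
    rewrite [X in mu X](_ : _ = set0) ?measure0//.
    by apply/seteqP; split=> // p /=; rewrite in_itv /=; have := n0 p; lra.
  rewrite [X in L X](_ : _ = `[0%R, x[%classic); last first.
    by apply/seteqP; split=> z; rewrite /D /= !in_itv /= ?andbT => -[]//; lra.
  transitivity (mu [set p : plane | p.1 ^+ 2 + p.2 ^+ 2 < x]).
    by congr (mu _); apply/seteqP; split=> p; rewrite /= in_itv.
  by rewrite (disc_area (ltW x0)) lebesgue_measure_itv /= lte_fin x0 oppr0 adde0 EFinM.
- move=> k; rewrite [ltLHS](_ : _ = mu [set p : plane | p.1 ^+ 2 + p.2 ^+ 2 < k%:R]).
    by rewrite disc_area// ltry.
  by congr (mu _); apply/seteqP; split=> p; rewrite /= in_itv.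
Qed.
End Radial.

(** * Smooth functions and weak derivatives *)

Section Elementary.
Context {R : realType}.
Implicit Types (f g : R * R -> R) (x v : R * R) (Q : {poly R}).

(** Restriction to a line makes the one-variable calculus, in particular the chain rule, available
    for directional derivatives. *)
Lemma is_derive_line f x v df :
  is_derive x v f df <-> is_derive (0 : R) (1 : R) (fun h => f (h *: v + x)) df.
Proof.
have E : (fun h : R => h^-1 *: ((f \o shift x) (h *: v) - f x)) =
    (fun h : R => h^-1 *: (((fun h => f (h *: v + x)) \o shift 0) (h *: (1 : R))
       - f (0 *: v + x))).
  by apply/funext => h /=; rewrite addr0 scale0r add0r [h *: 1]mulr1.
split=> -[dx <-]; split; rewrite ?/derivable ?/derive.
- by move: dx; rewrite /derivable E.
- by rewrite E.
- by rewrite E.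
- by rewrite E.
Qed.

Lemma is_derive_comp_line (phi : R -> R) f x v dphi df :
  is_derive (f x) (1 : R) phi dphi -> is_derive x v f df ->
  is_derive x v (phi \o f) (dphi * df).
Proof.
move=> hphi /is_derive_line hf; apply/is_derive_line.
have hphi' : is_derive (f (0 *: v + x)) (1 : R) phi dphi by rewrite scale0r add0r.
exact: (@is_derive1_comp R phi (fun h => f (h *: v + x)) 0 dphi df hphi' hf).
Qed.

(* The functions [Q(1/t) exp(-1/t)], [t > 0], extended by zero, are closed
   under differentiation. *)
Definition ebump Q (t : R) : R :=
  if 0 < t then Q.[t^-1] * expR (- t^-1) else 0.

(** The exponential series gives s^m exp(-s) <= m!. The induction runs over the Horner form of [Q],
    where a factor 'X raises the exponent; hence [m] is general. *)
Lemma horner_expR_bounded Q m : exists2 C : R, 0 <= C &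
  forall s, 0 <= s -> `|Q.[s]| * s ^+ m * expR (- s) <= C.
Proof.
elim/poly_ind: Q m => [|Q c IH] m.
  by exists 0 => // s _; rewrite horner0 normr0 !mul0r.
have [C C0 hC] := IH m.+1.
have fm : (0 : R) < m`!%:R by rewrite ltr0n fact_gt0.
exists (C + `|c| * m`!%:R) => [|s s0]; first by rewrite addr_ge0 ?mulr_ge0// ltW.
have es := expR_ge0 (- s).
have sm : s ^+ m * expR (- s) <= m`!%:R.
  rewrite expRN ler_pdivrMr ?expR_gt0// mulrC -ler_pdivrMr//.
  case: m {hC} fm => [|m] fm; first by rewrite expr0 fact0 divr1 -expR0 ler_expR.
  by apply: le_trans (expR_ge1Dxn m s0); rewrite lerDr.
rewrite hornerMXaddC.
apply: (@le_trans _ _ ((`|Q.[s]| * s + `|c|) * s ^+ m * expR (- s))).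
  rewrite ler_wpM2r// ler_wpM2r ?exprn_ge0//.
  by rewrite (le_trans (ler_normD _ _))// normrM (ger0_norm s0).
have -> : (`|Q.[s]| * s + `|c|) * s ^+ m * expR (- s) =
  `|Q.[s]| * s ^+ m.+1 * expR (- s) + `|c| * (s ^+ m * expR (- s)).
  by rewrite exprS; ring.
by apply: lerD; [exact: hC|rewrite ler_wpM2l].
Qed.

Lemma ebump_le Q m : exists2 C : R, 0 <= C &
  forall t, `|ebump Q t| <= C * `|t| ^+ m.
Proof.
have [C C0 hC] := horner_expR_bounded Q m.
exists C => // t; rewrite /ebump; case: ifPn => t0; last by rewrite normr0 mulr_ge0 ?exprn_ge0.
rewrite normrM (ger0_norm (expR_ge0 _)) (gtr0_norm t0).
rewrite -ler_pdivrMr ?exprn_gt0//.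
apply: le_trans (hC t^-1 _); last by rewrite invr_ge0 ltW.
by rewrite -exprVn mulrAC.
Qed.

(** With u = 1/t one has d/dt = - u^2 d/du, and the u-derivative of Q exp(-u) is (Q' - Q)
    exp(-u). *)
Definition ebump_deriv Q : {poly R} := 'X^2 * (Q - deriv Q).

Lemma is_derive_ebump Q (t : R) :
  is_derive t (1 : R) (ebump Q) (ebump (ebump_deriv Q) t).
Proof.
have [t0|t0|->] := ltgtP t 0.
- apply: (@near_eq_is_derive _ _ _ (cst 0)).
    near=> s; rewrite /ebump ifF//; apply/negbTE; rewrite -leNgt ltW//.
    by near: s; exact: lt_nbhsl.
  by rewrite /ebump ifF; [exact: is_derive_cst|apply/negbTE; rewrite -leNgt ltW].
- apply: (@near_eq_is_derive _ _ _ (fun s : R => Q.[s^-1] * expR (- s^-1))).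
    near=> s; rewrite /ebump ifT//.
    by near: s; exact: lt_nbhsr.
  have tn0 : t != 0 by rewrite gt_eqF.
  have d1 : is_derive t (1 : R) (fun s => s^-1) (- t ^- 2).
    have := @is_deriveV R id t 1 1 tn0 _.
    by move=> /(_ _)/is_derive_eq; apply; rewrite /GRing.scale /= mulr1.
  have d2 : is_derive t (1 : R) (fun s => Q.[s^-1]) (Q^`().[t^-1] * - t ^- 2).
    exact: (@is_derive1_comp _ (horner Q) (fun s => s^-1)).
  have d3 : is_derive t (1 : R) (fun s => expR (- s^-1)) (expR (- t^-1) * t ^- 2).
    have d4 : is_derive t (1 : R) (fun s => - s^-1) (t ^- 2).
      by apply: is_derive_eq; rewrite opprK.
    exact: (@is_derive1_comp _ expR (fun s => - s^-1)).
  rewrite /ebump t0 /ebump_deriv.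
  apply: is_derive_eq; rewrite /GRing.scale /= !hornerE /=.
  by rewrite exprVn; ring.
(* At 0 the function is O(t^2), so its difference quotient is O(t) and tends to 0. *)
- rewrite [ebump (ebump_deriv Q) 0]/ebump ltxx.
  have [C C0 hC] := ebump_le Q 2.
  suff h0 : (fun h : R => h^-1 *: ((ebump Q \o shift 0) (h *: 1) - ebump Q 0))
      @ 0^' --> (0 : R).
    by split; [apply/cvg_ex; exists 0|exact/cvg_lim].
  apply/cvgr0Pnorm_le => e e0; near=> h.
  rewrite /= addr0 [h *: 1]mulr1 /ebump ltxx subr0 -/(ebump Q h).
  have hn0 : h != 0 by near: h; exact: nbhs_dnbhs_neq.
  have hp : 0 < `|h| by rewrite normr_gt0.
  rewrite normrM normfV ler_pdivrMl//.
  apply: le_trans (hC h) _.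
  have he : `|h| <= e / (C + 1).
    near: h; apply: dnbhs0_le; rewrite divr_gt0//; lra.
  have : C * `|h| <= e.
    apply: (@le_trans _ _ ((C + 1) * `|h|)); first by rewrite ler_wpM2r ?ltW//; lra.
    by rewrite mulrC -ler_pdivlMr//; lra.
  move=> Ce; have -> : C * `|h| ^+ 2 = `|h| * (C * `|h|) by ring.
  by rewrite ler_wpM2l// ltW.
Unshelve. all: by end_near. Qed.

(** A class of functions closed under partial derivatives, so that existence and continuity of all
    iterated partials follow from one induction. Positivity everywhere keeps inverses, roots and
    logarithms away from their singularities; [ebump] supplies compact supports. *)
Inductive elementary : (R * R -> R) -> Prop :=
| elementary_cst c : elementary (fun=> c)
| elementary_fst : elementary fst
| elementary_snd : elementary snd
| elementary_add f g : elementary f -> elementary g ->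
    elementary (fun x => f x + g x)
| elementary_mul f g : elementary f -> elementary g ->
    elementary (fun x => f x * g x)
| elementary_inv f : (forall x, 0 < f x) -> elementary f ->
    elementary (fun x => (f x)^-1)
| elementary_sqrt f : (forall x, 0 < f x) -> elementary f ->
    elementary (fun x => Num.sqrt (f x))
| elementary_ln f : (forall x, 0 < f x) -> elementary f ->
    elementary (fun x => ln (f x))
| elementary_ebump Q f : elementary f -> elementary (fun x => ebump Q (f x)).

Lemma elementary_opp f : elementary f -> elementary (fun x => - f x).
Proof.
move=> ef; rewrite (_ : (fun _ => _) = (fun x => -1 * f x)); last first.
  by apply/funext => x; rewrite mulN1r.
by apply: elementary_mul => //; exact: elementary_cst.
Qed.

Lemma elementary_sub f g : elementary f -> elementary g ->
  elementary (fun x => f x - g x).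
Proof. by move=> ef eg; apply: elementary_add => //; exact: elementary_opp. Qed.

Lemma elementary_exp f n : elementary f -> elementary (fun x => f x ^+ n).
Proof.
move=> ef; elim: n => [|n IH]; first exact: elementary_cst.
rewrite (_ : (fun _ => _) = (fun x => f x * f x ^+ n)); first exact: elementary_mul.
by apply/funext => x; rewrite exprS.
Qed.

Lemma is_derive_fst x v : is_derive x v (fst : R * R -> R) v.1.
Proof.
apply/is_derive_line => /=.
have -> : (fun h : R => (h *: v + x).1) = (fun h : R => h * v.1 + x.1) by [].
by apply: is_derive_eq; rewrite /GRing.scale /=; ring.
Qed.

Lemma is_derive_snd x v : is_derive x v (snd : R * R -> R) v.2.
Proof.
apply/is_derive_line => /=.
have -> : (fun h : R => (h *: v + x).2) = (fun h : R => h * v.2 + x.2) by [].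
by apply: is_derive_eq; rewrite /GRing.scale /=; ring.
Qed.

Lemma elementary_continuous f : elementary f -> continuous f.
Proof.
elim=> {f}.
- by move=> c x; exact: cvg_cst.
- by move=> x; exact: cvg_fst.
- by move=> x; exact: cvg_snd.
- by move=> f g _ cf _ cg x; apply: cvgD; [exact: cf|exact: cg].
- by move=> f g _ cf _ cg x; apply: cvgM; [exact: cf|exact: cg].
- by move=> f f0 _ cf x; apply: cvgV; [rewrite gt_eqF|exact: cf].
- move=> f f0 _ cf x; apply: (@cvg_comp _ _ _ f); first exact: cf.
  exact: sqrt_continuous.
- move=> f f0 _ cf x; apply: (@cvg_comp _ _ _ f); first exact: cf.
  exact: continuous_ln.
- move=> Q f _ cf x; apply: (@cvg_comp _ _ _ f); first exact: cf.
  exact: (continuous_is_derive (is_derive_ebump Q)).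
Qed.

Lemma elementary_is_derive f (i : 'I_2) : elementary f ->
  exists2 g, elementary g & forall x, is_derive x (basis_vec R i) f (g x).
Proof.
elim=> {f}.
- by move=> c; exists (fun=> 0); [exact: elementary_cst|move=> x; exact: is_derive_cst].
- exists (fun=> (basis_vec R i).1); [exact: elementary_cst|move=> x; exact: is_derive_fst].
- exists (fun=> (basis_vec R i).2); [exact: elementary_cst|move=> x; exact: is_derive_snd].
- move=> f g ef [f' ef' df] eg [g' eg' dg]; exists (fun x => f' x + g' x).
    exact: elementary_add.
  by move=> x; exact: is_deriveD.
- move=> f g ef [f' ef' df] eg [g' eg' dg].
  exists (fun x => f x * g' x + g x * f' x).
    by apply: elementary_add; exact: elementary_mul.
  by move=> x; exact: is_deriveM.
- move=> f f0 ef [f' ef' df]; exists (fun x => - ((f x)^-1 ^+ 2) * f' x).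
    apply: elementary_mul => //; apply: elementary_opp; apply: elementary_exp.
    exact: elementary_inv.
  move=> x; apply: (is_derive_comp_line (phi := fun t => t^-1)) => //.
  have fx0 : f x != 0 by rewrite gt_eqF.
  have := @is_deriveV R id (f x) 1 1 fx0 _.
  by move=> /(_ _)/is_derive_eq; apply; rewrite exprVn /GRing.scale /= mulr1.
- move=> f f0 ef [f' ef' df]; exists (fun x => (2 * Num.sqrt (f x))^-1 * f' x).
    apply: elementary_mul => //; apply: elementary_inv.
      by move=> x; rewrite mulr_gt0 ?sqrtr_gt0.
    by apply: elementary_mul; [exact: elementary_cst|exact: elementary_sqrt].
  by move=> x; apply: (is_derive_comp_line (phi := Num.sqrt)) => //; exact: is_derive1_sqrt.
- move=> f f0 ef [f' ef' df]; exists (fun x => (f x)^-1 * f' x).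
    by apply: elementary_mul => //; exact: elementary_inv.
  by move=> x; apply: (is_derive_comp_line (phi := @ln R)) => //; exact: is_derive1_ln.
- move=> Q f ef [f' ef' df]; exists (fun x => ebump (ebump_deriv Q) (f x) * f' x).
    by apply: elementary_mul => //; exact: elementary_ebump.
  by move=> x; apply: (is_derive_comp_line (phi := ebump Q)) => //; exact: is_derive_ebump.
Qed.

Lemma elementary_partial f i : elementary f -> elementary (partial i f).
Proof.
move=> /(elementary_is_derive i)[g eg dg].
by rewrite (_ : partial i f = g)//; apply/funext => x; have [_] := dg x.
Qed.

Lemma elementary_derivable f i x : elementary f -> derivable f x (basis_vec R i).
Proof. by move=> /(elementary_is_derive i)[g _ dg]; have [] := dg x. Qed.

Lemma elementary_smooth f : elementary f -> smooth f.
Proof.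
move=> ef s.
have es : elementary (iter_partial s f).
  by elim: s => //= i s; exact: elementary_partial.
by split=> [|i x]; [exact: elementary_continuous|exact: elementary_derivable].
Qed.

Lemma smooth_partial f i : smooth f -> smooth (partial i f).
Proof.
move=> sf s; have -> : iter_partial s (partial i f) = iter_partial (rcons s i) f.
  by rewrite /iter_partial foldr_rcons.
exact: sf.
Qed.

Lemma test_function_partial f i : test_function f -> test_function (partial i f).
Proof.
move=> [sf [K [cK KD f0]]]; split; first exact: smooth_partial.
exists K; split=> // x nKx.
have : nbhs x (~` K).
  apply: open_nbhs_nbhs; split=> //; apply: closed_openC.
  by apply: compact_closed => //; exact: norm_hausdorff.
move=> nK; rewrite /partial (@near_eq_derive _ _ _ _ (cst 0)); last first.
  by near=> y; rewrite f0//; near: y.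
by have [_] := is_derive_cst (0 : R) x (basis_vec R i).
Unshelve. all: by end_near. Qed.
End Elementary.

(** * Integrals of real-valued functions *)

Section IntegralHelpers.
Context {R : realType} d (T : measurableType d) (m : {measure set T -> \bar R}).
Implicit Types (f g : T -> R) (D K : set T).

Lemma le_integrable_real D f g : measurable D -> measurable_fun D f ->
  (forall x, D x -> `|f x| <= g x) ->
  m.-integrable D (EFin \o g) -> m.-integrable D (EFin \o f).
Proof.
move=> mD mf fg; apply: le_integrable => //; first exact/measurable_EFinP.
move=> x Dx /=; rewrite lee_fin.
by apply: (le_trans (fg x Dx)); exact: ler_norm.
Qed.

Lemma patch_support D f : (forall x, ~ D x -> f x = 0) -> f \_ D = f.
Proof.
move=> f0; apply/funext => x; rewrite patchE; case: ifPn => //.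
by rewrite notin_setE => /f0.
Qed.

Lemma Rintegral_support D f : (forall x, ~ D x -> f x = 0) ->
  \int[m]_(x in D) f x = \int[m]_x f x.
Proof. by move=> f0; rewrite Rintegral_mkcond patch_support. Qed.

Lemma integrable_support D f : measurable D -> (forall x, ~ D x -> f x = 0) ->
  m.-integrable D (EFin \o f) <-> m.-integrable setT (EFin \o f).
Proof.
move=> mD f0; rewrite (integrable_mkcond _ mD).
by rewrite restrict_EFin patch_support.
Qed.

Lemma Rintegral_ae_eq D f g : measurable D -> measurable_fun D f ->
  measurable_fun D g -> {ae m, forall x, D x -> f x = g x} ->
  \int[m]_(x in D) f x = \int[m]_(x in D) g x.
Proof.
move=> mD mf mg fg; rewrite /Rintegral; congr fine.
apply: ae_eq_integral => //; [exact/measurable_EFinP|exact/measurable_EFinP|].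
by apply: filterS fg => x fgx Dx /=; rewrite fgx.
Qed.

Lemma Rdominated_cvg D (f_ : nat -> T -> R) f g : measurable D ->
  (forall n, measurable_fun D (f_ n)) ->
  (forall x, D x -> f_ n x @[n --> \oo] --> f x) ->
  m.-integrable D (EFin \o g) ->
  (forall n x, D x -> `|f_ n x| <= g x) ->
  m.-integrable D (EFin \o f) /\
  \int[m]_(x in D) f_ n x @[n --> \oo] --> \int[m]_(x in D) f x.
Proof.
move=> mD mf ff ig fg.
have mlim : measurable_fun D f by exact: measurable_fun_cvg ff.
have fle x : D x -> `|f x| <= g x.
  move=> Dx; have cf : `|f_ n x| @[n --> \oo] --> `|f x| by apply: cvg_norm; exact: ff.
  rewrite -(cvg_lim _ cf)//; apply: limr_le; first by apply/cvg_ex; exists `|f x|.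
  by apply: nearW => n; exact: fg.
have fi : m.-integrable D (EFin \o f) by exact: le_integrable_real fle ig.
split=> //; rewrite /Rintegral; apply: fine_cvg.
rewrite fineK; last exact: integrable_fin_num.
apply: (@dominated_cvg _ _ _ m D mD (fun n x => (f_ n x)%:E) (EFin \o f) (EFin \o g)) => //.
- by move=> n; exact/measurable_EFinP.
- by move=> x Dx; apply: cvg_EFin; [exact: nearW|exact: ff].
Qed.

Lemma integrableD_real D f g : measurable D -> m.-integrable D (EFin \o f) ->
  m.-integrable D (EFin \o g) -> m.-integrable D (EFin \o (fun x => f x + g x)).
Proof. by move=> mD fi gi; have := integrableD mD fi gi. Qed.

Lemma integrableB_real D f g : measurable D -> m.-integrable D (EFin \o f) ->
  m.-integrable D (EFin \o g) -> m.-integrable D (EFin \o (fun x => f x - g x)).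
Proof. by move=> mD fi gi; have := integrableB mD fi gi. Qed.

Lemma integrableZ_real D (k : R) f : measurable D -> m.-integrable D (EFin \o f) ->
  m.-integrable D (EFin \o (fun x => k * f x)).
Proof. by move=> mD fi; have := integrableZl mD k fi. Qed.

Lemma Rintegral_comb2 D f g a b : measurable D -> m.-integrable D (EFin \o f) ->
  m.-integrable D (EFin \o g) ->
  \int[m]_(x in D) (f x * a + g x * b) =
  \int[m]_(x in D) f x * a + \int[m]_(x in D) g x * b.
Proof.
move=> mD fi gi; rewrite -!RintegralZr// -RintegralD//.
- have := integrableZ_real a mD fi.
  by congr (m.-integrable D (EFin \o _)); apply/funext => x; rewrite mulrC.
- have := integrableZ_real b mD gi.
  by congr (m.-integrable D (EFin \o _)); apply/funext => x; rewrite mulrC.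
Qed.

Lemma integrableM_bounded D f g (M : R) : measurable D ->
  m.-integrable D (EFin \o f) -> measurable_fun D g ->
  (forall x, D x -> `|g x| <= M) -> m.-integrable D (EFin \o (fun x => f x * g x)).
Proof.
move=> mD fi mg gM.
have mf : measurable_fun D f by apply/measurable_EFinP; exact: measurable_int fi.
apply: (@le_integrable_real _ _ (fun x => `|f x| * M)) => //.
- exact: measurable_realfun.measurable_funM.
- by move=> x Dx; rewrite normrM ler_wpM2l// gM.
- have -> : EFin \o (fun x => `|f x| * M) = (fun x => (M%:E * (EFin \o (Num.Def.normr \o f)) x)%E).
    by apply/funext => x /=; rewrite mulrC.
  apply: integrableZl => //.
  rewrite (_ : EFin \o (Num.Def.normr \o f) = abse \o (EFin \o f))//.
  exact: integrable_abse.
Qed.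
End IntegralHelpers.

(** * The fundamental lemma of the calculus of variations *)

Section FundamentalLemma.
Context {R : realType}.
Local Notation L := (@lebesgue_measure R).
Local Notation plane := (measurableTypeR R * measurableTypeR R)%type.
Local Notation mu := (L \x L)%E.
Implicit Types (f g phi : R * R -> R).

Lemma plane_measureE : plane_measure R = mu :> {measure set plane -> \bar R}.
Proof. by []. Qed.

Lemma plane_aeS (P Q : R * R -> Prop) : (forall x, P x -> Q x) ->
  {ae mu, forall x, P x} -> {ae mu, forall x, Q x}.
Proof. by move=> PQ; apply: (@filterS _ (almost_everywhere mu)). Qed.

Lemma disc_sqnorm : @disc R = [set x | x.1 ^+ 2 + x.2 ^+ 2 < 1].
Proof.
apply/seteqP; split=> x; rewrite /disc /euclid /= => h.
  by rewrite -[ltLHS]sqr_sqrtr ?addr_ge0 ?sqr_ge0// expr_lt1 ?sqrtr_ge0.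
by rewrite -sqrtr1 ltr_sqrt.
Qed.

Lemma sqnorm_continuous : continuous (fun x : R * R => x.1 ^+ 2 + x.2 ^+ 2).
Proof.
apply: elementary_continuous; apply: elementary_add; apply: elementary_exp.
  exact: elementary_fst.
exact: elementary_snd.
Qed.

Lemma open_disc : open (@disc R).
Proof.
rewrite disc_sqnorm.
have /continuousP := sqnorm_continuous.
by move=> /(_ [set y | y < 1]); apply; exact: open_lt.
Qed.

Lemma measurable_disc : measurable (@disc R : set plane).
Proof. by apply: plane_open_measurable; exact: open_disc. Qed.

Lemma measure_disc : mu (@disc R) = pi%:E.
Proof. by rewrite disc_sqnorm disc_area// mulr1. Qed.

Definition cbox (a b c d : R) : set (R * R) := `[a, b] `*` `[c, d].

Lemma compact_cbox a b c d : compact (cbox a b c d).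
Proof. by apply: compact_setX; exact: segment_compact. Qed.

Lemma sub_obox_cbox a b c d : obox a b c d `<=` cbox a b c d.
Proof. by move=> x [] /= h1 h2; split; apply: subset_itv_oo_cc. Qed.

Lemma test_function_bounded phi : test_function phi ->
  exists M, forall x, `|phi x| <= M.
Proof.
move=> [sphi [K [cK _ phi0]]]; have [cphi _] := sphi [::].
have : compact (phi @` K).
  by apply: continuous_compact => //; exact: continuous_subspaceT.
move=> /compact_bounded[M [_ hM]]; exists (`|M| + 1) => x.
have [Kx|/phi0->] := pselect (K x); last by rewrite normr0 addr_ge0.
apply: (hM (`|M| + 1)); last by exists x.
by rewrite (le_lt_trans (ler_norm M))// ltrDl.
Qed.

Lemma test_function_measurable phi : test_function phi ->
  measurable_fun setT (phi : plane -> measurableTypeR R).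
Proof. by move=> [/(_ [::])[cphi _] _]; exact: plane_continuous_measurable. Qed.

Lemma locally_L1_test f phi : locally_L1 f -> test_function phi ->
  mu.-integrable setT (EFin \o (fun x => f x * phi x)).
Proof.
move=> f1 tphi; have [M hM] := test_function_bounded tphi.
have [_ [K [cK KD phi0]]] := tphi.
have mK := plane_compact_measurable cK.
apply/(@integrable_support _ _ _ mu K) => //.
  by move=> x /phi0->; rewrite mulr0.
apply: (@integrableM_bounded _ _ _ _ _ _ _ M) => //.
  exact: f1.
by apply: measurable_funTS; exact: test_function_measurable.
Qed.

Lemma Rintegral_test f phi : test_function phi ->
  \int[mu]_(x in @disc R) (f x * phi x) = \int[mu]_x (f x * phi x).
Proof.
move=> [_ [K [_ KD phi0]]]; apply: Rintegral_support => x Dx.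
by rewrite phi0 ?mulr0// => /KD.
Qed.

(* [ebump 1 t = exp(-1/t)] for t > 0, so that the four factors tend to the
   indicator function of the open box as k grows. *)
Definition box_bump (a b c d k : R) (x : R * R) : R :=
  ebump 1 (k * (x.1 - a)) * ebump 1 (k * (b - x.1)) *
  (ebump 1 (k * (x.2 - c)) * ebump 1 (k * (d - x.2))).

Lemma ebump1_itv (t : R) : 0 <= ebump 1 t <= 1.
Proof.
rewrite /ebump; case: ifPn => t0; last by rewrite lexx ler01.
rewrite hornerC mul1r expR_ge0 /= -expR0 ler_expR oppr_le0 invr_ge0 ltW//.
Qed.

Lemma ebump_le0 (Q : {poly R}) (t : R) : t <= 0 -> ebump Q t = 0.
Proof. by rewrite /ebump leNgt => /negbTE->. Qed.

Lemma elementary_box_bump a b c d k : elementary (box_bump a b c d k).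
Proof.
rewrite /box_bump.
by repeat first [apply: elementary_mul | apply: elementary_ebump
  | apply: elementary_sub | exact: elementary_cst | exact: elementary_fst
  | exact: elementary_snd].
Qed.

Lemma box_bump_itv a b c d k x : 0 <= box_bump a b c d k x <= 1.
Proof.
have h (u v : R) : 0 <= u <= 1 -> 0 <= v <= 1 -> 0 <= u * v <= 1.
  by move=> /andP[u0 u1] /andP[v0 v1]; rewrite mulr_ge0//= mulr_ile1.
by apply: (h _ _); apply: (h _ _); exact: ebump1_itv.
Qed.

Lemma box_bump_out a b c d k x : 0 < k -> ~ obox a b c d x ->
  box_bump a b c d k x = 0.
Proof.
move=> k0 nx; rewrite /box_bump.
have [h1|h1] := leP x.1 a.
  by rewrite [ebump 1 (k * (x.1 - a))]ebump_le0 ?mul0r// pmulr_rle0// subr_le0.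
have [h2|h2] := leP b x.1.
  by rewrite [ebump 1 (k * (b - x.1))]ebump_le0 ?mulr0 ?mul0r// pmulr_rle0// subr_le0.
have [h3|h3] := leP x.2 c.
  by rewrite [ebump 1 (k * (x.2 - c))]ebump_le0 ?mul0r ?mulr0// pmulr_rle0// subr_le0.
have [h4|h4] := leP d x.2.
  by rewrite [ebump 1 (k * (d - x.2))]ebump_le0 ?mulr0// pmulr_rle0// subr_le0.
by exfalso; apply: nx; split; rewrite /= in_itv /= ?h1 ?h2 ?h3 ?h4.
Qed.

Lemma test_function_box_bump a b c d k : 0 < k -> cbox a b c d `<=` @disc R ->
  test_function (box_bump a b c d k).
Proof.
move=> k0 KD; split; first exact/elementary_smooth/elementary_box_bump.
exists (cbox a b c d); split=> //; first exact: compact_cbox.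
by move=> x nx; apply: box_bump_out => // /sub_obox_cbox.
Qed.

Lemma cvg_ebump1 (t : R) : 0 < t ->
  ebump 1 (n.+1%:R * t) @[n --> \oo] --> (1 : R).
Proof.
move=> t0.
have -> : (fun n => ebump 1 (n.+1%:R * t)) = (fun n => expR (- (n.+1%:R^-1 * t^-1))).
  apply/funext => n; rewrite /ebump ifT ?mulr_gt0//.
  by rewrite hornerC mul1r invfM.
have h0 : (fun n : nat => - (n.+1%:R^-1 * t^-1)) @ \oo --> (- (0 * t^-1) : R).
  by apply: cvgN; apply: cvgM; [exact: cvg_harmonic|exact: cvg_cst].
rewrite mul0r oppr0 in h0.
by rewrite -[X in _ --> X]expR0; apply: (cvg_comp _ _ h0); exact: continuous_expR.
Qed.

Lemma cvg_box_bump a b c d x :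
  box_bump a b c d n.+1%:R x @[n --> \oo] --> (\1_(obox a b c d) x : R).
Proof.
have [xB|xB] := pselect (obox a b c d x); last first.
  rewrite indicE memNset//=; apply: cvg_near_cst; apply: nearW => n.
  by rewrite box_bump_out.
rewrite indicE mem_set//=; case: xB => /=; rewrite !in_itv /= => /andP[h1 h2] /andP[h3 h4].
rewrite [X in _ --> X](_ : _ = 1 * 1 * (1 * 1)); last by rewrite !mulr1.
by apply: cvgM; apply: cvgM; apply: cvg_ebump1; rewrite subr_gt0.
Qed.

(** The box bumps are test functions with values in [0, 1] that tend to the indicator function of
    the box, and |g| dominates the products on the closed box. *)
Lemma Rintegral_obox_eq0 g a b c d : locally_L1 g -> cbox a b c d `<=` @disc R ->
  (forall phi, test_function phi -> \int[mu]_x (g x * phi x) = 0) ->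
  \int[mu]_(x in obox a b c d) g x = 0.
Proof.
move=> g1 KD g0.
have mK := plane_compact_measurable (compact_cbox (a := a) (b := b) (c := c) (d := d)).
have gK : mu.-integrable (cbox a b c d) (EFin \o g).
  by apply: g1 => //; exact: compact_cbox.
have mgK : measurable_fun (cbox a b c d) g.
  by apply/measurable_EFinP; exact: measurable_int gK.
have [||||_] := @Rdominated_cvg _ _ _ mu (cbox a b c d)
  (fun n x => g x * box_bump a b c d n.+1%:R x) (fun x => g x * \1_(obox a b c d) x)
  (Num.Def.normr \o g) mK.
- move=> n; apply: measurable_realfun.measurable_funM => //.
  apply: measurable_funTS; apply: plane_continuous_measurable.
  exact/elementary_continuous/elementary_box_bump.
- by move=> x _; apply: cvgM; [exact: cvg_cst|exact: cvg_box_bump].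
- by rewrite (_ : EFin \o _ = abse \o (EFin \o g))//; exact: integrable_abse.
- move=> n x _ /=; rewrite normrM ler_piMr//.
  by have /andP[h1 h2] := box_bump_itv a b c d n.+1%:R x; rewrite ger0_norm.
have -> : (fun n : nat => \int[mu]_(x in cbox a b c d) (g x * box_bump a b c d n.+1%:R x))
    = (fun=> 0).
  apply/funext => n; rewrite Rintegral_support; last first.
    by move=> x nx; rewrite box_bump_out ?mulr0// => /sub_obox_cbox.
  by apply: g0; exact: test_function_box_bump.
rewrite Rintegral_support; last first.
  by move=> x nx; rewrite indicE memNset ?mulr0// => /sub_obox_cbox.
have -> : \int[mu]_x (g x * \1_(obox a b c d) x) = \int[mu]_(x in obox a b c d) g x.
  rewrite [RHS]Rintegral_mkcond; apply: eq_Rintegral => x _.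
  by rewrite patchE indicE; case: (x \in _); rewrite ?mulr1 ?mulr0.
by move=> h; apply/esym; apply: (cvg_unique _ (cvg_cst _) h).
Qed.

(** The sets [A] for which the integral of [g] over [A] intersected with the box vanishes form a
    Dynkin system. It contains all open boxes, hence all measurable sets, and a function all of
    whose integrals vanish is zero almost everywhere. *)
Lemma ae_eq0_obox g a b c d : locally_L1 g -> cbox a b c d `<=` @disc R ->
  (forall phi, test_function phi -> \int[mu]_x (g x * phi x) = 0) ->
  {ae mu, forall x, obox a b c d x -> g x = 0}.
Proof.
move=> g1 KD g0.
set B := obox a b c d; have mB : measurable (B : set plane) by exact: measurable_obox.
have mK := plane_compact_measurable (compact_cbox (a := a) (b := b) (c := c) (d := d)).
have gB : mu.-integrable B (EFin \o g).
  apply: (integrableS mK) => //; first exact: sub_obox_cbox.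
  by apply: g1 => //; exact: compact_cbox.
have gE (E : set plane) : measurable E -> E `<=` B -> mu.-integrable E (EFin \o g).
  by move=> mE EB; exact: integrableS gB.
have gO a' b' c' d' : cbox a' b' c' d' `<=` cbox a b c d ->
    obox a' b' c' d' `<=` B -> (\int[mu]_(x in obox a' b' c' d') (g x)%:E = 0)%E.
  move=> sK sB; have := @Rintegral_obox_eq0 g a' b' c' d' g1 (subset_trans sK KD) g0.
  rewrite /Rintegral => h; rewrite -[LHS]fineK ?h//.
  by apply: integrable_fin_num; [exact: measurable_obox|exact: gE (measurable_obox _ _ _ _) sB].
have key (A : set plane) : measurable A -> (\int[mu]_(x in A `&` B) (g x)%:E = 0)%E.
  rewrite measurable_sigma_oboxes; move: A.
  apply: (dynkin_induction (P := fun A : set plane => (\int[mu]_(x in A `&` B) (g x)%:E = 0)%E)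
      measurable_sigma_oboxes setI_closed_oboxes).
  - by rewrite setTI; exact: gO.
  - move=> _ [a' [b' [c' [d' ->]]]].
    have E : obox a' b' c' d' `&` B =
        obox (Num.max a' a) (Num.min b' b) (Num.max c' c) (Num.min d' d).
      apply/seteqP; split => -[x y]; rewrite /B /obox /= !in_itv /= !gt_max !lt_min.
        by move=> [[/andP[-> ->] /andP[-> ->]] [/andP[-> ->] /andP[-> ->]]].
      by move=> [/andP[/andP[-> ->] /andP[-> ->]] /andP[/andP[-> ->] /andP[-> ->]]].
    rewrite E; apply: gO; last by rewrite -E; exact: subIsetr.
    move=> -[x y]; rewrite /cbox /= !in_itv /= !ge_max !le_min.
    by move=> [/andP[/andP[_ ->] /andP[_ ->]] /andP[/andP[_ ->] /andP[_ ->]]].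
  - move=> A mA A0.
    have mAB : measurable (A `&` B) by exact: measurableI.
    have mCAB : measurable (~` A `&` B) by apply: measurableI => //; exact: measurableC.
    have := @integral_setU_EFin _ _ _ mu (A `&` B) (~` A `&` B) g mAB mCAB.
    rewrite -setIUl setUv setTI gO// A0 add0e => -> //.
    + by apply/measurable_EFinP; exact: measurable_int gB.
    + by apply/disj_setPS; rewrite setIACA setICr set0I.
  - move=> F mF tF F0; rewrite setI_bigcupl integral_bigcup//.
    + by apply: eseries0 => n _ _.
    + exact: trivIset_setIr.
    + by move=> n; exact: measurableI.
    + apply: gE; last by move=> x [n _ []].
      by apply: bigcup_measurable => n _; exact: measurableI.
have : ae_eq mu B (EFin \o g) (cst 0%E).
  apply: integral_ae_eq => // E EB mE.
  rewrite integral0; have := key E mE.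
  by rewrite (_ : E `&` B = E)//; exact: setIidl.
by apply: filterS => x h Bx; have [] := h Bx.
Qed.

(** The disc is a countable union of rational boxes with closure in the disc, and [ae_eq0_obox]
    applies to each of them. *)
Lemma fundamental_lemma g : locally_L1 g ->
  (forall phi, test_function phi -> \int[mu]_x (g x * phi x) = 0) ->
  {ae mu, forall x, @disc R x -> g x = 0}.
Proof.
move=> g1 g0.
pose B (p : rat * rat * rat) : set (R * R) :=
  let e := ratr p.2 : R in
  obox (ratr p.1.1 - e) (ratr p.1.1 + e) (ratr p.1.2 - e) (ratr p.1.2 + e).
pose K (p : rat * rat * rat) : set (R * R) :=
  let e := ratr p.2 : R in
  cbox (ratr p.1.1 - e) (ratr p.1.1 + e) (ratr p.1.2 - e) (ratr p.1.2 + e).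
have cover x : @disc R x -> exists p, K p `<=` @disc R /\ B p x.
  move: x => [x y] Dx.
  have /nbhs_ballP[e /= e0 eU] : nbhs (x, y) (@disc R).
    by apply: open_nbhs_nbhs; split => //; exact: open_disc.
  have [r /andP[r0 re]] : exists r : rat, (0 < ratr r :> R) && (ratr r < e / 2).
    have [r] := @rat_in_itvoo R 0 (e / 2) ltac:(lra).
    by rewrite in_itv /=; exists r.
  have near_rat (z : R) : exists q : rat, `|ratr q - z| < ratr r.
    have [q] := @rat_in_itvoo R (z - ratr r) (z + ratr r) ltac:(lra).
    by rewrite in_itv /= => /andP[q1 q2]; exists q; rewrite ltr_norml; lra.
  have [q1 xq] := near_rat x; have [q2 yq] := near_rat y.
  exists (q1, q2, r); move: xq yq; rewrite !ltr_norml => /andP[x1 x2] /andP[y1 y2].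
  split; last by split; rewrite /= in_itv /=; lra.
  move=> [a b] [] /=; rewrite !in_itv /= => /andP[a1 a2] /andP[b1 b2].
  by apply: eU; split; rewrite /ball /= ltr_norml; lra.
(* [unpickle] enumerates the rational boxes, so that only countably many null sets are united. *)
pose P (n : nat) (x : R * R) :=
  if unpickle n is Some p then K p `<=` @disc R -> B p x -> g x = 0 else True.
have : {ae mu, forall x n, P n x}.
  apply: ae_foralln => n; rewrite /P; case: (unpickle n) => [p|]; last exact: aeW.
  have [KD|nKD] := pselect (K p `<=` @disc R); last by apply: aeW => x /nKD.
  have BpE : {ae mu, forall x, B p x -> g x = 0} by exact: ae_eq0_obox g1 KD g0.
  by apply: plane_aeS BpE => x h _.
apply: plane_aeS => x h /cover[p [KD Bx]].
by have := h (pickle p); rewrite /P pickleK; exact.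
Qed.
End FundamentalLemma.

(** * Weak derivatives on the disc *)

Section WeakDerivatives.
Context {R : realType}.
Local Notation L := (@lebesgue_measure R).
Local Notation plane := (measurableTypeR R * measurableTypeR R)%type.
Local Notation mu := (L \x L)%E.
Implicit Types (f g phi : R * R -> R) (i : 'I_2).

Lemma compact_sub_cbox (K : set (R * R)) : compact K ->
  exists2 M : R, 0 < M & forall x, K x -> `|x.1| < M /\ `|x.2| < M.
Proof.
move=> /compact_bounded[M [_ hM]]; exists (`|M| + 2) => [|x Kx].
  by rewrite ltr_wpDl.
have : `|x| <= `|M| + 1.
  by apply: hM Kx; rewrite (le_lt_trans (ler_norm M))// ltrDl.
by rewrite prod_normE ge_max => /andP[h1 h2]; split; lra.
Qed.

Lemma measure_cbox_lty a b c d : (mu (cbox a b c d) < +oo)%E.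
Proof.
rewrite /cbox product_measure1E//= !lebesgue_measure_itv /=.
by case: ifP => _; case: ifP => _; rewrite ?mule0 ?mul0e -?EFinD -?EFinM ltry.
Qed.

Lemma measurable_cbox a b c d : measurable (cbox a b c d : set plane).
Proof. by apply: plane_compact_measurable; exact: compact_cbox. Qed.

Lemma measure_compact_lty (K : set (R * R)) : compact K -> (mu K < +oo)%E.
Proof.
move=> cK; have [M M0 hM] := compact_sub_cbox cK.
apply: le_lt_trans (measure_cbox_lty (- M) M (- M) M).
apply: le_measure; rewrite ?inE.
- exact: plane_compact_measurable.
- exact: measurable_cbox.
- by move=> x /hM[]; rewrite !ltr_norml => /andP[a b] /andP[c d]; split; rewrite /= in_itv /= !ltW.
Qed.

Lemma continuous_bounded_on_compact f (K : set (R * R)) : continuous f ->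
  compact K -> exists2 M, 0 <= M & forall x, K x -> `|f x| <= M.
Proof.
move=> cf cK; have : compact (f @` K).
  by apply: continuous_compact => //; exact: continuous_subspaceT.
move=> /compact_bounded[M [_ hM]]; exists (`|M| + 1) => [|x Kx].
  by rewrite addr_ge0.
by apply: (hM (`|M| + 1)); [rewrite (le_lt_trans (ler_norm M))// ltrDl|exists x].
Qed.

Lemma continuous_integrable_compact f (K : set (R * R)) : continuous f ->
  compact K -> mu.-integrable K (EFin \o f).
Proof.
move=> cf cK; have mK := plane_compact_measurable cK.
have [M M0 hM] := continuous_bounded_on_compact cf cK.
apply: measurable_bounded_integrable => //.
- exact: measure_compact_lty.
- by apply: measurable_funTS; exact: plane_continuous_measurable.
- by exists M; split=> [|r Mr x Kx]; rewrite ?num_real//; apply: le_trans (hM _ Kx) (ltW Mr).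
Qed.

Lemma continuous_locally_L1 f : continuous f -> locally_L1 f.
Proof. by move=> cf K cK _; exact: continuous_integrable_compact. Qed.

Lemma continuous_support_integrable f (K : set (R * R)) : continuous f ->
  compact K -> (forall x, ~ K x -> f x = 0) -> mu.-integrable setT (EFin \o f).
Proof.
move=> cf cK f0; have mK := plane_compact_measurable cK.
apply/(@integrable_support _ _ _ mu K) => //.
exact: continuous_integrable_compact.
Qed.

Lemma is_derive_slice1 f (x : R * R) df :
  is_derive x (basis_vec R 0) f df -> is_derive x.1 (1 : R) (fun t => f (t, x.2)) df.
Proof.
have E : (fun h : R => h^-1 *: ((f \o shift x) (h *: basis_vec R 0) - f x)) =
    (fun h : R => h^-1 *: (((fun t => f (t, x.2)) \o shift x.1) (h *: (1 : R))
       - f (x.1, x.2))).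
  apply/funext => h; rewrite -surjective_pairing; congr (_ *: (f _ - _)).
  case: x => a b; rewrite /basis_vec /= /shift /=.
  by congr (_, _); rewrite /= [h *: 0]mulr0 add0r.
by move=> [dx <-]; split; rewrite /derivable /derive /= -?E.
Qed.

Lemma is_derive_slice2 f (x : R * R) df :
  is_derive x (basis_vec R 1) f df -> is_derive x.2 (1 : R) (fun t => f (x.1, t)) df.
Proof.
have E : (fun h : R => h^-1 *: ((f \o shift x) (h *: basis_vec R 1) - f x)) =
    (fun h : R => h^-1 *: (((fun t => f (x.1, t)) \o shift x.2) (h *: (1 : R))
       - f (x.1, x.2))).
  apply/funext => h; rewrite -surjective_pairing; congr (_ *: (f _ - _)).
  case: x => a b; rewrite /basis_vec /= /shift /=.
  by congr (_, _); rewrite /= [h *: 0]mulr0 add0r.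
by move=> [dx <-]; split; rewrite /derivable /derive /= -?E.
Qed.

Lemma derive_support f f' i (K : set (R * R)) : closed K ->
  (forall x, is_derive x (basis_vec R i) f (f' x)) ->
  (forall x, ~ K x -> f x = 0) -> forall x, ~ K x -> f' x = 0.
Proof.
move=> cK df f0 x nKx.
have : nbhs x (~` K) by apply: open_nbhs_nbhs; split=> //; exact: closed_openC.
move=> nK; have [_ <-] := df x.
rewrite (@near_eq_derive _ _ _ _ (cst 0)); last by near=> y; rewrite f0//; near: y.
by have [_] := is_derive_cst (0 : R) x (basis_vec R i).
Unshelve. all: by end_near. Qed.

Lemma integral1_derive_support (u u' : R -> R) (M : R) : 0 < M ->
  (forall t : R, is_derive t (1 : R) u (u' t)) -> continuous u' ->
  (forall t, M <= `|t| -> u t = 0 /\ u' t = 0) -> (\int[L]_t (u' t)%:E = 0)%E.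
Proof.
move=> M0 du cu u0.
rewrite (_ : (fun t => (u' t)%:E) = (fun t => (u' t)%:E) \_ `[(- M), M]%classic); last first.
  apply/funext => t; rewrite patchE; case: ifPn => //.
  rewrite notin_setE /= in_itv /= -ler_norml => /negP; rewrite -ltNge => /ltW /u0[_ ->//].
rewrite -integral_mkcond (integral_is_derive _ du)//; last by rewrite ge0_cp// ltW.
by rewrite (u0 M _).1 ?(u0 (- M) _).1 ?subrr// ?normrN ger0_norm// ltW.
Qed.

(** By Fubini one integrates first in the direction [i], where the fundamental theorem of calculus
    gives zero on each line because of the compact support. *)
Lemma Rintegral_partial_eq0 f f' i (K : set (R * R)) :
  (forall x, is_derive x (basis_vec R i) f (f' x)) -> continuous f' ->
  compact K -> (forall x, ~ K x -> f x = 0) -> \int[mu]_x f' x = 0.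
Proof.
move=> df cf cK f0.
have clK : closed K by apply: compact_closed => //; exact: norm_hausdorff.
have f'0 := derive_support clK df f0.
have fi := continuous_support_integrable cf cK f'0.
have [M M0 hM] := compact_sub_cbox cK.
have out1 x : M <= `|x.1| -> ~ K x by move=> h /hM[]; rewrite ltNge h.
have out2 x : M <= `|x.2| -> ~ K x by move=> h /hM[_]; rewrite ltNge h.
rewrite /Rintegral; case: (altP (i =P 0)) => i0.
  rewrite -(integral21_prod_meas1 fi) [X in fine X](_ : _ = 0%E)//.
  apply: integral0_eq => y _; rewrite /fubini_G /=.
  apply: (@integral1_derive_support (fun t => f (t, y)) (fun t => f' (t, y)) M) => //.
  - by move=> t; have := df (t, y); rewrite i0 => /is_derive_slice1.
  - move=> t; apply: (@cvg_comp _ _ _ (fun t : R => (t, y)) f'); last exact: cf.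
    by apply: (@cvg_pair _ _ _ (nbhs t) (nbhs t) (nbhs y)); [exact: cvg_id|exact: cvg_cst].
  - by move=> t Mt; rewrite f0 ?f'0//; exact: out1.
have {}i0 : i = 1 by apply/val_inj; case: i i0 {df} => -[|[|[]]].
rewrite -(integral12_prod_meas1 fi) [X in fine X](_ : _ = 0%E)//.
apply: integral0_eq => x _; rewrite /fubini_F /=.
apply: (@integral1_derive_support (fun t => f (x, t)) (fun t => f' (x, t)) M) => //.
- by move=> t; have := df (x, t); rewrite i0 => /is_derive_slice2.
- move=> t; apply: (@cvg_comp _ _ _ (fun t : R => (x, t)) f'); last exact: cf.
  by apply: (@cvg_pair _ _ _ (nbhs t) (nbhs x) (nbhs t)); [exact: cvg_cst|exact: cvg_id].
- by move=> t Mt; rewrite f0 ?f'0//; exact: out2.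
Qed.

Lemma test_is_derive phi i x : test_function phi ->
  is_derive x (basis_vec R i) phi (partial i phi x).
Proof. by move=> [/(_ [::])[_ /(_ i x)] h _]; apply: DeriveDef. Qed.

Lemma test_continuous phi : test_function phi -> continuous phi.
Proof. by move=> [/(_ [::])[]]. Qed.

(** By the product rule the sum of the two integrands is the partial derivative of [f * phi], which
    has compact support. *)
Lemma classical_weak_partial f f' i :
  (forall x, is_derive x (basis_vec R i) f (f' x)) ->
  continuous f -> continuous f' -> is_weak_partial i f f'.
Proof.
move=> df cf cf'; split; [exact: continuous_locally_L1..|move=> phi tphi].
have tdphi := test_function_partial i tphi.
rewrite plane_measureE !Rintegral_test//.
have i1 := locally_L1_test (continuous_locally_L1 cf) tdphi.
have i2 := locally_L1_test (continuous_locally_L1 cf') tphi.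
apply/eqP; rewrite -addr_eq0 -RintegralD//; apply/eqP.
have [_ [K [cK _ phi0]]] := tphi.
apply: (@Rintegral_partial_eq0 (fun x => f x * phi x) _ i K) => //.
- move=> x; have hphi := test_is_derive i x tphi.
  by apply: is_derive_eq; rewrite /GRing.scale /=; ring.
- move=> x; apply: cvgD; apply: cvgM; do ?[exact: cf|exact: cf'].
    exact: test_continuous tdphi _.
  exact: test_continuous tphi _.
- by move=> x /phi0->; rewrite mulr0.
Qed.

Lemma weak_partial_unique f g1 g2 i :
  is_weak_partial i f g1 -> is_weak_partial i f g2 ->
  {ae mu, forall x, @disc R x -> g1 x = g2 x}.
Proof.
move=> [_ l1 h1] [_ l2 h2].
have : {ae mu, forall x, @disc R x -> g1 x - g2 x = 0}.
  apply: fundamental_lemma.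
    move=> K cK KD; rewrite (_ : EFin \o _ = ((EFin \o g1) \- (EFin \o g2))%E)//.
    apply: integrableB; [exact: plane_compact_measurable|exact: l1|exact: l2].
  move=> phi tphi; have tdphi := test_function_partial i tphi.
  under eq_Rintegral do rewrite mulrBl.
  rewrite RintegralB//; try exact: locally_L1_test.
  have := h1 _ tphi; have := h2 _ tphi.
  rewrite plane_measureE !Rintegral_test// => -> /oppr_inj ->.
  by rewrite subrr.
by apply: plane_aeS => x h Dx; apply/eqP; rewrite -subr_eq0 h.
Qed.

Lemma weak_partialP f g i : is_weak_partial i f g ->
  is_weak_partial i f (weak_partial i f).
Proof. by move=> h; apply: xgetPex; exists g. Qed.

Lemma weak_partial_ae f g i : is_weak_partial i f g ->
  {ae mu, forall x, @disc R x -> weak_partial i f x = g x}.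
Proof. by move=> h; apply: weak_partial_unique (weak_partialP h) h. Qed.

(** Local integrability gives measurability on compact sets only; the disc is the union of the
    closed discs |x|^2 <= 1 - 1/(n + 1). *)
Lemma locally_L1_measurable f : locally_L1 f -> measurable_fun (@disc R) f.
Proof.
move=> l1.
pose K (n : nat) : set (R * R) := [set x | x.1 ^+ 2 + x.2 ^+ 2 <= 1 - n.+1%:R^-1].
have KD n : K n `<=` @disc R.
  move=> x; rewrite disc_sqnorm /K /= => /le_lt_trans; apply.
  by rewrite ltrBlDr ltrDl invr_gt0 ltr0n.
have cK n : compact (K n).
  apply: (@subclosed_compact _ _ (cbox (-1) 1 (-1) 1)).
  - have /continuous_closedP := @sqnorm_continuous R.
    by move=> /(_ [set y | y <= 1 - n.+1%:R^-1]); apply; exact: closed_le.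
  - exact: compact_cbox.
  - move=> x /KD; rewrite disc_sqnorm /= => h.
    have := sqr_ge0 x.1; have := sqr_ge0 x.2 => h1 h2.
    split; rewrite /= in_itv /= -ler_norml -(@expr_le1 _ 2%N)// real_normK ?num_real//; lra.
have DK : @disc R = \bigcup_n K n.
  apply/seteqP; split => [x|x [n _]]; last exact: KD.
  rewrite disc_sqnorm /= => x1.
  have h : 0 < 1 - (x.1 ^+ 2 + x.2 ^+ 2) by rewrite subr_gt0.
  exists (Num.bound (1 - (x.1 ^+ 2 + x.2 ^+ 2))^-1) => //; rewrite /K /=.
  rewrite lerBrDl -lerBrDr invf_ple ?posrE//.
  apply: ltW; apply: (@lt_trans _ _ (Num.bound (1 - (x.1 ^+ 2 + x.2 ^+ 2))^-1)%:R).
    by apply: archi_boundP; rewrite invr_ge0 ltW.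
  by rewrite ltr_nat.
rewrite DK; apply/measurable_fun_bigcup.
  by move=> n; exact: plane_compact_measurable.
by move=> n; apply/measurable_EFinP; apply: measurable_int (l1 _ (cK n) (@KD n)).
Qed.

Lemma L2P f : L2 f <-> measurable_fun (@disc R) f /\
  mu.-integrable (@disc R) (EFin \o (fun x => f x ^+ 2)).
Proof.
have mD := @measurable_disc R.
have E : (fun x => (f \_ (@disc R)) x ^+ 2) = (fun x => f x ^+ 2) \_ (@disc R).
  by apply/funext => x; rewrite !patchE; case: ifP => // _; rewrite expr0n.
rewrite /L2 plane_measureE; split.
  move=> h; split.
    apply/(measurable_restrictT _ mD).
    by have := sub_Lfun_mfun h; rewrite inE.
  have := Lfun2_integrable_sqr h; rewrite E.
  by move=> h2; apply/(integrable_mkcond _ mD); rewrite restrict_EFin.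
move=> [mf fi].
have {}mf : measurable_fun setT (f \_ (@disc R)).
  exact/(measurable_restrictT _ mD).
rewrite inE; apply/andP; split; rewrite inE//=.
rewrite /finite_norm unlock /=; apply: poweR_lty.
have /integrableP[_] : mu.-integrable setT (EFin \o (fun x => (f \_ (@disc R)) x ^+ 2)).
  by rewrite E -restrict_EFin; apply/(integrable_mkcond _ mD).
apply: le_lt_trans; rewrite le_eqVlt; apply/orP; left; apply/eqP.
apply: eq_integral => x _ /=.
by rewrite normrX powR_mulrn.
Qed.

Lemma L2_ae_eq f g : measurable_fun (@disc R) f -> L2 g ->
  {ae mu, forall x, @disc R x -> f x = g x} -> L2 f.
Proof.
move=> mf /L2P[mg gi] fg; apply/L2P; split=> //.
have mD := @measurable_disc R.
have mf2 : measurable_fun (@disc R) (EFin \o (fun x => f x ^+ 2)).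
  by apply/measurable_EFinP; exact: measurable_funX.
have mg2 : measurable_fun (@disc R) (EFin \o (fun x => g x ^+ 2)).
  by apply/measurable_EFinP; exact: measurable_funX.
apply/integrableP; split=> //; have /integrableP[_] := gi.
apply: le_lt_trans; rewrite le_eqVlt; apply/orP; left; apply/eqP.
apply: ae_eq_integral => //; do ?exact: measurableT_comp.
by apply: plane_aeS fg => x fg Dx /=; rewrite fg.
Qed.

Lemma L2_weak_partial f g i : is_weak_partial i f g -> L2 g ->
  L2 (weak_partial i f).
Proof.
move=> h g2; apply: (L2_ae_eq _ g2); last exact: weak_partial_ae.
by have [_ l1 _] := weak_partialP h; exact: locally_L1_measurable.
Qed.
End WeakDerivatives.

(** * Wirtinger inequality on the circle *)

Section Wirtinger.
Context {R : realType}.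
Local Notation L := (@lebesgue_measure R).
Implicit Types (f g u : R -> R) (a b c t : R).

Lemma continuous_integrable_itv g a b : continuous g ->
  L.-integrable `[a, b] (EFin \o g).
Proof.
move=> cg; apply: continuous_compact_integrable; first exact: segment_compact.
exact: continuous_subspaceT.
Qed.

Lemma Rintegral_itv_split g a b c : continuous g -> a <= b -> b <= c ->
  \int[L]_(t in `[a, c]) g t = \int[L]_(t in `[a, b]) g t + \int[L]_(t in `[b, c]) g t.
Proof.
move=> cg ab bc; apply/eqP; rewrite addrC -subr_eq; apply/eqP.
rewrite (@Rintegral_itvB _ g (BLeft a) (BRight c) b) ?bnd_simp//.
  rewrite Rintegral_itv_obnd_cbnd//.
  apply: (@integrableS _ _ _ L `[b, c]%classic) => //.
    by apply: subset_itv; rewrite bnd_simp.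
  exact: continuous_integrable_itv.
exact: continuous_integrable_itv.
Qed.

Lemma Rintegral_itv_shift g a b c : continuous g ->
  \int[L]_(t in `[a, b]) g (t + c) = \int[L]_(t in `[a + c, b + c]) g t.
Proof.
move=> cg.
have pres : measure_preserving L (fun t => t + c).
  split; first exact: measurable_realfun.measurable_funD.
  by move=> A mA; exact: lebesgue_measure_shift.
rewrite Rintegral_mkcond [RHS]Rintegral_mkcond.
have i1 : L.-integrable setT (EFin \o (g \_ `[a + c, b + c])).
  have := continuous_integrable_itv (a + c) (b + c) cg.
  move/(@integrable_mkcond _ (measurableTypeR R) R L _ _ (measurable_itv `[a + c, b + c])).
  by rewrite restrict_EFin.
have [_ <-] := integrable_preserving pres i1.
apply: eq_Rintegral => t _; rewrite !patchE.
by congr (if _ then _ else _); apply/idP/idP; rewrite !inE /= !in_itv /=; lra.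
Qed.

Lemma Rintegral_periodic g a c : continuous g -> 0 <= c <= a ->
  (forall t, g (t + a) = g t) ->
  \int[L]_(t in `[0, a]) g t = \int[L]_(t in `[c, c + a]) g t.
Proof.
move=> cg /andP[c0 ca] pg.
rewrite (@Rintegral_itv_split g 0 c a)// (@Rintegral_itv_split g c a (c + a))//; last first.
  by rewrite lerDr.
rewrite addrC; congr (_ + _).
have := @Rintegral_itv_shift g 0 c a cg; rewrite add0r => <-.
by apply: eq_Rintegral => t _; rewrite pg.
Qed.

Lemma Rintegral_is_derive_within f f' a b : a < b ->
  (forall t, a <= t <= b -> is_derive t (1 : R) f (f' t)) ->
  (forall t, a <= t <= b -> {for t, continuous f'}) ->
  \int[L]_(t in `[a, b]) f' t = f b - f a.
Proof.
move=> ab df cf'.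
have cf t : a <= t <= b -> {for t, continuous f}.
  move=> /df[dt _]; apply: differentiable_continuous; exact/derivable1_diffP.
rewrite /Rintegral (@continuous_FTC2 _ f' f)//.
- apply: continuous_in_subspaceT => t; rewrite inE /= in_itv /=; exact: cf'.
- split; first by move=> t; rewrite in_itv /= => /andP[h1 h2]; have [|] := df t; rewrite ?ltW.
  + by apply: cvg_at_right_filter; apply: cf; rewrite lexx ltW.
  + by apply: cvg_at_left_filter; apply: cf; rewrite lexx ltW.
- move=> t; rewrite in_itv /= => /andP[h1 h2].
  by rewrite derive1E; have [|_] := df t; rewrite ?ltW.
Qed.

(* For [k < 1] the integrand [u' ^ 2 - k ^ 2 u ^ 2] is the square of
   [u' + k tan(k (t - a - pi/2)) u] minus an exact derivative, and the tangent
   has no pole on the interval. *)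
Lemma wirtinger_approx u u' a (k : R) : 0 < k < 1 ->
  (forall t : R, is_derive t (1 : R) u (u' t)) -> continuous u' ->
  u a = 0 -> u (a + pi) = 0 ->
  k ^+ 2 * \int[L]_(t in `[a, a + pi]) (u t ^+ 2) <=
  \int[L]_(t in `[a, a + pi]) (u' t ^+ 2).
Proof.
move=> /andP[k0 k1] du cu' ua ub.
have pi0 := pi_gt0 R.
have cu : continuous u := continuous_is_derive du.
have cu2 : continuous (fun t => u t ^+ 2) by move=> t; apply: cvgM; exact: cu.
have cu'2 : continuous (fun t => u' t ^+ 2) by move=> t; apply: cvgM; exact: cu'.
pose th t := k * (t - a - pi / 2).
have cth t : a <= t <= a + pi -> 0 < cos (th t).
  move=> /andP[h1 h2]; apply: cos_gt0_pihalf; rewrite /th.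
  have [h|h] := leP 0 (t - a - pi / 2).
    apply/andP; split.
      by apply: (@lt_le_trans _ _ 0); [lra|rewrite mulr_ge0// ltW].
    apply: (@le_lt_trans _ _ (k * (pi / 2))); first by apply: ler_wpM2l; lra.
    by rewrite gtr_pMl//; lra.
  apply/andP; split; last first.
    by apply: (@le_lt_trans _ _ 0); [rewrite pmulr_rle0 ?ltW|lra].
  apply: (@lt_le_trans _ _ (k * (- (pi / 2)))); last by apply: ler_wpM2l; lra.
  by rewrite mulrN ltrN2 gtr_pMl//; lra.
pose w t := tan (th t).
have dth (t : R) : is_derive t (1 : R) th k.
  by rewrite /th; apply: is_derive_eq; rewrite /GRing.scale /=; ring.
have dw t : a <= t <= a + pi -> is_derive t (1 : R) w ((1 + w t ^+ 2) * k).
  move=> /cth ct; have ct0 : cos (th t) != 0 by rewrite gt_eqF.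
  have h := is_derive_tan ct0; rewrite cos2_tan2// in h.
  exact: (@is_derive1_comp _ tan th t _ _ h (dth t)).
pose F t := k * w t * u t ^+ 2.
pose F' t := k ^+ 2 * (1 + w t ^+ 2) * u t ^+ 2 + 2 * k * w t * u t * u' t.
have dF t : a <= t <= a + pi -> is_derive t (1 : R) F (F' t).
  move=> /dw hw; have hu := du t.
  by rewrite /F /F'; apply: is_derive_eq; rewrite /GRing.scale /=; ring.
have cw t : a <= t <= a + pi -> {for t, continuous w}.
  by move=> /dw[dt _]; apply: differentiable_continuous; exact/derivable1_diffP.
have cF' t : a <= t <= a + pi -> {for t, continuous F'}.
  move=> /cw ct; rewrite /F'; apply: cvgD.
    apply: cvgM; last exact: cu2.
    apply: cvgM; first exact: cvg_cst.
    by apply: cvgD; [exact: cvg_cst|apply: cvgM].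
  apply: cvgM; last exact: cu'.
  apply: cvgM; last exact: cu.
  by apply: cvgM => //; exact: cvg_cst.
have ab : a < a + pi by rewrite ltrDl.
have IF := Rintegral_is_derive_within ab dF cF'.
have F0 : F (a + pi) - F a = 0 by rewrite /F ua ub expr0n /= !mulr0 subrr.
have iF' : L.-integrable `[a, a + pi] (EFin \o F').
  apply: continuous_compact_integrable; first exact: segment_compact.
  by apply: continuous_in_subspaceT => t; rewrite inE /= in_itv /=; exact: cF'.
have iu2 := @continuous_integrable_itv _ a (a + pi) cu2.
have iu'2 := @continuous_integrable_itv _ a (a + pi) cu'2.
have iku2 : L.-integrable `[a, a + pi] (EFin \o (fun t => k ^+ 2 * u t ^+ 2)).
  by apply: continuous_integrable_itv => t; apply: cvgM; [exact: cvg_cst|exact: cu2].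
rewrite -RintegralZl//.
rewrite -[leRHS]addr0 -F0 -IF -RintegralD//.
apply: le_Rintegral => //.
- exact: integrableD_real.
- move=> t _; rewrite /F' -subr_ge0.
  have -> : u' t ^+ 2 + (k ^+ 2 * (1 + w t ^+ 2) * u t ^+ 2 + 2 * k * w t * u t * u' t)
    - k ^+ 2 * u t ^+ 2 = (u' t + k * w t * u t) ^+ 2 by ring.
  exact: sqr_ge0.
Qed.

Lemma wirtinger u u' a :
  (forall t : R, is_derive t (1 : R) u (u' t)) -> continuous u' ->
  u a = 0 -> u (a + pi) = 0 ->
  \int[L]_(t in `[a, a + pi]) (u t ^+ 2) <=
  \int[L]_(t in `[a, a + pi]) (u' t ^+ 2).
Proof.
move=> du cu' ua ub.
set A := \int[L]_(t in _) _; set B := \int[L]_(t in _) _.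
have B0 : 0 <= B by apply: Rintegral_ge0 => t _; exact: sqr_ge0.
rewrite leNgt; apply/negP => BA.
have A0 : 0 < A by exact: le_lt_trans BA.
(* With k = 1 - e one gets k^2 A >= A - 2 e A = (A + B) / 2 > B, against [wirtinger_approx]; this
   replaces the limit k -> 1. *)
pose e := (A - B) / (4 * A).
have eA : e * A = (A - B) / 4 by rewrite /e; field; rewrite gt_eqF.
have e0 : 0 < e by rewrite /e divr_gt0 ?subr_gt0// mulr_gt0.
have e1 : e < 1.
  by rewrite /e ltr_pdivrMr ?mulr_gt0// mul1r; lra.
have h := @wirtinger_approx u u' a (1 - e) ltac:(lra) du cu' ua ub.
rewrite -/A -/B in h.
have : (1 - e) ^+ 2 * A = A - 2 * (e * A) + e * (e * A) by ring.
have : 0 <= e * (e * A) by apply: mulr_ge0; [exact: ltW|apply: mulr_ge0; exact: ltW].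
by rewrite eA; lra.
Qed.

(* For some [t0], [f1 - f1 t0] vanishes at [t0] and [t0 + pi], so that [wirtinger]
   applies to it on both half circles; the remainder is the square of
   [f1 - f1 t0 + f2'] up to an exact derivative. *)
Lemma circle_area_le (f1 f1' f2 f2' : R -> R) :
  (forall t : R, is_derive t (1 : R) f1 (f1' t)) -> continuous f1' ->
  (forall t : R, is_derive t (1 : R) f2 (f2' t)) -> continuous f2' ->
  (forall t, f1 (t + 2 * pi) = f1 t) -> (forall t, f1' (t + 2 * pi) = f1' t) ->
  (forall t, f2 (t + 2 * pi) = f2 t) -> (forall t, f2' (t + 2 * pi) = f2' t) ->
  0 <= \int[L]_(t in `[0, 2 * pi])
    (f1 t * f2' t - f2 t * f1' t + f1' t ^+ 2 + f2' t ^+ 2).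
Proof.
move=> d1 c1' d2 c2' p1 p1' p2 p2'.
have pi0 := pi_gt0 R.
have c1 : continuous f1 := continuous_is_derive d1.
have c2 : continuous f2 := continuous_is_derive d2.
(* The difference f1(t + pi) - f1(t) takes opposite values at t = 0 and t = pi, by periodicity. *)
have [t0 t0pi ht0] : exists2 t0, t0 \in `[0, pi] & f1 (t0 + pi) - f1 t0 = 0.
  have ch : continuous (fun t => f1 (t + pi) - f1 t).
    move=> t; apply: cvgB; last exact: c1.
    apply: (@cvg_comp _ _ _ (fun t : R => t + pi) f1); last exact: c1.
    by apply: cvgD; [exact: cvg_id|exact: cvg_cst].
  apply: (IVT (f := fun t => f1 (t + pi) - f1 t)) => //.
  - exact: ltW.
  - exact: continuous_subspaceT.
  - have -> : f1 (pi + pi) - f1 pi = - (f1 (0 + pi) - f1 0).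
      by rewrite add0r opprB -(p1 0) add0r mulr_natl mulr2n.
    set h := f1 (0 + pi) - f1 0.
    by rewrite ge_min le_max; apply/andP; split; apply/orP; have [h0|h0] := leP 0 h; lra.
move: t0pi; rewrite in_itv /= => /andP[t00 t01].
have e2 : f1 (t0 + pi) = f1 t0 by apply/eqP; rewrite -subr_eq0 ht0.
set c := f1 t0 in e2.
pose g t := f1 t * f2' t - f2 t * f1' t + f1' t ^+ 2 + f2' t ^+ 2.
have cg : continuous g.
  move=> t; rewrite /g.
  apply: cvgD; last by apply: cvgM; exact: c2'.
  apply: cvgD; last by apply: cvgM; exact: c1'.
  by apply: cvgB; apply: cvgM; do ?[exact: c1|exact: c2|exact: c1'|exact: c2'].
rewrite (@Rintegral_periodic g (2 * pi) t0)//; last 2 first.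
- by rewrite t00 /=; lra.
- by move=> t; rewrite /g p1 p1' p2 p2'.
(* Since f1 f2' - f2 f1' = 2 (f1 - c) f2' + F', the integrand is (f1 - c + f2')^2 + f1'^2 - (f1 -
   c)^2 + F', where F' integrates to zero over a period. *)
pose F t := 2 * c * f2 t - f1 t * f2 t.
pose F' t := 2 * c * f2' t - (f1 t * f2' t + f2 t * f1' t).
have dF (t : R) : is_derive t (1 : R) F (F' t).
  have h1 := d1 t; have h2 := d2 t.
  by rewrite /F /F'; apply: is_derive_eq; rewrite /GRing.scale /=; ring.
have cF' : continuous F'.
  move=> t; apply: cvgB; first by apply: cvgM; [exact: cvg_cst|exact: c2'].
  by apply: cvgD; apply: cvgM; do ?[exact: c1|exact: c2|exact: c1'|exact: c2'].
have du (t : R) : is_derive t (1 : R) (fun t => f1 t - c) (f1' t).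
  by have h1 := d1 t; apply: is_derive_eq; rewrite subr0.
have w1 := @wirtinger _ _ t0 du c1' (subrr _).
have w2 := @wirtinger _ _ (t0 + pi) du c1'.
have {}w1 := w1 ltac:(by rewrite e2 subrr).
have {}w2 := w2 ltac:(by rewrite e2 subrr) ltac:(by rewrite -addrA -mulr2n -[pi *+ 2]mulr_natl p1 subrr).
have t2 : t0 + 2 * pi = t0 + pi + pi by rewrite mulr_natl mulr2n addrA.
have ca : continuous (fun t => (f1 t - c) ^+ 2).
  by move=> t; apply: cvgM; apply: cvgB; do ?[exact: c1|exact: cvg_cst].
have cb : continuous (fun t => f1' t ^+ 2) by move=> t; apply: cvgM; exact: c1'.
have W : 0 <= \int[L]_(t in `[t0, t0 + 2 * pi]) (f1' t ^+ 2 - (f1 t - c) ^+ 2 + F' t).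
  have cd : continuous (fun t => f1' t ^+ 2 - (f1 t - c) ^+ 2).
    by move=> t; apply: cvgB; [exact: cb|exact: ca].
  rewrite RintegralD//; [|exact: continuous_integrable_itv..].
  rewrite (Rintegral_is_derive _ dF cF'); last by lra.
  have -> : F (t0 + 2 * pi) - F t0 = 0 by rewrite /F p1 p2 subrr.
  rewrite addr0 RintegralB//; [|exact: continuous_integrable_itv..].
  rewrite t2 (@Rintegral_itv_split _ t0 (t0 + pi))//; [|by lra..].
  rewrite (@Rintegral_itv_split (fun t => (f1 t - c) ^+ 2) t0 (t0 + pi))//; [|by lra..].
  by rewrite subr_ge0; apply: lerD.
apply: (le_trans W); apply: le_Rintegral => //.
- apply: continuous_integrable_itv => t; apply: cvgD; last exact: cF'.
  by apply: cvgB; [exact: cb|exact: ca].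
- exact: continuous_integrable_itv.
- move=> t _; rewrite /g /F' -subr_ge0.
  have -> : f1 t * f2' t - f2 t * f1' t + f1' t ^+ 2 + f2' t ^+ 2 -
    (f1' t ^+ 2 - (f1 t - c) ^+ 2 + (2 * c * f2' t - (f1 t * f2' t + f2 t * f1' t))) =
    (f1 t - c + f2' t) ^+ 2 by ring.
  exact: sqr_ge0.
Qed.
End Wirtinger.

(** * Mollification *)

Section Convolution.
Context {R : realType}.
Local Notation L := (@lebesgue_measure R).
Local Notation plane := (measurableTypeR R * measurableTypeR R)%type.
Local Notation mu := (L \x L)%E.
Implicit Types (f g k : R * R -> R) (i : 'I_2) (x y : R * R).

(** Partial derivatives are not enough for the chain rule along curves; circles need total
    differentiability. *)
Lemma elementary_differentiable f x : elementary f -> differentiable f x.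
Proof.
have comp (phi : R -> R) g : derivable phi (g x) 1 -> differentiable g x ->
    differentiable (fun x => phi (g x)) x.
  by move=> /derivable1_diffP dphi dg; exact: differentiable_comp.
elim=> {f}.
- by move=> c; exact: differentiable_cst.
- by apply: (@linear_differentiable _ _ _ (fst : {linear (R * R)%type -> R})) => y; exact: cvg_fst.
- by apply: (@linear_differentiable _ _ _ (snd : {linear (R * R)%type -> R})) => y; exact: cvg_snd.
- by move=> f g _ df _ dg; exact: differentiableD.
- by move=> f g _ df _ dg; exact: differentiableM.
- by move=> f f0 _ df; apply: differentiableV => //; rewrite gt_eqF.
- by move=> f f0 _ df; apply: comp => //; apply: ex_derive; exact: is_derive1_sqrt.
- by move=> f f0 _ df; apply: comp => //; apply: ex_derive; exact: is_derive1_ln.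
- by move=> Q f _ df; apply: comp => //; apply: ex_derive; exact: is_derive_ebump.
Qed.

Lemma is_derive_curve k (u v : R -> R) (du dv t : R) : elementary k ->
  is_derive t (1 : R) u du -> is_derive t (1 : R) v dv ->
  is_derive t (1 : R) (fun s => k (u s, v s))
    (partial 0 k (u t, v t) * du + partial 1 k (u t, v t) * dv).
Proof.
move=> ek hu hv.
have dk := elementary_differentiable (u t, v t) ek.
have du1 : differentiable u t by apply/derivable1_diffP; have [] := hu.
have dv1 : differentiable v t by apply/derivable1_diffP; have [] := hv.
have dp : differentiable (fun s => (u s, v s)) t by exact: differentiable_pair.
have dc : differentiable (k \o (fun s => (u s, v s))) t by exact: differentiable_comp.
apply: DeriveDef; first exact/derivable1_diffP.
have -> : (fun s => k (u s, v s)) = k \o (fun s => (u s, v s)) by [].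
rewrite deriveE// diff_comp//= diff_pair//=.
have -> : 'd u t 1 = du by rewrite -deriveE//; have [_] := hu.
have -> : 'd v t 1 = dv by rewrite -deriveE//; have [_] := hv.
have -> : (du, dv) = du *: basis_vec R 0 + dv *: basis_vec R 1.
  rewrite /basis_vec /=; congr (_, _) => /=.
    by rewrite [du *: 1]mulr1 [dv *: 0]mulr0 addr0.
  by rewrite [du *: 0]mulr0 [dv *: 1]mulr1 add0r.
by rewrite linearD !linearZ /partial !deriveE//; congr (_ + _); exact: mulrC.
Qed.

Definition is_kernel k :=
  elementary k /\ exists e, forall x, ~ cbox (- e) e (- e) e x -> k x = 0.

Lemma kernel_partial k i : is_kernel k -> is_kernel (partial i k).
Proof.
move=> [ek [e ke]]; split; first exact: elementary_partial.
exists e; apply: (derive_support (f := k) (i := i)) => //.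
  by apply: compact_closed; [exact: norm_hausdorff|exact: compact_cbox].
by move=> x; apply: DeriveDef => //; exact: elementary_derivable.
Qed.

Lemma kernel_bounded k : is_kernel k -> exists2 M, 0 <= M & forall x, `|k x| <= M.
Proof.
move=> [ek [e ke]].
have [M M0 hM] := continuous_bounded_on_compact (elementary_continuous ek)
  (@compact_cbox _ (- e) e (- e) e).
exists M => // x; have [Kx|/ke->] := pselect (cbox (- e) e (- e) e x); first exact: hM.
by rewrite normr0.
Qed.

Lemma elementary_measurable k : elementary k ->
  measurable_fun setT (k : plane -> measurableTypeR R).
Proof. by move=> ek; apply: plane_continuous_measurable; exact: elementary_continuous. Qed.

Lemma measurable_minus x : measurable_fun setT
  ((fun y => (x.1 - y.1, x.2 - y.2)) : plane -> plane).
Proof.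
by apply: measurable_fun_pair; apply: measurable_realfun.measurable_funB.
Qed.

Definition conv f k x : R := \int[mu]_y (f y * k (x.1 - y.1, x.2 - y.2)).

Lemma conv_integrable f k x : mu.-integrable setT (EFin \o f) -> is_kernel k ->
  mu.-integrable setT (EFin \o (fun y => f y * k (x.1 - y.1, x.2 - y.2))).
Proof.
move=> fi kk; have [M M0 hM] := kernel_bounded kk.
apply: (@integrableM_bounded _ _ _ _ _ _ _ M) => //.
by apply: (measurableT_comp (elementary_measurable kk.1)); exact: measurable_minus.
Qed.

(** A general curve covers both uses at once, coordinate lines and circles about 0. The bound [B] on
    the velocity yields the integrable majorant [G] for differentiation under the integral sign. *)
Lemma is_derive_conv_curve f k (u v u' v' : R -> R) (B t : R) :
  mu.-integrable setT (EFin \o f) -> is_kernel k ->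
  (forall s : R, is_derive s (1 : R) u (u' s)) -> (forall s : R, is_derive s (1 : R) v (v' s)) ->
  (forall s, `|u' s| <= B /\ `|v' s| <= B) ->
  is_derive t (1 : R) (fun s => conv f k (u s, v s))
    (conv f (partial 0 k) (u t, v t) * u' t + conv f (partial 1 k) (u t, v t) * v' t).
Proof.
move=> fi kk du dv hB.
have k0 := kernel_partial 0 kk; have k1 := kernel_partial 1 kk.
have [M0 M00 hM0] := kernel_bounded k0; have [M1 M10 hM1] := kernel_bounded k1.
pose F s (y : plane) := f y * k (u s - y.1, v s - y.2).
pose F' s (y : plane) := f y * (partial 0 k (u s - y.1, v s - y.2) * u' s +
  partial 1 k (u s - y.1, v s - y.2) * v' s).
have dF (s : R) (y : plane) : is_derive s (1 : R) (F ^~ y) (F' s y).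
  have hu : is_derive s (1 : R) (fun s => u s - y.1) (u' s).
    by have h := du s; apply: is_derive_eq; rewrite subr0.
  have hv : is_derive s (1 : R) (fun s => v s - y.2) (v' s).
    by have h := dv s; apply: is_derive_eq; rewrite subr0.
  have := is_derive_curve kk.1 hu hv; rewrite /F /F' /= => h.
  by apply: is_derive_eq; rewrite /GRing.scale /=; ring.
have d1 s y : partial1of2 F s y = F' s y.
  by rewrite partial1of2E; have [_] := dF s y.
have h1 s : t - 1 < s < t + 1 -> mu.-integrable setT (EFin \o F s).
  by move=> _; exact: (conv_integrable (u s, v s)).
have B0 : 0 <= B by have [h _] := hB t; exact: le_trans h.
pose G (y : plane) := `|f y| * (M0 * B + M1 * B).
have tI : (`]t - 1, t + 1[%classic : set R) t by rewrite /= in_itv /=; lra.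
have fi' : mu.-integrable setT (EFin \o (fun y => `|f y|)).
  by rewrite (_ : EFin \o _ = abse \o (EFin \o f))//; exact: integrable_abse.
have iF s : (`]t - 1, t + 1[%classic : set R) s -> mu.-integrable setT (EFin \o F s).
  by move=> _; exact: (conv_integrable (u s, v s)).
have dFF s (y : plane) : (`]t - 1, t + 1[%classic : set R) s -> [set: plane] y -> derivable (F ^~ y) s 1.
  by move=> _ _; have [] := dF s y.
have G0 y : 0 <= G y by rewrite /G mulr_ge0// addr_ge0// mulr_ge0.
have iG : mu.-integrable setT (EFin \o G).
  apply: (@integrableM_bounded _ _ _ _ _ _ _ (M0 * B + M1 * B)) => //.
  by move=> y _; rewrite ger0_norm// addr_ge0// mulr_ge0.
have GF s (y : plane) : (`]t - 1, t + 1[%classic : set R) s -> [set: plane] y -> `|partial1of2 F s y| <= G y.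
  move=> _ _; rewrite d1 /F' /G normrM ler_wpM2l//.
  rewrite (le_trans (ler_normD _ _))// !normrM lerD// ler_pM//; first by have [] := hB s.
  by have [] := hB s.
have hd := @derivable_under_integral R _ plane mu F setT measurableT t (t - 1) (t + 1)
  tI iF dFF G G0 iG GF.
have hv := @differentiation_under_integral R _ plane mu F setT measurableT t (t - 1) (t + 1)
  tI iF dFF G G0 iG GF.
apply: DeriveDef; first exact: hd.
rewrite -derive1E [LHS]hv /conv /=.
rewrite (_ : (fun x : plane => partial1of2 F t x) = F' t); last exact/funext/d1.
have := Rintegral_comb2 (u' t) (v' t) measurableT (conv_integrable (u t, v t) fi k0)
  (conv_integrable (u t, v t) fi k1).
move=> /= <-; apply: eq_Rintegral => y _; rewrite /F'; ring.
Qed.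

Lemma is_derive_conv f k i x : mu.-integrable setT (EFin \o f) -> is_kernel k ->
  is_derive x (basis_vec R i) (conv f k) (conv f (partial i k) x).
Proof.
move=> fi kk; apply/is_derive_line.
pose b := basis_vec R i.
have d1 (s : R) : is_derive s (1 : R) (fun h : R => h * b.1 + x.1) b.1.
  by apply: is_derive_eq; rewrite /GRing.scale /=; ring.
have d2 (s : R) : is_derive s (1 : R) (fun h : R => h * b.2 + x.2) b.2.
  by apply: is_derive_eq; rewrite /GRing.scale /=; ring.
have bB (s : R) : `|b.1| <= 1 /\ `|b.2| <= 1.
  by rewrite /b /basis_vec; case: ifP; rewrite /= normr0 normr1 ler01 lexx.
have := @is_derive_conv_curve f k _ _ (fun=> b.1) (fun=> b.2) 1 0 fi kk d1 d2 bB.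
rewrite !mul0r !add0r -surjective_pairing => h.
have -> : (fun h : R => conv f k (h *: basis_vec R i + x)) =
  (fun s => conv f k (s * b.1 + x.1, s * b.2 + x.2)) by [].
apply: is_derive_eq.
case: (altP (i =P 0)) => [i0|i0].
  rewrite /b i0 /basis_vec /=.
  by move: (conv f (partial 0 k) x) (conv f (partial 1 k) x) => A B; ring.
have i1 : i = 1 by apply/val_inj; case: i i0 {b d1 d2 bB h} => -[|[|[]]].
rewrite /b i1 /basis_vec /=.
by move: (conv f (partial 0 k) x) (conv f (partial 1 k) x) => A B; ring.
Qed.

(** The mean value theorem along two axis-parallel segments. The bound gives continuity of
    convolutions with integrable functions and the rate at which averages of a kernel approach
    it. *)
Lemma kernel_lipschitz k : is_kernel k -> exists2 M, 0 <= M &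
  forall x y, `|k x - k y| <= M * (`|x.1 - y.1| + `|x.2 - y.2|).
Proof.
move=> kk; have [ek _] := kk.
have [M0 M00 hM0] := kernel_bounded (kernel_partial 0 kk).
have [M1 M10 hM1] := kernel_bounded (kernel_partial 1 kk).
have lip (w w' : R -> R) (M : R) : (forall s : R, is_derive s (1 : R) w (w' s)) ->
    (forall s, `|w' s| <= M) -> forall a b, `|w a - w b| <= M * `|a - b|.
  move=> dw wM; have cw := continuous_is_derive dw.
  have main a b : a <= b -> `|w a - w b| <= M * `|a - b|.
    move=> ab; have [|c _ h] := @MVT_segment R w w' a b ab (fun (s : R) _ => dw s).
      exact: continuous_subspaceT.
    by rewrite distrC h normrM [`|a - b|]distrC ler_wpM2r.
  move=> a b; have [/main//|/ltW/main] := leP a b.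
  by rewrite [`|w b - w a|]distrC [`|b - a|]distrC.
exists (M0 + M1) => [|[a b] [c d]] /=; first exact: addr_ge0.
have -> : k (a, b) - k (c, d) = (k (a, b) - k (c, b)) + (k (c, b) - k (c, d)) by ring.
apply: (le_trans (ler_normD _ _)).
have h0 : `|k (a, b) - k (c, b)| <= M0 * `|a - c|.
  apply: (lip (fun s => k (s, b)) (fun s => partial 0 k (s, b))) => s; last exact: hM0.
  apply: (@is_derive_slice1 _ k (s, b)); apply: DeriveDef => //.
  exact: elementary_derivable.
have h1 : `|k (c, b) - k (c, d)| <= M1 * `|b - d|.
  apply: (lip (fun s => k (c, s)) (fun s => partial 1 k (c, s))) => s; last exact: hM1.
  apply: (@is_derive_slice2 _ k (c, s)); apply: DeriveDef => //.
  exact: elementary_derivable.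
rewrite mulrDl !mulrDr; have := normr_ge0 (a - c); have := normr_ge0 (b - d) => n1 n2.
have := mulr_ge0 M00 n1; have := mulr_ge0 M10 n2; lra.
Qed.

Lemma conv_continuous f k : mu.-integrable setT (EFin \o f) -> is_kernel k ->
  continuous (conv f k).
Proof.
move=> fi kk x; have [M M0 hM] := kernel_lipschitz kk.
pose I := \int[mu]_y `|f y|.
have fi' : mu.-integrable setT (EFin \o (fun y => `|f y|)).
  by rewrite (_ : EFin \o _ = abse \o (EFin \o f))//; exact: integrable_abse.
have I0 : 0 <= I by apply: Rintegral_ge0.
have key y : `|conv f k y - conv f k x| <= I * M * (`|y.1 - x.1| + `|y.2 - x.2|).
  rewrite /conv -RintegralB//; [|exact: conv_integrable..].
  apply: (le_trans (le_normr_Rintegral _ _)) => //.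
    by apply: integrableB_real => //; exact: conv_integrable.
  rewrite -mulrA mulrC -RintegralZl//.
  apply: le_Rintegral => //.
  - have h := integrableB_real measurableT (conv_integrable y fi kk) (conv_integrable x fi kk).
    have := integrable_abse h; exact.
  - exact: integrableZ_real.
  - move=> z _; rewrite -mulrBr normrM mulrC ler_wpM2r//.
    apply: (le_trans (hM _ _)) => /=.
    have -> : y.1 - z.1 - (x.1 - z.1) = y.1 - x.1 by ring.
    by have -> : y.2 - z.2 - (x.2 - z.2) = y.2 - x.2 by ring.
apply/cvgrPdist_le => e e0.
have d0 : 0 < e / (2 * (I * M + 1)) by rewrite divr_gt0// mulr_gt0// ltr_wpDl// mulr_ge0.
have N1 := @elementary_continuous R fst (elementary_fst) x.
have N2 := @elementary_continuous R snd (elementary_snd) x.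
move/cvgrPdist_le : N1 => /(_ _ d0) N1; move/cvgrPdist_le : N2 => /(_ _ d0) N2.
near=> y; rewrite distrC; apply: (le_trans (key y)).
have y1 : `|y.1 - x.1| <= e / (2 * (I * M + 1)).
  by rewrite distrC; near: y.
have y2 : `|y.2 - x.2| <= e / (2 * (I * M + 1)).
  by rewrite distrC; near: y.
have IM := mulr_ge0 I0 M0.
apply: (@le_trans _ _ ((I * M + 1) * (`|y.1 - x.1| + `|y.2 - x.2|))).
  by rewrite ler_wpM2r ?addr_ge0//; lra.
have : `|y.1 - x.1| + `|y.2 - x.2| <= e / (I * M + 1).
  have -> : e / (I * M + 1) = e / (2 * (I * M + 1)) + e / (2 * (I * M + 1)).
    by field; apply/eqP; lra.
  exact: lerD.
by rewrite ler_pdivlMr 1?mulrC//; lra.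
Unshelve. all: by end_near. Qed.
End Convolution.

(* Averaging against doubly stochastic kernels [w n] on a measure space: such
   averages contract the L^2 norm, so the functions which are L^2 limits of
   their averages form a closed subspace. *)
Section Averaging.
Context {R : realType} d (X : measurableType d)
  (m : {sigma_finite_measure set X -> \bar R}).
Variable w : nat -> X * X -> R.
Hypothesis mw : forall n, measurable_fun setT (w n).
Hypothesis w_ge0 : forall n z, 0 <= w n z.
Hypothesis w_bounded : forall n, exists M, forall z, w n z <= M.
Hypothesis w_left : forall n x, (\int[m]_y (w n (x, y))%:E = 1)%E.
Hypothesis w_right : forall n y, (\int[m]_x (w n (x, y))%:E = 1)%E.
Implicit Types f g : X -> R.

Definition square_integrable f :=
  m.-integrable setT (EFin \o f) /\ m.-integrable setT (EFin \o (fun x => f x ^+ 2)).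

Definition average n f x : R := \int[m]_y (f y * w n (x, y)).

Lemma measurable_integrable f : m.-integrable setT (EFin \o f) -> measurable_fun setT f.
Proof. by move=> fi; apply/measurable_EFinP; exact: measurable_int fi. Qed.

Lemma square_integrable_comb a b f g : square_integrable f -> square_integrable g ->
  square_integrable (fun x => a * f x + b * g x).
Proof.
move=> [f1 f2] [g1 g2]; split.
  by apply: integrableD_real => //; exact: integrableZ_real.
have mf := measurable_integrable f1; have mg := measurable_integrable g1.
apply: (@le_integrable_real _ _ _ _ _ _ (fun x => 2 * a ^+ 2 * f x ^+ 2 + 2 * b ^+ 2 * g x ^+ 2)) => //.
- apply: measurable_funX; apply: measurable_realfun.measurable_funD; exact: measurable_realfun.measurable_funM.
- move=> x _; rewrite ger0_norm ?sqr_ge0// -subr_ge0.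
  have -> : 2 * a ^+ 2 * f x ^+ 2 + 2 * b ^+ 2 * g x ^+ 2 - (a * f x + b * g x) ^+ 2 =
    (a * f x - b * g x) ^+ 2 by ring.
  exact: sqr_ge0.
- by apply: integrableD_real => //; exact: integrableZ_real.
Qed.

Lemma measurable_w1 n x : measurable_fun setT (fun y => w n (x, y)).
Proof. by apply: (measurableT_comp (mw n)); exact: measurable_fun_pair. Qed.

Lemma measurable_w2 n y : measurable_fun setT (fun x => w n (x, y)).
Proof. by apply: (measurableT_comp (mw n)); exact: measurable_fun_pair. Qed.

Lemma integrable_w1 n x : m.-integrable setT (EFin \o (fun y => w n (x, y))).
Proof.
apply/integrableP; split; first by apply/measurable_EFinP; exact: measurable_w1.
under eq_integral do rewrite /= ger0_norm//.
by rewrite w_left ltry.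
Qed.

Lemma integrable_average n f x : m.-integrable setT (EFin \o f) ->
  m.-integrable setT (EFin \o (fun y => f y * w n (x, y))).
Proof.
move=> fi; have [M hM] := w_bounded n.
apply: (@integrableM_bounded _ _ _ _ _ _ _ M) => //; first exact: measurable_w1.
by move=> y _; rewrite ger0_norm.
Qed.

Lemma average_comb n a b f g x : m.-integrable setT (EFin \o f) ->
  m.-integrable setT (EFin \o g) ->
  average n (fun x => a * f x + b * g x) x = a * average n f x + b * average n g x.
Proof.
move=> fi gi; rewrite mulrC [b * _]mulrC.
rewrite -(Rintegral_comb2 a b measurableT (integrable_average n x fi) (integrable_average n x gi)).
by apply: eq_Rintegral => y _; ring.
Qed.

Lemma average_EFin n f x : m.-integrable setT (EFin \o f) ->
  ((average n f x)%:E = \int[m]_y (f y * w n (x, y))%:E)%E.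
Proof.
move=> fi; rewrite /average /Rintegral fineK//.
by apply: integrable_fin_num => //; exact: integrable_average.
Qed.

Lemma measurable_average_joint n f : measurable_fun setT f ->
  measurable_fun setT (fun z : X * X => (f z.2 * w n z)%:E).
Proof.
move=> mf; apply/measurable_EFinP; apply: measurable_realfun.measurable_funM => //.
exact: measurableT_comp mf measurable_snd.
Qed.

(** After exchanging the integrals by Tonelli, the inner one is the mass of the kernel in its first
    variable. *)
Lemma integral_average n f : (forall x, 0 <= f x) -> m.-integrable setT (EFin \o f) ->
  (\int[m]_x (average n f x)%:E = \int[m]_x (f x)%:E)%E.
Proof.
move=> f0 fi; have mf := measurable_integrable fi.
under eq_integral do rewrite (average_EFin n _ fi).
rewrite (@fubini_tonelli _ _ _ _ _ m m (fun z => (f z.2 * w n z)%:E)); last 2 first.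
- exact: measurable_average_joint.
- by move=> z; rewrite lee_fin mulr_ge0.
apply: eq_integral => y _ /=.
under eq_integral do rewrite EFinM.
rewrite ge0_integralZl ?w_right ?mule1//.
- by apply/measurable_EFinP; exact: measurable_w2.
- by move=> x _; rewrite lee_fin.
- by rewrite lee_fin.
Qed.

Lemma measurable_average n f : m.-integrable setT (EFin \o f) ->
  measurable_fun setT (average n f).
Proof.
move=> fi; have mf := measurable_integrable fi.
have ji : (m \x m)%E.-integrable setT (fun z : X * X => (f z.2 * w n z)%:E).
  apply/(integrable21ltyP _ _ _).2; first exact: measurable_average_joint.
  have -> : (\int[m]_y \int[m]_x `|(f (x, y).2 * w n (x, y))%:E| = \int[m]_y `|(f y)%:E|)%E.
    apply: eq_integral => y _ /=.
    under eq_integral do rewrite normrM [`|w n _|]ger0_norm// EFinM.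
    rewrite ge0_integralZl ?w_right ?mule1//.
    - by apply/measurable_EFinP; exact: measurable_w2.
    - by move=> x _; rewrite lee_fin.
  by case/integrableP: fi.
apply/measurable_EFinP.
have := measurable_fubini_F ji; congr (measurable_fun _ _).
by apply/funext => x; rewrite /fubini_F /= average_EFin.
Qed.

(** Jensen's inequality for the probability density [w n (x, .)], by expanding the integral of (f -
    c)^2 with c the average. *)
Lemma average_sqr_le n f x : square_integrable f ->
  average n f x ^+ 2 <= average n (fun y => f y ^+ 2) x.
Proof.
move=> [f1 f2]; set c := average n f x.
have w1 : \int[m]_y w n (x, y) = 1 by rewrite /Rintegral w_left.
have i1 := integrable_average n x f1; have i2 := integrable_average n x f2.
have : 0 <= \int[m]_y ((f y - c) ^+ 2 * w n (x, y)).
  by apply: Rintegral_ge0 => y _; rewrite mulr_ge0// sqr_ge0.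
have -> : \int[m]_y ((f y - c) ^+ 2 * w n (x, y)) =
    \int[m]_y ((f y ^+ 2 * w n (x, y) * 1 + f y * w n (x, y) * (- 2 * c)) * 1
      + w n (x, y) * c ^+ 2).
  by apply: eq_Rintegral => y _; ring.
rewrite Rintegral_comb2//; last 2 first.
- have := integrableD_real measurableT (integrableZ_real 1 measurableT i2)
    (integrableZ_real (- 2 * c) measurableT i1).
  by congr (m.-integrable _ (EFin \o _)); apply/funext => y; ring.
- exact: integrable_w1.
rewrite Rintegral_comb2// w1 -/c -/(average n f x) -/c.
rewrite -/(average n (fun y => f y ^+ 2) x).
by set A := average _ _ _ => h; rewrite -subr_ge0; apply: le_trans h _; rewrite le_eqVlt; apply/orP; left; apply/eqP; ring.
Qed.

Lemma average_contraction n f : square_integrable f ->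
  (\int[m]_x (average n f x ^+ 2)%:E <= \int[m]_x (f x ^+ 2)%:E)%E.
Proof.
move=> hf; have [f1 f2] := hf.
rewrite -(@integral_average n (fun x => f x ^+ 2))//; last by move=> x; exact: sqr_ge0.
apply: ge0_le_integral => //.
- by move=> x _; rewrite lee_fin sqr_ge0.
- by apply/measurable_EFinP; apply: measurable_funX; exact: measurable_average.
- by apply/measurable_EFinP; exact: measurable_average.
- by move=> x _; rewrite lee_fin average_sqr_le.
Qed.

Definition average_error n f : \bar R := (\int[m]_x ((average n f x - f x) ^+ 2)%:E)%E.

Definition recovered f := square_integrable f /\
  forall e : R, 0 < e -> exists N, forall n, (N <= n)%N -> (average_error n f <= e%:E)%E.

Lemma integral_sqr_comb_le (u v : X -> R) (a b : R) : measurable_fun setT u -> measurable_fun setT v ->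
  (\int[m]_x ((a * u x + b * v x) ^+ 2)%:E <=
   (2 * a ^+ 2)%:E * \int[m]_x (u x ^+ 2)%:E + (2 * b ^+ 2)%:E * \int[m]_x (v x ^+ 2)%:E)%E.
Proof.
move=> mu_ mv.
have h (c : R) (z : X -> R) : measurable_fun setT z -> measurable_fun setT (fun x => (c * z x ^+ 2)%:E).
  by move=> mz; apply/measurable_EFinP; apply: measurable_realfun.measurable_funM => //; exact: measurable_funX.
have ea : 0 <= 2 * a ^+ 2 by rewrite mulr_ge0 ?sqr_ge0.
have eb : 0 <= 2 * b ^+ 2 by rewrite mulr_ge0 ?sqr_ge0.
rewrite -!ge0_integralZl//; try (by move=> x _; rewrite lee_fin sqr_ge0);
  try (by apply/measurable_EFinP; exact: measurable_funX).
rewrite -ge0_integralD//; try (by move=> x _; rewrite -EFinM lee_fin mulr_ge0 ?sqr_ge0); try exact: h.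
apply: ge0_le_integral => //.
- by move=> x _; rewrite lee_fin sqr_ge0.
- apply/measurable_EFinP; apply: measurable_funX.
  by apply: measurable_realfun.measurable_funD; exact: measurable_realfun.measurable_funM.
- by apply: emeasurable_funD; exact: h.
- move=> x _; rewrite lee_fin -subr_ge0.
  have -> : 2 * a ^+ 2 * u x ^+ 2 + 2 * b ^+ 2 * v x ^+ 2 - (a * u x + b * v x) ^+ 2 =
    (a * u x - b * v x) ^+ 2 by ring.
  exact: sqr_ge0.
Qed.

Lemma recovered_comb a b f g : recovered f -> recovered g ->
  recovered (fun x => a * f x + b * g x).
Proof.
move=> [hf ef] [hg eg]; split; first exact: square_integrable_comb.
move=> e e0.
pose e' := e / (2 * a ^+ 2 + 2 * b ^+ 2 + 1).
have s0 : 0 < 2 * a ^+ 2 + 2 * b ^+ 2 + 1.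
  by rewrite ltr_wpDl// addr_ge0// mulr_ge0// sqr_ge0.
have e'0 : 0 < e' by rewrite divr_gt0.
have [N1 h1] := ef _ e'0; have [N2 h2] := eg _ e'0.
exists (maxn N1 N2) => n; rewrite geq_max => /andP[/h1 {}h1 /h2 {}h2].
have [f1 _] := hf; have [g1 _] := hg.
have -> : average_error n (fun x => a * f x + b * g x) =
    (\int[m]_x ((a * (average n f x - f x) + b * (average n g x - g x)) ^+ 2)%:E)%E.
  apply: eq_integral => x _; congr ((_ ^+ 2)%:E).
  by rewrite (average_comb n a b x f1 g1); ring.
apply: le_trans (integral_sqr_comb_le _ _ _ _) _.
- apply: measurable_realfun.measurable_funB; [exact: measurable_average|exact: measurable_integrable].
- apply: measurable_realfun.measurable_funB; [exact: measurable_average|exact: measurable_integrable].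
have ea : 0 <= 2 * a ^+ 2 by rewrite mulr_ge0 ?sqr_ge0.
have eb : 0 <= 2 * b ^+ 2 by rewrite mulr_ge0 ?sqr_ge0.
apply: (@le_trans _ _ ((2 * a ^+ 2)%:E * e'%:E + (2 * b ^+ 2)%:E * e'%:E)%E).
  by apply: leeD; apply: lee_wpmul2l.
rewrite -!EFinM -EFinD lee_fin -mulrDl /e' mulrA ler_pdivrMr// mulrC ler_wpM2l ?ltW//.
by rewrite ltrDl.
Qed.

(** The error of [f] splits into the average of f - g, controlled by contraction, the error of [g],
    and f - g itself. *)
Lemma recovered_limit f : square_integrable f ->
  (forall e : R, 0 < e -> exists g, recovered g /\
     (\int[m]_x ((f x - g x) ^+ 2)%:E <= e%:E)%E) -> recovered f.
Proof.
move=> hf happ; split=> // e e0.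
(* Using (u + v)^2 <= 2 u^2 + 2 v^2 twice, the three errors enter with the factors 4, 4 and 2. *)
have e10 : 0 < e / 10 by rewrite divr_gt0.
have [g [[hg eg] hfg]] := happ _ e10.
have [N hN] := eg _ e10; exists N => n /hN {}hN.
have [f1 _] := hf; have [g1 _] := hg.
have mf := measurable_integrable f1; have mg := measurable_integrable g1.
have mAf := measurable_average n f1; have mAg := measurable_average n g1.
have mfg : measurable_fun setT (fun x => f x - g x) by exact: measurable_realfun.measurable_funB.
have hd : square_integrable (fun x => f x - g x).
  have := square_integrable_comb 1 (-1) hf hg.
  by congr square_integrable; apply/funext => x; ring.
have hc : (\int[m]_x ((average n f x - average n g x) ^+ 2)%:E <= (e / 10)%:E)%E.
  apply: le_trans hfg; apply: le_trans (average_contraction n hd).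
  rewrite le_eqVlt; apply/orP; left; apply/eqP; apply: eq_integral => x _.
  have -> : average n (fun x => f x - g x) x = average n f x - average n g x.
    have := average_comb n 1 (-1) x f1 g1; rewrite mul1r mulN1r => <-.
    by congr (average n _ x); apply/funext => y; ring.
  by [].
have -> : average_error n f =
    (\int[m]_x ((1 * (1 * (average n f x - average n g x) + (-1) * (f x - g x))
       + 1 * (average n g x - g x)) ^+ 2)%:E)%E.
  by apply: eq_integral => x _; congr ((_ ^+ 2)%:E); ring.
have m1 : measurable_fun setT (fun x => average n f x - average n g x).
  exact: measurable_realfun.measurable_funB.
have m2 : measurable_fun setT (fun x => average n g x - g x).
  exact: measurable_realfun.measurable_funB.
have m3 : measurable_fun setT (fun x => 1 * (average n f x - average n g x) + (-1) * (f x - g x)).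
  by apply: measurable_realfun.measurable_funD; exact: measurable_realfun.measurable_funM.
apply: le_trans (integral_sqr_comb_le _ _ m3 m2) _.
have h1 := integral_sqr_comb_le 1 (-1) m1 mfg.
apply: (@le_trans _ _ ((2 * (2 * (e / 10) + 2 * (e / 10)) + 2 * (e / 10))%R)%:E%E).
  rewrite !expr1n sqrrN expr1n !mulr1 in h1 *.
  rewrite -[leRHS]/((2 : R)%:E * ((2 : R)%:E * (e / 10)%:E + (2 : R)%:E * (e / 10)%:E)
    + (2 : R)%:E * (e / 10)%:E)%E.
  apply: leeD; apply: lee_wpmul2l => //.
  by apply: le_trans h1 _; apply: leeD; apply: lee_wpmul2l.
by rewrite lee_fin; lra.
Qed.
End Averaging.

(** * Density: every square integrable function is the limit of its averages *)

Section AveragingDense.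
Context {R : realType} d (X : measurableType d)
  (m : {sigma_finite_measure set X -> \bar R}).
Variable w : nat -> X * X -> R.
Hypothesis mw : forall n, measurable_fun setT (w n).
Hypothesis w_ge0 : forall n z, 0 <= w n z.
Hypothesis w_bounded : forall n, exists M, forall z, w n z <= M.
Hypothesis w_left : forall n x, (\int[m]_y (w n (x, y))%:E = 1)%E.
Hypothesis w_right : forall n y, (\int[m]_x (w n (x, y))%:E = 1)%E.
Implicit Types (f g : X -> R) (A B : set X).
Local Notation recov := (recovered m w).

Lemma recov_limit_seq f (g : nat -> X -> R) (h : X -> R) :
  square_integrable m f -> (forall n, recov (g n)) ->
  m.-integrable setT (EFin \o h) ->
  (forall x, g n x @[n --> \oo] --> f x) ->
  (forall n x, (f x - g n x) ^+ 2 <= h x) -> recov f.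
Proof.
move=> hf hg hi gf gh; apply: recovered_limit => // e e0.
have mf := measurable_integrable hf.1.
have mg n := measurable_integrable (hg n).1.1.
have [||||_ cv] := @Rdominated_cvg _ _ _ m setT (fun n x => (f x - g n x) ^+ 2) (fun=> 0) h measurableT.
- by move=> n; apply: measurable_funX; exact: measurable_realfun.measurable_funB.
- move=> x _; rewrite -(_ : (f x - f x) ^+ 2 = 0); last by rewrite subrr expr0n.
  have c : f x - g n x @[n --> \oo] --> f x - f x by apply: cvgB; [exact: cvg_cst|exact: gf].
  exact: cvgM.
- exact: hi.
- by move=> n x _; rewrite ger0_norm ?sqr_ge0.
have R0 : \int[m]_(x in setT) (0 : R) = 0 by rewrite /Rintegral integral0.
rewrite R0 in cv.
move/cvgrPdist_le : cv => /(_ _ e0)[N _ /(_ N (leqnn N))] /=.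
rewrite sub0r normrN => hN; exists (g N); split=> //.
have fin : m.-integrable setT (EFin \o (fun x => (f x - g N x) ^+ 2)).
  apply: (@le_integrable_real _ _ _ _ _ _ h) => //.
    by apply: measurable_funX; exact: measurable_realfun.measurable_funB.
  by move=> x _; rewrite ger0_norm ?sqr_ge0.
rewrite -[leLHS]fineK; last exact: integrable_fin_num.
by rewrite lee_fin; apply: le_trans hN; rewrite ler_norm.
Qed.

Lemma square_integrable_indic A : measurable A -> (m A < +oo)%E ->
  square_integrable m (\1_A : X -> R).
Proof.
move=> mA fA.
have h : m.-integrable setT (EFin \o (\1_A : X -> R)).
  apply/integrableP; split; first by apply/measurable_EFinP; exact: measurable_indic.
  under eq_integral do rewrite /= ger0_norm//.
  by rewrite integral_indic// setIT.
split=> //; move: h; congr (m.-integrable _ (EFin \o _)); apply/funext => x.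
by rewrite indicE; case: (_ \in _); rewrite ?expr1n ?expr0n.
Qed.

Lemma recov0 : recov (fun=> 0).
Proof.
have h0 : m.-integrable setT (EFin \o (fun=> 0 : R)).
  by have := integrable0 m setT.
split; first by split=> //; move: h0; congr (m.-integrable _ (EFin \o _)); apply/funext => x; rewrite expr0n.
move=> e e0; exists 0%N => n _.
rewrite /average_error (eq_integral (cst 0%E)) ?integral0 ?lee_fin ?ltW// => x _.
rewrite subr0 /average.
have -> : \int[m]_y ((fun=> 0 : R) y * w n (x, y)) = 0.
  under eq_Rintegral do rewrite mul0r.
  by rewrite /Rintegral integral0.
by rewrite expr0n.
Qed.

Variables (G : set (set X)).
Hypothesis mG : @measurable _ X = <<s G >>.
Hypothesis GI : setI_closed G.
Hypothesis Gfin : forall A, G A -> (m A < +oo)%E.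
Hypothesis Grecov : forall A, G A -> recov (\1_A).

(** Dynkin induction in [A]. Intersecting with a set [B] of finite measure keeps the indicator
    functions square integrable, makes complements differences of indicators, and lets the indicator
    of [B] dominate countable disjoint unions. *)
Lemma recov_indic_setI A B : G B -> measurable A -> recov (\1_(A `&` B)).
Proof.
move=> GB mA.
have mB : measurable B by rewrite mG; exact: sub_sigma_algebra.
have finS C : measurable C -> C `<=` B -> square_integrable m (\1_C : X -> R).
  move=> mC CB; apply: square_integrable_indic => //.
  by apply: le_lt_trans (Gfin GB); apply: le_measure; rewrite ?inE.
move: A mA; rewrite mG.
apply: (dynkin_induction (P := fun A => recov (\1_(A `&` B))) mG GI).
- by rewrite setTI; exact: Grecov.
- by move=> C GC; apply: Grecov; exact: GI.
- move=> C mC hC.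
  have := recovered_comb mw w_ge0 w_bounded w_right 1 (-1) (Grecov GB) hC.
  congr recov; apply/funext => x; rewrite !indicE !in_setI in_setC.
  by case: (x \in C); case: (x \in B); rewrite /= ?subrr; ring.
- move=> F mF tF hF.
  have mFB n : measurable (F n `&` B) by exact: measurableI.
  pose g n x : R := \sum_(i < n) \1_(F i `&` B) x.
  have hg n : recov (g n).
    elim: n => [|n IH].
      by have := recov0; congr recov; apply/funext => x; rewrite /g big_ord0.
    have := recovered_comb mw w_ge0 w_bounded w_right 1 1 IH (hF n).
    by congr recov; apply/funext => x; rewrite /g big_ord_recr /= !mul1r.
  have gE n x : g n x = \1_((\bigcup_(i < n) F i) `&` B) x.
    elim: n => [|n IH].
      rewrite /g big_ord0 indicE memNset// => -[[i]] //.
    rewrite /g big_ord_recr /= -/(g n x) IH !indicE !in_setI.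
    have [xB|] := boolP (x \in B); rewrite ?andbF ?addr0// !andbT.
    have [xF|xF] := boolP (x \in F n).
      rewrite memNset ?add0r; last first.
        move=> [i /= ni Fi]; have := tF i n I I.
        move=> /(_ _)/eqP; rewrite eqn_leq [(n <= i)%N]leqNgt ni andbF => h.
        by have : false by apply: h; exists x; split=> //; rewrite inE in xF.
      by rewrite [in RHS]mem_set//; exists n => //=; rewrite inE in xF.
    rewrite addr0; congr ((_ : bool)%:R); apply/idP/idP; rewrite !inE.
      by move=> [i /= ni Fi]; exists i => //=; exact: ltnW.
    move=> [i /= ni Fi]; exists i => //=; move: ni; rewrite ltnS leq_eqVlt => /predU1P[ni|//].
    by move: xF; rewrite notin_setE -ni.
  apply: (@recov_limit_seq _ g (\1_B)) => //.
  + apply: finS; last exact: subIsetr.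
    by apply: measurableI => //; exact: bigcup_measurable.
  + exact: (finS B mB (@subset_refl _ B)).1.
  + move=> x; have [[[i _ Fi] Bx]|nx] := pselect ((\bigcup_k F k `&` B) x).
      rewrite [\1_(\bigcup_k F k `&` B) x]indicE mem_set//=; last by split=> //; exists i.
      apply: cvg_near_cst; exists i.+1 => // n /= ni; rewrite gE indicE mem_set//.
      by split=> //; exists i.
    rewrite [\1_(\bigcup_k F k `&` B) x]indicE memNset//=.
    apply: cvg_near_cst; apply: nearW => n; rewrite gE indicE memNset//.
    by move=> [[i _ Fi] Bx]; apply: nx; split=> //; exists i.
  + move=> n x; rewrite gE !indicE !in_setI.
    have [xB|] := boolP (x \in B); rewrite ?andbF ?subrr ?expr0n// !andbT.
    by case: (x \in _); case: (x \in _); rewrite /= ?subr0 ?subrr ?sub0r ?sqrrN ?expr1n ?expr0n//.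
Qed.

Import HBNNSimple.

Variable B : nat -> set X.
Hypothesis GB : forall k, G (B k).
Hypothesis B_exhaust : forall x, exists N, forall n, (N <= n)%N -> B n x.

(** Simple functions increasing to [f], cut off to the exhausting sets [B n], are combinations of
    the indicators just treated, and f^2 dominates the squared errors. *)
Lemma recov_ge0 f : (forall x, 0 <= f x) -> square_integrable m f -> recov f.
Proof.
move=> f0 hf; have mf := measurable_integrable hf.1.
have mfE : measurable_fun setT (EFin \o f) by exact/measurable_EFinP.
pose phi := nnsfun_approx measurableT mfE.
have phi_cvg x : phi n x @[n --> \oo] --> f x.
  have := cvg_nnsfun_approx measurableT mfE (fun x _ => f0 x : (0 <= (EFin \o f) x)%E) (x := x) I.
  by move=> /fine_cvg /=.
have phi_le n x : phi n x <= f x.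
  have nd : nondecreasing_seq (fun n => phi n x).
    by move=> a b ab; exact/lefP/nd_nnsfun_approx.
  have := nondecreasing_cvgn_le nd (cvgP _ (phi_cvg x)) n.
  by rewrite (cvg_lim _ (phi_cvg x)).
have hphi n : recov (fun x => phi n x * \1_(B n) x).
  have -> : (fun x => phi n x * \1_(B n) x) =
    (fun x => \sum_(y <- finmap.enum_fset (fset_set (range (phi n)))) y * \1_(phi n @^-1` [set y] `&` B n) x).
    apply/funext => x; rewrite {1}(fimfunE (phi n) x) fsbig_finite//= mulr_suml.
    apply: eq_bigr => y _; rewrite -mulrA; congr (_ * _).
    by rewrite !indicE in_setI; case: (_ \in _); case: (_ \in _); rewrite /= ?mulr1 ?mulr0 ?mul0r.
  elim: (finmap.enum_fset (fset_set (range (phi n)))) => [|y s IH].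
    by have := recov0; congr recov; apply/funext => x; rewrite big_nil.
  have hy : recov (\1_(phi n @^-1` [set y] `&` B n)) by exact: recov_indic_setI.
  have := recovered_comb mw w_ge0 w_bounded w_right y 1 hy IH.
  by congr recov; apply/funext => x; rewrite big_cons mul1r.
apply: (@recov_limit_seq _ (fun n x => phi n x * \1_(B n) x) (fun x => f x ^+ 2)) => //.
- exact: hf.2.
- move=> x; have [N hN] := B_exhaust x.
  apply: cvg_trans (phi_cvg x); apply: near_eq_cvg.
  by exists N => // n /= /hN Bn; rewrite indicE mem_set// mulr1.
- move=> n x; rewrite indicE.
  have h1 := phi_le n x; have h2 : 0 <= phi n x by [].
  by case: (_ \in _); rewrite /= ?mulr1 ?mulr0 ?subr0// lerXn2r ?nnegrE ?subr_ge0// lerBlDr lerDl.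
Qed.

(** [f] is the difference of its positive and negative parts (|f| + f) / 2 and (|f| - f) / 2. *)
Lemma recov_all f : square_integrable m f -> recov f.
Proof.
move=> [f1 f2]; have mf := measurable_integrable f1.
have hp (s : R) : `|s| <= 1 -> square_integrable m (fun x => 2^-1 * (`|f x| + s * f x)).
  move=> s1.
  have fa : m.-integrable setT (EFin \o (fun x => `|f x|)).
    by rewrite (_ : EFin \o _ = abse \o (EFin \o f))//; exact: integrable_abse.
  have h : square_integrable m (fun x => `|f x|).
    split=> //; move: f2; congr (m.-integrable _ (EFin \o _)).
    by apply/funext => x; rewrite real_normK ?num_real.
  have := square_integrable_comb 2^-1 (2^-1 * s) h (conj f1 f2).
  by congr (square_integrable _ _); apply/funext => x; ring.
have pos (s : R) : s = 1 \/ s = -1 -> forall x, 0 <= 2^-1 * (`|f x| + s * f x).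
  move=> hs x; rewrite mulr_ge0 ?invr_ge0//.
  by case: hs => ->; rewrite ?mul1r ?mulN1r; have := ler_norm (f x); have := ler_norm (- f x); rewrite normrN; lra.
have r1 := recov_ge0 (pos 1 (or_introl erefl)) (hp 1 ltac:(by rewrite normr1)).
have r2 := recov_ge0 (pos (-1) (or_intror erefl)) (hp (-1) ltac:(by rewrite normrN1)).
have := recovered_comb mw w_ge0 w_bounded w_right 1 (-1) r1 r2.
by congr recov; apply/funext => x; field.
Qed.
End AveragingDense.
Section AverageError.
Context {R : realType} d (X : measurableType d)
  (m : {sigma_finite_measure set X -> \bar R}).
Variable w : nat -> X * X -> R.
Hypothesis mw : forall n, measurable_fun setT (w n).
Hypothesis w_ge0 : forall n z, 0 <= w n z.
Hypothesis w_bounded : forall n, exists M, forall z, w n z <= M.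
Hypothesis w_left : forall n x, (\int[m]_y (w n (x, y))%:E = 1)%E.
Hypothesis w_right : forall n y, (\int[m]_x (w n (x, y))%:E = 1)%E.

Lemma average_close n f x (c : R) : m.-integrable setT (EFin \o f) ->
  (forall y, w n (x, y) != 0 -> `|f y - f x| <= c) ->
  `|average m w n f x - f x| <= c.
Proof.
move=> fi h.
have wi := integrable_w1 mw w_ge0 w_left n x.
have w1 : \int[m]_y w n (x, y) = 1 by rewrite /Rintegral w_left.
have cE (b : R) : b = \int[m]_y (b * w n (x, y)) by rewrite RintegralZl// w1 mulr1.
have i1 := integrable_average mw w_ge0 w_bounded n x fi.
have i2 b : m.-integrable setT (EFin \o (fun y => b * w n (x, y))).
  exact: integrableZ_real.
rewrite [in X in `|_ - X|](cE (f x)) /average -RintegralB//.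
apply: le_trans (le_normr_Rintegral _ _) _ => //; first exact: integrableB_real.
rewrite [leRHS](cE c); apply: le_Rintegral => //.
- have := integrable_abse (integrableB_real measurableT i1 (i2 (f x))); exact.
- move=> y _; rewrite -mulrBl normrM (ger0_norm (w_ge0 _ _)).
  have [->|h0] := eqVneq (w n (x, y)) 0; first by rewrite !mulr0.
  by apply: ler_wpM2r => //; exact: h.
Qed.

Lemma average_error_le n f (B : set X) (c : R) : 0 <= c -> measurable B ->
  m.-integrable setT (EFin \o f) ->
  (forall x, `|average m w n f x - f x| <= c * \1_B x) ->
  (average_error m w n f <= (c ^+ 2)%:E * m B)%E.
Proof.
move=> c0 mB fi h.
have mavg := measurable_average mw w_ge0 w_bounded w_right n fi.
have mf := measurable_integrable fi.
apply: (@le_trans _ _ (\int[m]_x ((c ^+ 2)%:E * (\1_B x)%:E))%E).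
  apply: ge0_le_integral => //.
  - by move=> x _; rewrite lee_fin sqr_ge0.
  - apply/measurable_EFinP; apply: measurable_funX.
    exact: measurable_realfun.measurable_funB.
  - by apply/measurable_EFinP; apply: measurable_realfun.measurable_funM => //; exact: measurable_indic.
  - move=> x _; rewrite -EFinM lee_fin -[leLHS]real_normK ?num_real//.
    have := h x; rewrite indicE; case: (x \in B) => /=.
      by rewrite !mulr1 => hx; apply: lerXn2r => //; rewrite nnegrE ?normr_ge0.
    by rewrite !mulr0 normr_le0 => /eqP->; rewrite normr0 expr0n.
rewrite ge0_integralZl//.
- by rewrite integral_indic// setIT.
- by apply/measurable_EFinP; exact: measurable_indic.
- by rewrite lee_fin sqr_ge0.
Qed.

End AverageError.

(** * Mollifiers and convergence in L^2 *)

Section Mollifier.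
Context {R : realType}.
Local Notation L := (@lebesgue_measure R).
Local Notation plane := (measurableTypeR R * measurableTypeR R)%type.
Local Notation mu := (L \x L)%E.

(* The library gives [\x] no sigma-finite instance. *)
Definition lebesgue2 : set plane -> \bar R := mu.

HB.instance Definition _ := Measure.copy lebesgue2 mu.

Lemma lebesgue2_sigma_finite : sigma_finite setT lebesgue2.
Proof.
have /sigma_finiteP[F [TF ndF Foo]] := sigma_finiteT L.
exists (fun n => F n `*` F n).
  rewrite -setXTT TF predeqE => -[x y]; split.
    move=> [/= [n _ Fnx] [k _ Gky]]; exists (maxn n k) => //; split.
    - by move: x Fnx; exact/subsetPset/ndF/leq_maxl.
    - by move: y Gky; exact/subsetPset/ndF/leq_maxr.
  by move=> [n _ []/= ? ?]; split; exists n.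
move=> k; have [? ?] := Foo k.
split; first exact: measurableX.
by rewrite /lebesgue2 product_measure1E// lte_mul_pinfty// ge0_fin_numE.
Qed.

HB.instance Definition _ :=
  Measure_isSigmaFinite.Build _ plane R lebesgue2 lebesgue2_sigma_finite.

Local Notation smu := (lebesgue2 : {sigma_finite_measure set plane -> \bar R}).
Implicit Types (f g k : R * R -> R) (i : 'I_2) (x y : R * R) (e : R).

Lemma box_bump_kernel a b c d (k : R) : 0 < k -> is_kernel (box_bump a b c d k).
Proof.
move=> k0; split; first exact: elementary_box_bump.
exists (`|a| + `|b| + `|c| + `|d|) => x nx; apply: box_bump_out => // xB; apply: nx.
case: xB; rewrite /= !in_itv /= => /andP[h1 h2] /andP[h3 h4].
have := ler_norm a; have := ler_norm b; have := ler_norm c; have := ler_norm d.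
have := ler_norm (- a); have := ler_norm (- b); have := ler_norm (- c); have := ler_norm (- d).
rewrite !normrN.
have := normr_ge0 a; have := normr_ge0 b; have := normr_ge0 c; have := normr_ge0 d.
by move=> *; split; rewrite /= in_itv /=; lra.
Qed.

Lemma kernel_integrable k : is_kernel k -> mu.-integrable setT (EFin \o k).
Proof.
move=> [ek [e ke]]; apply: (continuous_support_integrable _ (@compact_cbox _ (- e) e (- e) e) ke).
exact: elementary_continuous.
Qed.

Lemma measure_obox a b c d : a < b -> c < d ->
  mu (obox a b c d) = ((b - a) * (d - c))%:E.
Proof.
move=> ab cd; rewrite /obox product_measure1E//= !lebesgue_measure_itv /= !lte_fin ab cd.
by rewrite -!EFinD -EFinM.
Qed.

Definition moll0 e := box_bump (- e) e (- e) e 1.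

(** With integral zero the bump would vanish almost everywhere, yet it is positive on a box of
    positive measure. *)
Lemma moll0_mass_gt0 e : 0 < e -> 0 < \int[mu]_x moll0 e x.
Proof.
move=> e0; have h0 x : 0 <= moll0 e x by have /andP[] := box_bump_itv (- e) e (- e) e 1 x.
rewrite lt_neqAle Rintegral_ge0 ?andbT//; apply/negP => /eqP/esym z0.
have ki := kernel_integrable (@box_bump_kernel (- e) e (- e) e 1 ltr01).
have mk : measurable_fun [set: plane] (EFin \o moll0 e : plane -> \bar R) by exact: measurable_int ki.
have I0 : (\int[mu]_x `|(moll0 e x)%:E| = 0)%E.
  under eq_integral do rewrite /= ger0_norm//.
  move: z0; rewrite /Rintegral => z0; rewrite -[LHS]fineK ?z0//.
  exact: integrable_fin_num.
have [N [mN N0 hN]] := (@ae_eq_integral_abs _ plane R mu setT measurableT _ mk).1 I0.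
have : obox (- e) e (- e) e `<=` N.
  move=> x xB; apply: hN => /= h; have := h I => /eqP; rewrite eqe /=.
  case: xB; rewrite /= !in_itv /= => /andP[h1 h2] /andP[h3 h4].
  rewrite gt_eqF// /moll0 /box_bump /ebump !mul1r !ifT; [|by lra..].
  by rewrite !hornerC !mul1r !mulr_gt0 ?expR_gt0.
move=> sub; have := measure_obox (_ : - e < e) (_ : - e < e).
have /eqP : mu (obox (- e) e (- e) e) = 0%E.
  apply/eqP; rewrite -measure_le0 -N0; apply: le_measure => //; rewrite ?inE//.
  exact: measurable_obox.
move=> /eqP -> /(_ ltac:(lra) ltac:(lra)) [] /esym/eqP; rewrite gt_eqF// mulr_gt0//; lra.
Qed.

Definition moll e x : R := (\int[mu]_x moll0 e x)^-1 * moll0 e x.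

Lemma moll_ge0 e x : 0 < e -> 0 <= moll e x.
Proof.
move=> e0; rewrite mulr_ge0//; first by rewrite invr_ge0 ltW// moll0_mass_gt0.
by have /andP[] := box_bump_itv (- e) e (- e) e 1 x.
Qed.

Lemma moll_out e x : ~ obox (- e) e (- e) e x -> moll e x = 0.
Proof. by move=> nx; rewrite /moll /moll0 box_bump_out ?mulr0. Qed.

Lemma moll_kernel e : is_kernel (moll e).
Proof.
have [h1 [E hE]] := @box_bump_kernel (- e) e (- e) e 1 ltr01.
split; first by apply: elementary_mul => //; exact: elementary_cst.
by exists E => x /hE h; rewrite /moll /moll0 h mulr0.
Qed.

Lemma moll_even e x : moll e (- x.1, - x.2) = moll e x.
Proof.
rewrite /moll /moll0 /box_bump /= !mul1r; congr (_ * (_ * _)).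
  by rewrite mulrC; congr (ebump 1 _ * ebump 1 _); ring.
by rewrite mulrC; congr (ebump 1 _ * ebump 1 _); ring.
Qed.

Lemma Rintegral_moll e : 0 < e -> \int[mu]_x moll e x = 1.
Proof.
move=> e0; have h := moll0_mass_gt0 e0.
rewrite /moll RintegralZl//; first by rewrite mulVf// gt_eqF.
exact: (kernel_integrable (@box_bump_kernel (- e) e (- e) e 1 ltr01)).
Qed.

Lemma integral_moll e : 0 < e -> (\int[mu]_x (moll e x)%:E = 1)%E.
Proof.
move=> e0; have ki := kernel_integrable (moll_kernel e).
by rewrite -[LHS]fineK; [congr (_%:E); exact: Rintegral_moll|exact: integrable_fin_num].
Qed.

Lemma integral_moll_right e y : 0 < e ->
  (\int[mu]_x (moll e (x.1 - y.1, x.2 - y.2))%:E = 1)%E.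
Proof.
move=> e0; rewrite -(integral_moll e0).
pose F x := (moll e x)%:E : \bar R.
have mF : measurable_fun [set: plane] (F : plane -> \bar R).
  by apply/measurable_EFinP; apply: elementary_measurable; have [] := moll_kernel e.
have F0 x : (0 <= F x)%E by rewrite lee_fin moll_ge0.
by have := ge0_integral_preserving (translation_preserving (- y.1, - y.2)) mF F0.
Qed.

Lemma integral_moll_left e x : 0 < e ->
  (\int[mu]_y (moll e (x.1 - y.1, x.2 - y.2))%:E = 1)%E.
Proof.
move=> e0; rewrite -(integral_moll_right x e0); apply: eq_integral => y _.
by rewrite -moll_even /=; congr ((moll e (_, _))%:E); ring.
Qed.

Definition moll_weight n (z : plane * plane) : R :=
  moll n.+1%:R^-1 (z.1.1 - z.2.1, z.1.2 - z.2.2).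

Lemma moll_weight_measurable n : measurable_fun setT (moll_weight n).
Proof.
have [em _] := moll_kernel n.+1%:R^-1.
apply: (measurableT_comp (elementary_measurable em)).
have m1 : measurable_fun setT (fun z : plane * plane => z.1) by exact: measurable_fst.
have m2 : measurable_fun setT (fun z : plane * plane => z.2) by exact: measurable_snd.
apply: measurable_fun_pair; apply: measurable_realfun.measurable_funB.
- exact: measurableT_comp measurable_fst m1.
- exact: measurableT_comp measurable_fst m2.
- exact: measurableT_comp measurable_snd m1.
- exact: measurableT_comp measurable_snd m2.
Qed.

Lemma invn_gt0 (n : nat) : 0 < n.+1%:R^-1 :> R.
Proof. by rewrite invr_gt0 ltr0n. Qed.

Lemma moll_weight_ge0 n z : 0 <= moll_weight n z.
Proof. by apply: moll_ge0; exact: invn_gt0. Qed.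

Lemma moll_weight_bounded n : exists M, forall z, moll_weight n z <= M.
Proof.
have [M _ hM] := kernel_bounded (moll_kernel n.+1%:R^-1).
by exists M => z; apply: le_trans (hM _); exact: ler_norm.
Qed.

Lemma moll_weight_left n x : (\int[mu]_y (moll_weight n (x, y))%:E = 1)%E.
Proof. by rewrite /moll_weight /= integral_moll_left// invn_gt0. Qed.

Lemma moll_weight_right n y : (\int[mu]_x (moll_weight n (x, y))%:E = 1)%E.
Proof. by rewrite /moll_weight /= integral_moll_right// invn_gt0. Qed.

Lemma kernel_square_integrable k : is_kernel k -> square_integrable smu k.
Proof.
move=> [ek [e ke]]; split; first by apply: kernel_integrable; split=> //; exists e.
apply: (@kernel_integrable (fun x => k x ^+ 2)); split; first exact: elementary_exp.
by exists e => x /ke->; rewrite expr0n.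
Qed.

(** A Lipschitz function changes by at most 2 M / (n + 1) when averaged over a square of half-side
    1/(n + 1). Outside the support box enlarged by 1 both [k] and its averages vanish, so the error
    lives on a set of finite measure. *)
Lemma kernel_recovered k : is_kernel k -> recovered smu moll_weight k.
Proof.
move=> kk; split; first exact: kernel_square_integrable.
have [ek [E kE]] := kk; have [M M0 hM] := kernel_lipschitz kk.
have ki : smu.-integrable setT (EFin \o k) by exact: (kernel_integrable kk).
have close := average_close (@moll_weight_measurable) (m := smu) (@moll_weight_ge0)
  (@moll_weight_bounded) moll_weight_left.
have error := average_error_le (@moll_weight_measurable) (m := smu) (@moll_weight_ge0)
  (@moll_weight_bounded) moll_weight_right.
pose B := cbox (- (E + 1)) (E + 1) (- (E + 1)) (E + 1).
have mB : measurable (B : set plane) by exact: measurable_cbox.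
pose I := fine (mu B).
have muB : mu B = I%:E by rewrite fineK// ge0_fin_numE// measure_cbox_lty.
have I0 : 0 <= I by rewrite fine_ge0.
have near_ n x y : moll n.+1%:R^-1 (x.1 - y.1, x.2 - y.2) != 0 ->
    `|x.1 - y.1| <= n.+1%:R^-1 /\ `|x.2 - y.2| <= n.+1%:R^-1.
  move=> h; have [[h1 h2]|/moll_out] := pselect (obox (- n.+1%:R^-1) n.+1%:R^-1 (- n.+1%:R^-1)
      n.+1%:R^-1 (x.1 - y.1, x.2 - y.2)); last by move/eqP; rewrite (negbTE h).
  move: h1 h2; rewrite /= !in_itv /= => /andP[h1 h2] /andP[h3 h4].
  by rewrite !ler_norml !ltW.
have n1 n : n.+1%:R^-1 <= 1 :> R by rewrite invf_le1// ler1n.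
have wider (r u v : R) : r <= 1 -> `|u - v| <= r -> - E <= v <= E -> - (E + 1) <= u <= E + 1.
  by rewrite ler_norml => ? /andP[? ?] /andP[? ?]; apply/andP; split; lra.
have err n x : `|average smu moll_weight n k x - k x| <= 2 * M * n.+1%:R^-1 * \1_B x.
  apply: (close n k x _ ki) => y; rewrite /moll_weight /= => /near_[h1 h2].
  rewrite indicE; have [xB|xB] := pselect (B x).
    rewrite mem_set//= mulr1 distrC; apply: (le_trans (hM _ _)).
    rewrite -mulrA mulrCA; apply: ler_wpM2l => //.
    by apply: (le_trans (lerD h1 h2)); rewrite mulr_natl mulr2n.
  have hx : ~ cbox (- E) E (- E) E x.
    by move=> [] /=; rewrite !in_itv /= => h3 h4; apply: xB; split;
      rewrite /= in_itv /=; clear - h3 h4; lra.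
  have hy : ~ cbox (- E) E (- E) E y.
    move=> [] /=; rewrite !in_itv /= => h3 h4; apply: xB.
    by split; rewrite /= in_itv /=; [exact: wider (n1 n) h1 h3|exact: wider (n1 n) h2 h4].
  by rewrite memNset//= mulr0 !kE// subrr normr0.
move=> e e0.
pose C := (2 * M) ^+ 2 * I.
have C0 : 0 <= C by rewrite mulr_ge0// sqr_ge0.
exists (Num.bound (C / e)) => n hn.
have n0 : 0 < n.+1%:R^-1 :> R by exact: invn_gt0.
have c0 : 0 <= 2 * M * n.+1%:R^-1 by rewrite !mulr_ge0// ltW.
apply: (le_trans (error n k B _ c0 mB ki (err n))).
have -> : smu B = I%:E := muB.
rewrite -EFinM lee_fin.
apply: (@le_trans _ _ (C * n.+1%:R^-1)).
  rewrite /C exprMn mulrAC; apply: ler_wpM2l => //.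
  by rewrite expr2 ler_piMl// ltW.
rewrite ler_pdivrMr ?ltr0n// mulrC -ler_pdivrMr//.
apply: (@le_trans _ _ (Num.bound (C / e))%:R).
  by apply/ltW/archi_boundP; rewrite divr_ge0// ltW.
by rewrite ler_nat; exact: leqW.
Qed.

Lemma obox_recovered a b c d : recovered smu moll_weight (\1_(obox a b c d)).
Proof.
have mO := @measurable_obox R a b c d.
have finO : (mu (obox a b c d) < +oo)%E.
  apply: le_lt_trans (measure_cbox_lty a b c d); apply: le_measure; rewrite ?inE//.
    exact: measurable_cbox.
  exact: sub_obox_cbox.
have sO := square_integrable_indic (m := smu) mO finO.
have lim := recov_limit_seq (@moll_weight_measurable) (m := smu) (@moll_weight_ge0)
  (@moll_weight_bounded) moll_weight_left moll_weight_right.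
apply: (lim _ (fun n => box_bump a b c d n.+1%:R) _ sO _ sO.1).
- by move=> n; apply: kernel_recovered; exact: box_bump_kernel.
- by move=> x; exact: cvg_box_bump.
- move=> n x; have /andP[h0 h1] := box_bump_itv a b c d n.+1%:R x.
  rewrite indicE; have [xB|xB] := pselect (obox a b c d x).
    rewrite mem_set//=; rewrite -[leRHS](expr1n _ 2); apply: lerXn2r; rewrite ?nnegrE; lra.
  by rewrite memNset//= box_bump_out// subrr expr0n.
Qed.

(** Kernels converge by their Lipschitz bound, indicators of boxes are limits of kernels, and boxes
    generate the measurable sets of the plane. *)
Theorem mollification_cvg f : square_integrable smu f ->
  forall e, 0 < e -> exists N, forall n, (N <= n)%N ->
    (\int[mu]_x ((conv f (moll n.+1%:R^-1) x - f x) ^+ 2)%:E <= e%:E)%E.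
Proof.
move=> hf; have [_] : recovered smu moll_weight f; last exact.
have all_ := recov_all (@moll_weight_measurable) (m := smu) (@moll_weight_ge0)
  (@moll_weight_bounded) moll_weight_left moll_weight_right (@measurable_sigma_oboxes R).
pose B (k : nat) : set (R * R) := obox (- k%:R) k%:R (- k%:R) k%:R.
refine (all_ (@setI_closed_oboxes R) _ _ B _ _ f hf).
- move=> _ [a [b [c [d ->]]]].
  apply: le_lt_trans (measure_cbox_lty a b c d); apply: le_measure; rewrite ?inE.
  + exact: measurable_obox.
  + exact: measurable_cbox.
  + exact: sub_obox_cbox.
- by move=> _ [a [b [c [d ->]]]]; exact: obox_recovered.
- by move=> k; do 4 eexists.
- move=> x; exists (Num.bound (`|x.1| + `|x.2|)) => n hn.
  have h : `|x.1| + `|x.2| < n%:R.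
    apply: lt_le_trans (archi_boundP _) _; first exact: addr_ge0.
    by rewrite ler_nat.
  have := normr_ge0 x.1; have := normr_ge0 x.2 => h1 h2.
  by split; rewrite /= in_itv /= -ltr_norml; lra.
Qed.

Lemma conv_moll_contraction f n : square_integrable smu f ->
  (\int[mu]_x (conv f (moll n.+1%:R^-1) x ^+ 2)%:E <= \int[mu]_x (f x ^+ 2)%:E)%E.
Proof.
move=> hf; have contr := average_contraction (@moll_weight_measurable) (m := smu)
  (@moll_weight_ge0) (@moll_weight_bounded) moll_weight_left moll_weight_right.
exact: (contr n f hf).
Qed.
End Mollifier.

(** * The logarithmic cutoff *)

Section DiscRadial.
Context {R : realType}.
Local Notation L := (@lebesgue_measure R).
Local Notation plane := (measurableTypeR R * measurableTypeR R)%type.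
Local Notation mu := (L \x L)%E.

Definition sqnorm (x : R * R) : R := x.1 ^+ 2 + x.2 ^+ 2.

Lemma sqnorm_ge0 x : 0 <= sqnorm x.
Proof. by rewrite addr_ge0 ?sqr_ge0. Qed.

(** Adding the bound [M] makes the integrand nonnegative, so that the radial formula applies; the
    contribution of [M] is subtracted at the end. The variable is |x|^2, whence the factor pi. *)
Lemma disc_radial (f F : R -> R) (M : R) :
  (forall t : R, 0 <= t <= 1 -> `|f t| <= M) ->
  (forall t : R, 0 <= t <= 1 -> is_derive t (1 : R) F (f t)) ->
  (forall t : R, 0 <= t <= 1 -> {for t, continuous f}) ->
  mu.-integrable (@disc R) (EFin \o (fun x => f (sqnorm x))) /\
  \int[mu]_(x in @disc R) f (sqnorm x) = pi * (F 1 - F 0).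
Proof.
move=> fM dF cf.
pose g : measurableTypeR R -> \bar R := (fun t => (f t + M)%:E) \_ `[0, 1[.
have g_ge0 s : (0 <= g s)%E.
  rewrite /g patchE; case: ifPn => // /set_mem; rewrite /= in_itv /= => /andP[s0 s1].
  have : `|f s| <= M by apply: fM; rewrite s0 ltW.
  by rewrite lee_fin ler_norml; lra.
have cfM (t : R) : 0 <= t <= 1 -> {for t, continuous (fun t => f t + M)}.
  by move=> t01; apply: cvgD; [exact: cf|exact: cvg_cst].
have mf (D : set R) : measurable D -> D `<=` `[0, 1] ->
    measurable_fun D (fun t => f t + M : measurableTypeR R).
  move=> mD D01; apply: (measurable_funS (measurable_itv `[0, 1]) D01).
  apply: subspace_continuous_measurable_fun; first exact: measurable_itv.
  apply: continuous_in_subspaceT => t /set_mem; rewrite /= in_itv /=.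
  exact: cfM.
have sub01 : [set` `[0, 1[%R] `<=` [set` `[(0 : R), 1]%R].
  by move=> t; rewrite /= !in_itv /= => /andP[-> /ltW].
have mg : measurable_fun setT g.
  apply/(measurable_restrictT _ (measurable_itv `[(0 : R), 1[)).
  by apply/measurable_EFinP; apply: mf => //; exact: measurable_itv.
have E1 : (\int[mu]_(x in @disc R) (f (sqnorm x) + M)%:E = (pi * (F 1 - F 0 + M))%:E)%E.
  transitivity (\int[mu]_p g (p.1 ^+ 2 + p.2 ^+ 2)%R)%E.
    rewrite integral_mkcond; apply: eq_integral => x _.
    rewrite disc_sqnorm !patchE; congr (if _ then _ else _).
    apply/idP/idP => /set_mem h; apply/mem_set; move: h; rewrite /= in_itv /=.
      by rewrite (sqnorm_ge0 x).
    by case/andP.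
  rewrite (ge0_integral_radial mg g_ge0).
  have -> : (\int[L]_(s in `[0%R, +oo[) g s = \int[L]_(s in `[0%R, 1%R]) (f s + M)%:E)%E.
    rewrite -[RHS]integral_itv_bndo_bndc; last by apply/measurable_EFinP; exact: mf.
    rewrite [RHS]integral_mkcond [LHS]integral_mkcond; apply: eq_integral => s _.
    rewrite /g !patchE; case: ifPn => // /negP ns; case: ifPn => // /set_mem h.
    by case: ns; apply/mem_set; move: h; rewrite /= !in_itv /= => /andP[->].
  have dFM (t : R) : 0 <= t <= 1 -> is_derive t (1 : R) (fun t => F t + M * t) (f t + M).
    move=> /dF d; apply: is_derive_eq; rewrite /GRing.scale /=; ring.
  have := Rintegral_is_derive_within ltr01 dFM cfM.
  have iM : L.-integrable `[0, 1] (EFin \o (fun t => f t + M)).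
    apply: continuous_compact_integrable; first exact: segment_compact.
    apply: continuous_in_subspaceT => t /set_mem; rewrite /= in_itv /=.
    exact: cfM.
  rewrite /Rintegral => h; rewrite -[X in (_ * X)%E]fineK; last exact: integrable_fin_num.
  by rewrite h -EFinM; congr (_%:E); ring.
have mD := @measurable_disc R.
have msq : measurable_fun (@disc R) (fun x => f (sqnorm x) + M : measurableTypeR R).
  have : measurable_fun setT (g \o (fun p : plane => p.1 ^+ 2 + p.2 ^+ 2 : measurableTypeR R)).
    by apply: measurableT_comp => //; exact: measurable_sqnorm.
  move=> /(measurable_funS measurableT (@subsetT _ (@disc R))) h.
  apply/measurable_EFinP; apply: (eq_measurable_fun _ _ h) => x /set_mem.
  rewrite disc_sqnorm => xD; rewrite /= /g patchE mem_set//= in_itv /=.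
  by rewrite (sqnorm_ge0 x).
have cstM : mu.-integrable (@disc R) (EFin \o cst M).
  apply/integrableP; split; first by apply/measurable_EFinP; exact: measurable_cst.
  under eq_integral do rewrite /=.
  by rewrite integral_cst//= measure_disc -EFinM ltry.
have i1 : mu.-integrable (@disc R) (EFin \o (fun x => f (sqnorm x) + M)).
  apply/integrableP; split; first exact/measurable_EFinP.
  apply: (@le_lt_trans _ _ (\int[mu]_(x in @disc R) (f (sqnorm x) + M)%:E)%E); last first.
    by rewrite E1 ltry.
  rewrite le_eqVlt; apply/orP; left; apply/eqP; apply: eq_integral => x /set_mem.
  rewrite disc_sqnorm => xD; rewrite /= ger0_norm//.
  have : `|f (sqnorm x)| <= M by apply: fM; rewrite sqnorm_ge0 ltW.
  by rewrite ler_norml; lra.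
have E (x : R * R) : f (sqnorm x) = f (sqnorm x) + M - M by rewrite addrK.
have I : mu.-integrable (@disc R) (EFin \o (fun x => f (sqnorm x))).
  rewrite (_ : (fun x => _) = (fun x => f (sqnorm x) + M - M)); last by apply/funext.
  exact: (integrableB_real mD i1 cstM).
split=> //.
have h := Rintegral_comb2 1 (-1) mD i1 cstM.
transitivity (\int[mu]_(x in @disc R) ((f (sqnorm x) + M) * 1 + cst M x * -1)).
  by apply: eq_Rintegral => x _; rewrite /= mulr1 mulrN1 addrK.
rewrite {}h [X in _ + X * _]Rintegral_cst//= measure_disc /= /Rintegral E1 /=.
by ring.
Qed.
End DiscRadial.

Section LogCutoff.
Context {R : realType}.
Local Notation L := (@lebesgue_measure R).
Local Notation plane := (measurableTypeR R * measurableTypeR R)%type.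
Local Notation mu := (L \x L)%E.

Definition coord (i : 'I_2) (x : R * R) : R := if i == 0 then x.1 else x.2.

Lemma ord2_cases (i : 'I_2) : i = 0 \/ i = 1.
Proof. by case: i => -[|[|[]]]// ?; [left|right]; exact/val_inj. Qed.

Lemma is_derive_coord i j x : is_derive x (basis_vec R j) (coord i) (i == j)%:R.
Proof.
have [->|->] := ord2_cases i.
  have -> : (0 == j)%:R = (basis_vec R j).1 by have [->|->] := ord2_cases j.
  exact: is_derive_fst.
have -> : (1 == j)%:R = (basis_vec R j).2 by have [->|->] := ord2_cases j.
exact: is_derive_snd.
Qed.

Lemma is_derive_sqnorm i x : is_derive x (basis_vec R i) (@sqnorm R) (2 * coord i x).
Proof.
have h0 := is_derive_coord 0 i x; have h1 := is_derive_coord 1 i x.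
rewrite (_ : @sqnorm R = fun x => coord 0 x * coord 0 x + coord 1 x * coord 1 x); last first.
  by apply/funext => y; rewrite /sqnorm !expr2.
apply: is_derive_eq; rewrite /GRing.scale /=.
by have [->|->] := ord2_cases i; rewrite /=; ring.
Qed.

Lemma compact_half_disc : compact [set x : R * R | sqnorm x <= 1 / 4].
Proof.
apply: (@subclosed_compact _ _ (cbox (-1) 1 (-1) 1)).
- have /continuous_closedP := @sqnorm_continuous R.
  by move=> /(_ [set y | y <= 1 / 4]); apply; exact: closed_le.
- exact: compact_cbox.
- move=> x; rewrite /sqnorm /= => hx.
  by split; rewrite /= in_itv /= -ler_norml -(@ler_pXn2r _ 2)// ?nnegrE//
    real_normK ?num_real// expr1n; nra.
Qed.

Variable h : R.
Hypothesis h_gt0 : 0 < h.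

(* [log_scale (|x|^2)] is [ln (1 / (2 |x|))] with [|x|^2] replaced by
   [|x|^2 + h^2]; it is negative for [|x| > 1/2]. *)
Definition log_scale (s : R) : R := - 2^-1 * ln (4 * (s + h ^+ 2)).
(** t exp(-1/t) is a smooth substitute for the positive part of t, which it approximates from below
    within 1. *)
Definition cutoff s : R := log_scale s * ebump 1 (log_scale s).
(** A = - 2 cutoff' and B = - 2 A' in the variable s = |x|^2, so that the cutoff has gradient - A x
    and its Hessian has the entries x_i x_j B - delta_ij A. *)
Definition cutoffA s : R := ebump (1 + 'X) (log_scale s) / (s + h ^+ 2).
Definition cutoffB s : R :=
  (ebump 'X^3 (log_scale s) + 2 * ebump (1 + 'X) (log_scale s)) / (s + h ^+ 2) ^+ 2.

Lemma reg_gt0 s : 0 <= s -> 0 < s + h ^+ 2.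
Proof. by move=> s0; rewrite ltr_wpDl// exprn_gt0. Qed.

Lemma is_derive_log_scale (s : R) : 0 <= s ->
  is_derive s (1 : R) log_scale (- (2 * (s + h ^+ 2))^-1).
Proof.
move=> s0; have p := reg_gt0 s0.
have d1 : is_derive s (1 : R) (fun t => 4 * (t + h ^+ 2)) 4.
  by apply: is_derive_eq; rewrite /GRing.scale /=; ring.
have p4 : 0 < 4 * (s + h ^+ 2) by rewrite mulr_gt0.
have d2 := is_derive1_ln p4.
have d3 := @is_derive1_comp R (@ln R) (fun t => 4 * (t + h ^+ 2)) s _ _ d2 d1.
have d4 : is_derive s (1 : R) (fun t => ln (4 * (t + h ^+ 2))) ((4 * (s + h ^+ 2))^-1 * 4).
  exact: d3.
rewrite /log_scale; apply: is_derive_eq; rewrite /GRing.scale /=.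
by field; rewrite gt_eqF.
Qed.

Lemma is_derive_tebump t :
  is_derive t (1 : R) (fun t => t * ebump 1 t) (ebump (1 + 'X) t).
Proof.
have d := is_derive_ebump 1 t.
apply: is_derive_eq; rewrite /GRing.scale /= /ebump_deriv /ebump.
case: ifPn => [t0|_]; last by rewrite mulr0 mul0r addr0.
rewrite derivC subr0 mulr1 !hornerE /=.
by field; rewrite gt_eqF.
Qed.

Lemma is_derive_ebumpX t : is_derive t (1 : R) (ebump (1 + 'X)) (ebump 'X^3 t).
Proof.
have d := is_derive_ebump (1 + 'X) t.
have <- : ebump_deriv (1 + 'X) = 'X^3 :> {poly R} by rewrite /ebump_deriv derivD derivX derivC add0r addrAC subrr add0r -exprSr.
by [].
Qed.

Lemma is_derive_cutoff (s : R) : 0 <= s -> is_derive s (1 : R) cutoff (- (cutoffA s / 2)).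
Proof.
move=> s0; have p := reg_gt0 s0.
have d := @is_derive1_comp R (fun t => t * ebump 1 t) log_scale s _ _
  (is_derive_tebump _) (is_derive_log_scale s0).
have d' : is_derive s (1 : R) cutoff (ebump (1 + 'X) (log_scale s) * - (2 * (s + h ^+ 2))^-1).
  exact: d.
apply: is_derive_eq; rewrite /cutoffA; field; rewrite gt_eqF//.
Qed.

Lemma is_derive_cutoffA (s : R) : 0 <= s -> is_derive s (1 : R) cutoffA (- (cutoffB s / 2)).
Proof.
move=> s0; have p := reg_gt0 s0.
have d := @is_derive1_comp R (ebump (1 + 'X)) log_scale s _ _
  (is_derive_ebumpX _) (is_derive_log_scale s0).
have d' : is_derive s (1 : R) (fun s => ebump (1 + 'X) (log_scale s))
   (ebump 'X^3 (log_scale s) * - (2 * (s + h ^+ 2))^-1).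
  exact: d.
have d1 : is_derive s (1 : R) (fun t => t + h ^+ 2) 1.
  by apply: is_derive_eq; rewrite addr0.
have pn : s + h ^+ 2 != 0 by rewrite gt_eqF.
have d2 := @is_deriveV R (fun t => t + h ^+ 2) s 1 1 pn d1.
rewrite /cutoffA; apply: is_derive_eq; rewrite /cutoffB /GRing.scale /=.
by field.
Qed.

(** This is (1 + u) exp(-u) <= 1 with u = 1/t. The constant 1 matters: it gives A |x|^2 <= 1, which
    lets the Hessian of W absorb the area term completely. *)
Lemma ebumpX_itv (t : R) : 0 <= ebump (1 + 'X) t <= 1.
Proof.
rewrite /ebump; case: ifPn => t0; last by rewrite lexx ler01.
rewrite !hornerE; have u0 : 0 < t^-1 by rewrite invr_gt0.
have := expR_ge1Dx t^-1; have := expR_gt0 (- t^-1); have := expR_gt0 (t^-1).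
move=> e0 e1 e2; apply/andP; split; first by rewrite mulr_ge0// addr_ge0// ltW.
by rewrite expRN ler_pdivrMr// mul1r.
Qed.

Lemma log_scale_le0 s : 1 / 4 <= s -> log_scale s <= 0.
Proof.
move=> s0; have hp : 0 < h ^+ 2 by rewrite exprn_gt0.
by rewrite /log_scale mulNr oppr_le0 mulr_ge0// ln_ge0//; lra.
Qed.

Lemma cutoff_out s : 1 / 4 <= s -> [/\ cutoff s = 0, cutoffA s = 0 & cutoffB s = 0].
Proof.
move=> /log_scale_le0 t0; rewrite /cutoff /cutoffA /cutoffB !ebump_le0//.
by rewrite !mulr0 !mul0r addr0 mul0r.
Qed.

Lemma cutoffA_itv s : 0 <= s -> 0 <= cutoffA s * (s + h ^+ 2) <= 1.
Proof. by move=> s0; rewrite divfK ?gt_eqF ?reg_gt0// ebumpX_itv. Qed.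

(** [log_scale 0] is ln(1/(2h)), and t exp(-1/t) >= t - 1. *)
Lemma cutoff0_ge : - ln h - ln 2 - 1 <= cutoff 0.
Proof.
have t0E : log_scale 0 = - ln h - ln 2.
  rewrite /log_scale add0r (_ : 4 * h ^+ 2 = (2 * h) ^+ 2); last by ring.
  rewrite lnXn ?mulr_gt0// lnM ?posrE//; first by field.
rewrite /cutoff -t0E; set t := log_scale 0.
rewrite /ebump; case: ifPn => [t0|]; last by rewrite -leNgt mulr0; lra.
rewrite hornerC mul1r; have := expR_ge1Dx (- t^-1).
move=> /(ler_wpM2l (ltW t0)); rewrite mulrDr mulrN divff ?gt_eqF// mulr1.
by [].
Qed.

Lemma elementary_sqnorm : elementary (@sqnorm R).
Proof. by apply: elementary_add; apply: elementary_exp; [exact: elementary_fst|exact: elementary_snd]. Qed.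

Lemma elementary_reg : elementary (fun x => sqnorm x + h ^+ 2).
Proof. by apply: elementary_add; [exact: elementary_sqnorm|exact: elementary_cst]. Qed.

Lemma reg_sqnorm_gt0 x : 0 < sqnorm x + h ^+ 2.
Proof. by rewrite reg_gt0// sqnorm_ge0. Qed.

Lemma elementary_log_scale : elementary (fun x => log_scale (sqnorm x)).
Proof.
apply: elementary_mul; first exact: elementary_cst.
apply: (elementary_ln (f := fun x => 4 * (sqnorm x + h ^+ 2))).
  by move=> x; rewrite mulr_gt0// reg_sqnorm_gt0.
by apply: elementary_mul; [exact: elementary_cst|exact: elementary_reg].
Qed.

Definition cutoff_fun (x : R * R) : R := cutoff (sqnorm x).

Lemma cutoff_fun_test : test_function cutoff_fun.
Proof.
split.
  apply: elementary_smooth; apply: elementary_mul; first exact: elementary_log_scale.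
  exact: (elementary_ebump 1 elementary_log_scale).
exists [set x | sqnorm x <= 1 / 4]; split; first exact: compact_half_disc.
- by move=> x /= hx; rewrite disc_sqnorm /=; move: hx; rewrite /sqnorm; lra.
- move=> x /= /negP; rewrite -ltNge => /ltW hx.
  by rewrite /cutoff_fun; have [] := cutoff_out hx.
Qed.

Lemma cutoff_fun_partial i x :
  is_derive x (basis_vec R i) cutoff_fun (- (coord i x * cutoffA (sqnorm x))).
Proof.
have := is_derive_comp_line (is_derive_cutoff (sqnorm_ge0 x)) (is_derive_sqnorm i x).
by move=> /is_derive_eq; apply; field.
Qed.

Lemma cutoff_fun_partialE i :
  partial i cutoff_fun = fun x => - (coord i x * cutoffA (sqnorm x)).
Proof. by apply/funext => x; have [_] := cutoff_fun_partial i x. Qed.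

Lemma cutoff_fun_partial2E i j x : partial j (partial i cutoff_fun) x =
  coord i x * coord j x * cutoffB (sqnorm x) - (i == j)%:R * cutoffA (sqnorm x).
Proof.
rewrite cutoff_fun_partialE.
have d1 := is_derive_comp_line (is_derive_cutoffA (sqnorm_ge0 x)) (is_derive_sqnorm j x).
have d1' : is_derive x (basis_vec R j) (fun x => cutoffA (sqnorm x)) _ := d1.
have d2 := is_derive_coord i j x.
suff: is_derive x (basis_vec R j) (fun x => - (coord i x * cutoffA (sqnorm x)))
    (coord i x * coord j x * cutoffB (sqnorm x) - (i == j)%:R * cutoffA (sqnorm x)).
  by case.
by apply: is_derive_eq; rewrite /GRing.scale /=; field.
Qed.

Lemma cutoffA_continuous (t : R) : 0 <= t -> {for t, continuous cutoffA}.
Proof.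
move=> t0; apply: differentiable_continuous; apply/derivable1_diffP.
by have [] := is_derive_cutoffA t0.
Qed.

Lemma cutoffB_derivable (t : R) : 0 <= t -> derivable cutoffB t 1.
Proof.
move=> t0.
have eb Q : derivable (fun s => ebump Q (log_scale s)) t 1.
  have [] // := @is_derive1_comp R (ebump Q) log_scale t _ _
    (is_derive_ebump Q _) (is_derive_log_scale t0).
have p := reg_gt0 t0.
apply: derivableM; first by apply: derivableD => //; apply: derivableM.
by apply: derivableV; [rewrite expf_neq0// gt_eqF|].
Qed.

Lemma cutoffB_continuous (t : R) : 0 <= t -> {for t, continuous cutoffB}.
Proof.
move=> t0; apply: differentiable_continuous; apply/derivable1_diffP.
exact: cutoffB_derivable.
Qed.

(** |x|^2 B - A is the second radial derivative of the cutoff, that is, its cofactor matrix paired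
    with the tensor square of [hat_perp]. In s = |x|^2 it has the primitive - 2 s A - 2 cutoff,
    whose boundary value at 0 gives the result. *)
Lemma radial_hessian_integral :
  mu.-integrable (@disc R) (EFin \o (fun x => sqnorm x * cutoffB (sqnorm x) - cutoffA (sqnorm x))) /\
  \int[mu]_(x in @disc R) (sqnorm x * cutoffB (sqnorm x) - cutoffA (sqnorm x)) = 2 * pi * cutoff 0.
Proof.
pose f (t : R) := t * cutoffB t - cutoffA t.
have cf (t : R) : 0 <= t <= 1 -> {for t, continuous f}.
  move=> /andP[t0 _]; apply: cvgB; last exact: cutoffA_continuous.
  by apply: cvgM; [exact: cvg_id|exact: cutoffB_continuous].
pose F (t : R) := - 2 * t * cutoffA t - 2 * cutoff t.
have dF (t : R) : 0 <= t <= 1 -> is_derive t (1 : R) F (f t).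
  move=> /andP[t0 _]; have d1 := is_derive_cutoff t0; have d2 := is_derive_cutoffA t0.
  by apply: is_derive_eq; rewrite /GRing.scale /= /f; field.
have [M hM] : exists M : R, forall t, 0 <= t <= 1 -> `|f t| <= M.
  have : {within `[0, 1], continuous f}.
    by apply: continuous_in_subspaceT => t /set_mem; rewrite /= in_itv /=; exact: cf.
  move=> /(continuous_compact)/(_ (@segment_compact R 0 1))/compact_bounded.
  move=> [M [_ hM]]; exists (M + 1) => t t01; apply: (hM (M + 1)); first by rewrite ltrDl.
  by exists t => //; rewrite /= in_itv.
have [I E] := disc_radial hM dF cf; split=> //.
rewrite [LHS]E /F; have [|-> -> _] := @cutoff_out 1; first lra.
by ring.
Qed.

End LogCutoff.

(** * The gradient along circles *)

Section InvariantAverage.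
Context {R : realType} d (X : measurableType d)
  (m : {sigma_finite_measure set X -> \bar R}).
Local Notation L := (@lebesgue_measure R).

(** Integrate H(T_t x) over X times [0, b]: in one order invariance gives b times the integral of
    [H], in the other order the inner integrals are nonnegative. *)
Lemma invariant_average_ge0 (T : R -> X -> X) (H : X -> R) (b : R) : 0 < b ->
  measurable_fun setT (fun z : X * measurableTypeR R => T z.2 z.1) ->
  (forall t, measure_preserving m (T t)) ->
  m.-integrable setT (EFin \o H) ->
  (forall x, 0 <= \int[L]_(t in `[0%R, b]) (H (T t x))%:E)%E ->
  0 <= \int[m]_x H x.
Proof.
move=> b0 mT pT Hi avg.
have mH : measurable_fun setT H := measurable_integrable Hi.
pose I : set (measurableTypeR R) := [set` `[0%R, b]].
have mI : measurable I by exact: measurable_itv.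
have LI : L I = b%:E by rewrite /I lebesgue_measure_itv /= lte_fin b0 sube0.
have I1 : (\int[L]_t (\1_I t)%:E = b%:E)%E by rewrite integral_indic// setIT; exact: LI.
pose f (z : X * measurableTypeR R) := (\1_I z.2 * H (T z.2 z.1))%:E.
have mf : measurable_fun setT f.
  apply/measurable_EFinP; apply: measurable_realfun.measurable_funM.
    by apply: measurableT_comp; [exact: measurable_indic|exact: measurable_snd].
  exact: measurableT_comp mH mT.
have slice t : (\int[m]_x (\1_I t * H (T t x))%:E = (\1_I t)%:E * \int[m]_x (H x)%:E)%E.
  have [HTi E] := integrable_preserving (pT t) Hi.
  under eq_integral do rewrite EFinM.
  rewrite integralZl//; congr (_ * _)%E.
  by move: E; rewrite /Rintegral => E; rewrite -[LHS]fineK ?E ?fineK//; exact: integrable_fin_num.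
have Iint (c : \bar R) : (0 <= c)%E -> (\int[L]_t ((\1_I t)%:E * c) = b%:E * c)%E.
  move=> c0; rewrite ge0_integralZr//; last first.
    by apply/measurable_EFinP; exact: measurable_indic.
  by congr (_ * _)%E; exact: I1.
have fi : (m \x L)%E.-integrable setT f.
  apply/(integrable21ltyP _ _ mf).
  have -> : (\int[L]_t \int[m]_x `|f (x, t)| =
      \int[L]_t ((\1_I t)%:E * \int[m]_x `|(H x)%:E|))%E.
    apply: eq_integral => t _; rewrite /f /=.
    under eq_integral do rewrite normrM [`|\1_I _|]ger0_norm// EFinM.
    rewrite ge0_integralZl//.
    + congr (_ * _)%E.
      apply: (ge0_integral_preserving (f := fun x => `|(H x)%:E|%E) (pT t)) => //.
      by apply/measurable_EFinP; exact: measurableT_comp.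
    + apply/measurable_EFinP; apply: measurableT_comp => //.
      by apply: measurableT_comp mH _; have [] := pT t.
  rewrite Iint ?integral_ge0//.
  by apply: lte_mul_pinfty; rewrite ?lee_fin ?ltW//; case/integrableP: Hi.
have := Fubini fi.
have : (0 <= \int[m]_x \int[L]_t f (x, t))%E.
  apply: integral_ge0 => x _; apply: le_trans (avg x) _.
  rewrite integral_mkcond le_eqVlt; apply/orP; left; apply/eqP.
  apply: eq_integral => t _; rewrite /f patchE indicE /=.
  by rewrite -/I; case: (t \in I); rewrite ?mul1r ?mul0r.
move=> h0 E; rewrite {}E in h0; move: h0.
under eq_integral do rewrite slice.
rewrite (_ : \int[m]_x (H x)%:E = (\int[m]_x H x)%:E)%E; last first.
  by rewrite /Rintegral fineK//; exact: integrable_fin_num.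
under eq_integral do rewrite muleC.
rewrite integralZl//; last first.
  apply/integrableP; split; first by apply/measurable_EFinP; exact: measurable_indic.
  under eq_integral do rewrite /= ger0_norm//.
  by apply: (@le_lt_trans _ _ b%:E); [rewrite le_eqVlt; apply/orP; left; apply/eqP; exact: I1|exact: ltry].
rewrite [X in (_ * X)%E](_ : _ = b%:E); last exact: I1.
by rewrite -EFinM lee_fin pmulr_lge0.
Qed.

End InvariantAverage.

(** * The area swept by a smooth gradient along circles *)

Section AreaInequality.
Context {R : realType}.
Local Notation L := (@lebesgue_measure R).
Local Notation plane := (measurableTypeR R * measurableTypeR R)%type.
Local Notation mu := (L \x L)%E.

Lemma is_derive_area_field (a b p q : R * R -> R) (x v : R * R) (a' b' p' q' : R) :
  is_derive x v a a' -> is_derive x v b b' -> is_derive x v p p' -> is_derive x v q q' ->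
  is_derive x v (fun y => b y * b y * p y - a y * b y * q y)
    (2 * b x * b' * p x + b x * b x * p' - (a' * b x + a x * b') * q x - a x * b x * q').
Proof.
move=> da db dp dq; apply: is_derive_eq; rewrite /GRing.scale /=; ring.
Qed.

Variables (A : R * R -> R) (p : 'I_2 -> R * R -> R) (pp : 'I_2 -> 'I_2 -> R * R -> R).
Hypothesis cA : continuous A.
Hypothesis A_ge0 : forall x, 0 <= A x.
Hypothesis A_rot : forall c s x, c ^+ 2 + s ^+ 2 = 1 -> A (rot c s x) = A x.
Hypothesis A_out : forall x, ~ sqnorm x <= 1 / 4 -> A x = 0.
Hypothesis pE : forall i x, p i x = - (coord i x * A x).
Hypothesis p_derive : forall i j x, is_derive x (basis_vec R j) (p i) (pp i j x).
Hypothesis cpp : forall i j, continuous (pp i j).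
Variables (f : 'I_2 -> R * R -> R) (df : 'I_2 -> 'I_2 -> R * R -> R).
Hypothesis cf : forall i, continuous (f i).
Hypothesis cdf : forall i j, continuous (df i j).
Hypothesis f_derive : forall i j x, is_derive x (basis_vec R j) (f i) (df i j x).

(** The angular derivative of [f i]. *)
Definition dtheta i (x : R * R) : R := - x.2 * df i 0 x + x.1 * df i 1 x.

Hypothesis f_rot : forall i x (t : R), is_derive t (1 : R)
  (fun s => f i (rot (cos s) (sin s) x)) (dtheta i (rot (cos t) (sin t) x)).
(** Symmetry is asked for only on the support of [A]: a mollified weak gradient, extended by zero
    outside the disc, need not be curl free near the unit circle. *)
Hypothesis df_sym : forall x, sqnorm x <= 1 / 4 -> df 0 1 x = df 1 0 x.

(** The tensor square of the vector (a, b) contracted with the cofactor matrix of [pp]. *)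
Definition cof_quadratic (a b : R) (x : R * R) : R :=
  a ^+ 2 * pp 1 1 x + b ^+ 2 * pp 0 0 x - a * b * (pp 1 0 x + pp 0 1 x).

Lemma dtheta_continuous i : continuous (dtheta i).
Proof.
move=> x; apply: cvgD; apply: cvgM; do ?[exact: cdf].
  by apply: cvgN; exact: cvg_snd.
exact: cvg_fst.
Qed.

Lemma half_disc_support (g : R * R -> R) : continuous g ->
  (forall x, ~ sqnorm x <= 1 / 4 -> g x = 0) -> mu.-integrable setT (EFin \o g).
Proof. by move=> cg g0; apply: (continuous_support_integrable cg (@compact_half_disc R)). Qed.

Lemma p_out i x : ~ sqnorm x <= 1 / 4 -> p i x = 0.
Proof. by move=> hx; rewrite pE A_out// mulr0 oppr0. Qed.

Lemma closed_half_disc : closed [set x : R * R | sqnorm x <= 1 / 4].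
Proof. by apply: compact_closed; [exact: norm_hausdorff|exact: compact_half_disc]. Qed.

Lemma pp_out i j x : ~ sqnorm x <= 1 / 4 -> pp i j x = 0.
Proof.
exact: (derive_support closed_half_disc (p_derive i j) (@p_out i)).
Qed.

Lemma p_continuous i : continuous (p i).
Proof.
move=> x; rewrite (_ : p i = fun x => - (coord i x * A x)); last exact/funext.
apply: cvgN; apply: cvgM; last exact: cA.
by rewrite /coord; case: (i == 0); [exact: cvg_fst|exact: cvg_snd].
Qed.

(** The divergence of (V0, V1) is the quadratic form plus terms linear in [p]. As p = - A x and [df]
    is symmetric, these terms add up to minus [A] times the area density along circles. *)
Lemma cof_quadratic_by_parts :
  \int[mu]_x cof_quadratic (f 0 x) (f 1 x) x =
  \int[mu]_x (A x * (f 1 x * dtheta 0 x - f 0 x * dtheta 1 x)).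
Proof.
have cp := p_continuous.
pose V0 x := f 1 x * f 1 x * p 0 x - f 0 x * f 1 x * p 1 x.
pose V1 x := f 0 x * f 0 x * p 1 x - f 1 x * f 0 x * p 0 x.
pose V0' x := 2 * f 1 x * df 1 0 x * p 0 x + f 1 x * f 1 x * pp 0 0 x
  - (df 0 0 x * f 1 x + f 0 x * df 1 0 x) * p 1 x - f 0 x * f 1 x * pp 1 0 x.
pose V1' x := 2 * f 0 x * df 0 1 x * p 1 x + f 0 x * f 0 x * pp 1 1 x
  - (df 1 1 x * f 0 x + f 1 x * df 0 1 x) * p 0 x - f 1 x * f 0 x * pp 0 1 x.
have dV0 x : is_derive x (basis_vec R 0) V0 (V0' x).
  exact: (is_derive_area_field (f_derive 0 0 x) (f_derive 1 0 x)
    (p_derive 0 0 x) (p_derive 1 0 x)).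
have dV1 x : is_derive x (basis_vec R 1) V1 (V1' x).
  exact: (is_derive_area_field (f_derive 1 1 x) (f_derive 0 1 x)
    (p_derive 1 1 x) (p_derive 0 1 x)).
have c3 (a b c : R * R -> R) : continuous a -> continuous b -> continuous c ->
    continuous (fun x => a x * b x * c x).
  by move=> ca cb cc x; apply: cvgM; [apply: cvgM; [exact: ca|exact: cb]|exact: cc].
have c4 (a b c d : R * R -> R) : continuous a -> continuous b -> continuous c -> continuous d ->
    continuous (fun x => a x * b x + c x * d x).
  by move=> ca cb cc cd x; apply: cvgD; apply: cvgM; [exact: ca|exact: cb|exact: cc|exact: cd].
have c5 (a b c d : R * R -> R) : continuous a -> continuous b -> continuous c -> continuous d ->
    continuous (fun x => a x + b x - c x - d x).
  move=> ca cb cc cd x; apply: cvgB; last exact: cd.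
  by apply: cvgB; [apply: cvgD; [exact: ca|exact: cb]|exact: cc].
have c2 (a : R * R -> R) : continuous a -> continuous (fun x => 2 * a x).
  by move=> ca x; apply: cvgM; [exact: cvg_cst|exact: ca].
have c6 (a b : R * R -> R) : continuous a -> continuous b -> continuous (fun x => a x * b x).
  by move=> ca cb x; apply: cvgM; [exact: ca|exact: cb].
have cV0 : continuous V0'.
  by apply: c5; [apply: c3 => //; exact: c2|exact: c3|apply: c6 => //; exact: c4|exact: c3].
have cV1 : continuous V1'.
  by apply: c5; [apply: c3 => //; exact: c2|exact: c3|apply: c6 => //; exact: c4|exact: c3].
have cK := @compact_half_disc R.
have V00 x : ~ sqnorm x <= 1 / 4 -> V0 x = 0.
  by move=> nx; rewrite /V0 !p_out// !mulr0 subr0.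
have V10 x : ~ sqnorm x <= 1 / 4 -> V1 x = 0.
  by move=> nx; rewrite /V1 !p_out// !mulr0 subr0.
have I0 := Rintegral_partial_eq0 dV0 cV0 cK V00.
have I1 := Rintegral_partial_eq0 dV1 cV1 cK V10.
have i0 := half_disc_support cV0 (derive_support closed_half_disc dV0 V00).
have i1 := half_disc_support cV1 (derive_support closed_half_disc dV1 V10).
pose G x := A x * (f 1 x * dtheta 0 x - f 0 x * dtheta 1 x).
have GE x : cof_quadratic (f 0 x) (f 1 x) x = G x * 1 + (V0' x * 1 + V1' x * 1) * 1.
  rewrite !mulr1 /G /V0' /V1' /cof_quadratic /dtheta !pE.
  have [hx|hx] := pselect (sqnorm x <= 1 / 4).
    by rewrite -(df_sym hx) /coord /=; ring.
  by rewrite A_out// !mul0r !mulr0 !pp_out//; ring.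
have cG : continuous G.
  apply: c6 => //; move=> x; apply: cvgB; apply: cvgM; do ?[exact: cf].
    exact: dtheta_continuous.
  exact: dtheta_continuous.
have iG : mu.-integrable setT (EFin \o G).
  by apply: half_disc_support cG _ => x /A_out a0; rewrite /G a0 mul0r.
transitivity (\int[mu]_x (G x * 1 + (V0' x * 1 + V1' x * 1) * 1)).
  by apply: eq_Rintegral => x _; rewrite GE.
have i01 : mu.-integrable setT (EFin \o (fun x => V0' x * 1 + V1' x * 1)).
  rewrite (_ : (fun x => _) = fun x => V0' x + V1' x); first exact: integrableD_real.
  by apply/funext => x; rewrite !mulr1.
have E1 := Rintegral_comb2 1 1 measurableT iG i01.
have E2 := Rintegral_comb2 1 1 measurableT i0 i1.
rewrite {}E1 {}E2 I0 I1; by ring.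
Qed.

Lemma rot_curve_continuous (g : R * R -> R) x : continuous g ->
  continuous (fun t : R => g (rot (cos t) (sin t) x)).
Proof.
move=> cg t; apply: (continuous_comp (f := fun t : R => rot (cos t) (sin t) x)); last exact: cg.
have cc : {for t, continuous (fun t : R => cos t * x.1 - sin t * x.2)}.
  apply: cvgB; apply: cvgM; [exact: continuous_cos|exact: cvg_cst|exact: continuous_sin|exact: cvg_cst].
have cs : {for t, continuous (fun t : R => sin t * x.1 + cos t * x.2)}.
  apply: cvgD; apply: cvgM; [exact: continuous_sin|exact: cvg_cst|exact: continuous_cos|exact: cvg_cst].
exact: (cvg_pair cc cs).
Qed.

Lemma measurable_rot_curve : measurable_fun setT
  (fun z : plane * measurableTypeR R => rot (cos z.2) (sin z.2) z.1 : plane).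
Proof.
have mc : measurable_fun setT (fun z : plane * measurableTypeR R => cos z.2 : measurableTypeR R).
  apply: (measurableT_comp (f := @cos R : measurableTypeR R -> measurableTypeR R)); last exact: measurable_snd.
  by apply: continuous_measurable_fun; exact: continuous_cos.
have ms : measurable_fun setT (fun z : plane * measurableTypeR R => sin z.2 : measurableTypeR R).
  apply: (measurableT_comp (f := @sin R : measurableTypeR R -> measurableTypeR R)); last exact: measurable_snd.
  by apply: continuous_measurable_fun; exact: continuous_sin.
have m1 : measurable_fun setT (fun z : plane * measurableTypeR R => z.1.1).
  exact: measurableT_comp measurable_fst measurable_fst.
have m2 : measurable_fun setT (fun z : plane * measurableTypeR R => z.1.2).
  exact: measurableT_comp measurable_snd measurable_fst.
apply: measurable_fun_pair.
  by apply: measurable_realfun.measurable_funB; exact: measurable_realfun.measurable_funM.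
by apply: measurable_realfun.measurable_funD; exact: measurable_realfun.measurable_funM.
Qed.

(* Averaged over rotations, the difference of the right-hand side and of the area
   integrand is nonnegative by [circle_area_le]. *)
Lemma area_inequality : \int[mu]_x cof_quadratic (f 0 x) (f 1 x) x <=
  \int[mu]_x (A x * (dtheta 0 x ^+ 2 + dtheta 1 x ^+ 2)).
Proof.
rewrite cof_quadratic_by_parts.
pose G x := A x * (f 1 x * dtheta 0 x - f 0 x * dtheta 1 x).
pose S x := A x * (dtheta 0 x ^+ 2 + dtheta 1 x ^+ 2).
have ct := dtheta_continuous.
have cG : continuous G.
  by move=> x; apply: cvgM; [exact: cA|apply: cvgB; apply: cvgM; do ?[exact: cf]; exact: ct].
have cS : continuous S.
  by move=> x; apply: cvgM; [exact: cA|apply: cvgD; apply: cvgM; exact: ct].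
have iG : mu.-integrable setT (EFin \o G).
  by apply: half_disc_support cG _ => x /A_out a0; rewrite /G a0 mul0r.
have iS : mu.-integrable setT (EFin \o S).
  by apply: half_disc_support cS _ => x /A_out a0; rewrite /S a0 mul0r.
have E := Rintegral_comb2 1 (-1) measurableT iS iG.
suff : 0 <= \int[mu]_x (S x * 1 + G x * -1) by rewrite E mulr1 mulrN1 subr_ge0.
have Hi : mu.-integrable setT (EFin \o (fun x => S x * 1 + G x * -1)).
  rewrite (_ : (fun x => _) = fun x => S x - G x); first exact: integrableB_real.
  by apply/funext => x; rewrite mulr1 mulrN1.
have pi2 : 0 < 2 * pi :> R by rewrite mulr_gt0 ?pi_gt0.
have pres (t : R) : measure_preserving (lebesgue2 : {measure set plane -> \bar R}) (rot (cos t) (sin t)).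
  by apply: rot_preserving; rewrite cos2Dsin2.
apply: (invariant_average_ge0 (m := lebesgue2) pi2 measurable_rot_curve pres Hi) => x.
have cr (w : R * R -> R) (cw : continuous w) := @rot_curve_continuous w x cw.
pose g t := f 0 (rot (cos t) (sin t) x) * dtheta 1 (rot (cos t) (sin t) x) -
  f 1 (rot (cos t) (sin t) x) * dtheta 0 (rot (cos t) (sin t) x) +
  dtheta 0 (rot (cos t) (sin t) x) ^+ 2 + dtheta 1 (rot (cos t) (sin t) x) ^+ 2.
have per (w : R * R -> R) (t : R) :
    w (rot (cos (t + 2 * pi)) (sin (t + 2 * pi)) x) = w (rot (cos t) (sin t) x).
  by rewrite mulr_natl cosD2pi sinD2pi.
have := circle_area_le (f_rot 0 x) (cr _ (ct 0)) (f_rot 1 x) (cr _ (ct 1))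
  (per _) (per _) (per _) (per _).
have cg : continuous g.
  move=> t; apply: cvgD; last by apply: cvgM; exact: cr (ct 1) t.
  apply: cvgD; last by apply: cvgM; exact: cr (ct 0) t.
  by apply: cvgB; apply: cvgM; [exact: cr (@cf 0) t|exact: cr (ct 1) t|exact: cr (@cf 1) t|exact: cr (ct 0) t].
have gi := @continuous_integrable_itv R g 0 (2 * pi) cg.
rewrite -/(g _) => h0.
have -> : (\int[L]_(t in `[0%R, (2 * pi)%R]) (S (rot (cos t) (sin t) x) * 1 +
    G (rot (cos t) (sin t) x) * -1)%:E = \int[L]_(t in `[0%R, (2 * pi)%R]) ((A x)%:E * (g t)%:E))%E.
  apply: eq_integral => t _; rewrite /S /G A_rot ?cos2Dsin2// -EFinM; congr (_%:E).
  rewrite /g; ring.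
rewrite integralZl//; apply: mule_ge0; first by rewrite lee_fin.
move: h0; rewrite /Rintegral => h0.
by rewrite -[leRHS]fineK ?lee_fin//; exact: integrable_fin_num.
Qed.

End AreaInequality.

(** * Quadratic forms with bounded coefficients under L^2 convergence *)

Section QuadraticLimit.
Context {R : realType} d (X : measurableType d) (m : {measure set X -> \bar R}).
Variables (P : R) (p11 p00 p01 : X -> R).
Hypothesis P_ge0 : 0 <= P.
Hypothesis mp11 : measurable_fun setT p11.
Hypothesis mp00 : measurable_fun setT p00.
Hypothesis mp01 : measurable_fun setT p01.
Hypothesis p11P : forall x, `|p11 x| <= P.
Hypothesis p00P : forall x, `|p00 x| <= P.
Hypothesis p01P : forall x, `|p01 x| <= 2 * P.

Definition qform (a b : X -> R) x : R :=
  a x ^+ 2 * p11 x + b x ^+ 2 * p00 x - a x * b x * p01 x.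

Lemma young (p M e u v : R) : `|p| <= M -> 0 < e ->
  2 * (p * (u * v)) <= M * (e * u ^+ 2 + e^-1 * v ^+ 2).
Proof.
move=> pM e0; have M0 : 0 <= M by apply: le_trans pM.
have h : 2 * `|u * v| <= e * u ^+ 2 + e^-1 * v ^+ 2.
  rewrite -subr_ge0 normrM -(real_normK (num_real u)) -(real_normK (num_real v)).
  have -> : e * `|u| ^+ 2 + e^-1 * `|v| ^+ 2 - 2 * (`|u| * `|v|) = e * (`|u| - e^-1 * `|v|) ^+ 2.
    by field; rewrite gt_eqF.
  by rewrite mulr_ge0 ?sqr_ge0 ?ltW.
apply: (@le_trans _ _ (M * (2 * `|u * v|))); last exact: ler_wpM2l.
rewrite [leRHS]mulrCA; apply: (ler_wpM2l (ler0n _ 2)).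
by apply: le_trans (ler_norm _) _; rewrite normrM; apply: ler_wpM2r.
Qed.


(** With a' = a - r and b' = b - s, the right side minus the left is a nonnegative combination of
    defects in Young's inequality: weight [e] for products of a, b with r, s, and weight 1 for
    products among r, s. *)
Lemma qform_close (a b a' b' : X -> R) (e : R) x : 0 < e ->
  qform a b x - qform a' b' x <=
  2 * P * (e * (a x ^+ 2 + b x ^+ 2) +
    (e^-1 + 1) * ((a' x - a x) ^+ 2 + (b' x - b x) ^+ 2)).
Proof.
move=> e0; rewrite /qform; set u := a x; set v := b x.
have [r ->] : exists r, a' x = u - r by exists (u - a' x); ring.
have [s ->] : exists s, b' x = v - s by exists (v - b' x); ring.
have pN (p M : R) : `|p| <= M -> `|- p| <= M by rewrite normrN.
have y1 := young u r (p11P x) e0.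
have y2 := young v s (p00P x) e0.
have y3 := young u s (pN _ _ (p01P x)) e0.
have y4 := young v r (pN _ _ (p01P x)) e0.
have y5 := young r r (pN _ _ (p11P x)) ltr01.
have y6 := young s s (pN _ _ (p00P x)) ltr01.
have y7 := young r s (p01P x) ltr01.
rewrite !invr1 in y5 y6 y7.
set i := e^-1 in y1 y2 y3 y4 *.
rewrite -subr_ge0.
rewrite (_ : _ - _ = (P * (e * u ^+ 2 + i * r ^+ 2) - 2 * (p11 x * (u * r))) +
  (P * (e * v ^+ 2 + i * s ^+ 2) - 2 * (p00 x * (v * s))) +
  2^-1 * (2 * P * (e * u ^+ 2 + i * s ^+ 2) - 2 * (- p01 x * (u * s))) +
  2^-1 * (2 * P * (e * v ^+ 2 + i * r ^+ 2) - 2 * (- p01 x * (v * r))) +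
  2^-1 * (P * (1 * r ^+ 2 + 1 * r ^+ 2) - 2 * (- p11 x * (r * r))) +
  2^-1 * (P * (1 * s ^+ 2 + 1 * s ^+ 2) - 2 * (- p00 x * (s * s))) +
  2^-1 * (2 * P * (1 * r ^+ 2 + 1 * s ^+ 2) - 2 * (p01 x * (r * s)))); last first.
  by field.
have i2 : 0 <= 2^-1 :> R by rewrite invr_ge0.
by do 6! [apply: addr_ge0; last by rewrite ?pmulr_rge0 ?subr_ge0 ?invr_gt0]; rewrite subr_ge0.
Qed.

Lemma qform_integrable (a b : X -> R) : measurable_fun setT a -> measurable_fun setT b ->
  m.-integrable setT (EFin \o (fun x => a x ^+ 2)) ->
  m.-integrable setT (EFin \o (fun x => b x ^+ 2)) ->
  m.-integrable setT (EFin \o qform a b).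
Proof.
move=> ma mb ia ib.
have i := integrableZ_real (2 * P) measurableT (integrableD_real measurableT ia ib).
apply: (le_integrable_real _ _ _ i) => //.
  apply: measurable_realfun.measurable_funB; first apply: measurable_realfun.measurable_funD;
    apply: measurable_realfun.measurable_funM => //; try exact: measurable_funX.
  exact: measurable_realfun.measurable_funM.
move=> x _; rewrite ler_norml /qform.
have y1 := young (a x) (b x) (p01P x) ltr01.
have y2 : 2 * (- p01 x * (a x * b x)) <= 2 * P * (1 * a x ^+ 2 + 1^-1 * b x ^+ 2).
  by apply: young => //; rewrite normrN.
rewrite !invr1 in y1 y2.
have a2 : 0 <= a x ^+ 2 by rewrite sqr_ge0.
have b2 : 0 <= b x ^+ 2 by rewrite sqr_ge0.
have := p11P x; have := p00P x; rewrite !ler_norml => /andP[h1 h2] /andP[h3 h4].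
have k1 := ler_wpM2l a2 h3; have k2 := ler_wpM2l a2 h4.
have k3 := ler_wpM2l b2 h1; have k4 := ler_wpM2l b2 h2.
by apply/andP; split; lra.
Qed.

Lemma qform_limit (a b : X -> R) (a_ b_ : nat -> X -> R) (S : R) (N0 : nat) :
  measurable_fun setT a -> measurable_fun setT b ->
  m.-integrable setT (EFin \o (fun x => a x ^+ 2)) ->
  m.-integrable setT (EFin \o (fun x => b x ^+ 2)) ->
  (forall n, measurable_fun setT (a_ n)) -> (forall n, measurable_fun setT (b_ n)) ->
  (forall e : R, 0 < e -> exists N, forall n, (N <= n)%N ->
     (\int[m]_x ((a_ n x - a x) ^+ 2)%:E <= e%:E)%E) ->
  (forall e : R, 0 < e -> exists N, forall n, (N <= n)%N ->
     (\int[m]_x ((b_ n x - b x) ^+ 2)%:E <= e%:E)%E) ->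
  (forall n, (N0 <= n)%N -> m.-integrable setT (EFin \o qform (a_ n) (b_ n)) /\
     \int[m]_x qform (a_ n) (b_ n) x <= S) ->
  \int[m]_x qform a b x <= S.
Proof.
move=> ma mb ia ib ma_ mb_ ca cb hS.
apply/ler_addgt0Pr => /= e e0.
have iab := integrableD_real measurableT ia ib.
have [I [I0 IE]] : exists I : R, 0 <= I /\ \int[m]_x (a x ^+ 2 + b x ^+ 2) = I.
  by eexists; split; last reflexivity; apply: Rintegral_ge0 => x _; rewrite addr_ge0 ?sqr_ge0.
have P1 : 0 < P + 1 by rewrite ltr_wpDl.
have I1 : 0 < I + 1 by rewrite ltr_wpDl.
(* [eta] is fixed first, against the norm of the limit; only then is [r] chosen, since the distance
   to the limit carries the large factor eta^-1 + 1. *)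
have [eta [eta0 e1]] : exists eta : R, 0 < eta /\ 2 * P * (eta * I) <= e / 2.
  exists (e / (4 * (P + 1) * (I + 1))); split; first by rewrite divr_gt0// !mulr_gt0.
  rewrite (_ : 2 * P * _ = e / 2 * ((P / (P + 1)) * (I / (I + 1)))); last first.
    by field; rewrite !gt_eqF.
  rewrite -[leRHS]mulr1; apply: ler_wpM2l; first by rewrite divr_ge0// ltW.
  have q0 := ltW P1; have q1 := ltW I1.
  rewrite mulr_ile1// ?divr_ge0// ?ler_pdivrMr//; lra.
have ei0 : 0 < eta^-1 + 1 by rewrite addr_gt0 ?invr_gt0.
have [r [r0 e2]] : exists r : R, 0 < r /\ 2 * P * ((eta^-1 + 1) * (r + r)) <= e / 2.
  move: (eta^-1 + 1) ei0 => i i0.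
  exists (e / (8 * (P + 1) * i)); split; first by rewrite divr_gt0// !mulr_gt0.
  rewrite (_ : 2 * P * _ = e / 2 * (P / (P + 1))); last by field; rewrite !gt_eqF.
  rewrite -[leRHS]mulr1; apply: ler_wpM2l; first by rewrite divr_ge0// ltW.
  by rewrite ler_pdivrMr//; lra.
have [N1 hN1] := ca _ r0; have [N2 hN2] := cb _ r0.
pose n := maxn N0 (maxn N1 N2).
have [iq hq] := hS n (leq_maxl _ _).
have h1 := hN1 n (leq_trans (leq_maxl _ _) (leq_maxr _ _)).
have h2 := hN2 n (leq_trans (leq_maxr _ _) (leq_maxr _ _)).
have sq (u v : X -> R) : measurable_fun setT u -> measurable_fun setT v ->
    (\int[m]_x ((u x - v x) ^+ 2)%:E <= r%:E)%E ->
    m.-integrable setT (EFin \o (fun x => (u x - v x) ^+ 2)) /\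
    \int[m]_x ((u x - v x) ^+ 2) <= r.
  move=> mu_ mv_ hr.
  have i : m.-integrable setT (EFin \o (fun x => (u x - v x) ^+ 2)).
    apply/integrableP; split.
      by apply/measurable_EFinP; apply: measurable_funX; exact: measurable_realfun.measurable_funB.
    under eq_integral do rewrite /= ger0_norm ?sqr_ge0//.
    by apply: le_lt_trans hr _; exact: ltry.
  split=> //; move: hr; rewrite -lee_fin /Rintegral fineK//.
  exact: integrable_fin_num.
have [ida da] := sq _ _ (ma_ n) ma h1.
have [idb db] := sq _ _ (mb_ n) mb h2.
have id := integrableD_real measurableT ida idb.
have iqab := qform_integrable ma mb ia ib.
have ii := integrableD_real measurableT (integrableZ_real eta measurableT iab)
  (integrableZ_real (eta^-1 + 1) measurableT id).
have := @le_Rintegral _ _ _ m _ _ _ measurableT (integrableB_real measurableT iqab iq)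
  (integrableZ_real (2 * P) measurableT ii) (fun x _ => qform_close a b (a_ n) (b_ n) x eta0).
rewrite RintegralB// RintegralZl// RintegralD//; last 2 first.
- exact: integrableZ_real.
- exact: integrableZ_real.
rewrite !RintegralZl// IE RintegralD// => hh.
have e3 : 2 * P * ((eta^-1 + 1) * (\int[m]_x (a_ n x - a x) ^+ 2 + \int[m]_x (b_ n x - b x) ^+ 2))
   <= 2 * P * ((eta^-1 + 1) * (r + r)).
  apply: ler_wpM2l; first by rewrite mulr_ge0.
  by apply: ler_wpM2l; [exact: ltW|exact: lerD].
rewrite mulrDr in hh; lra.
Qed.

End QuadraticLimit.

(** * Convolution of weak derivatives *)

Section WeakArea.
Context {R : realType}.
Local Notation L := (@lebesgue_measure R).
Local Notation plane := (measurableTypeR R * measurableTypeR R)%type.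
Local Notation mu := (L \x L)%E.
Local Notation smu := (lebesgue2 : {sigma_finite_measure set plane -> \bar R}).
Implicit Types (f g k : R * R -> R) (i j : 'I_2) (x y : R * R) (e : R).

(** Convolution at [x] tests a function against k(x - .), which has to be smooth to be admissible in
    the weak derivative. *)
Lemma elementary_reflect k x : elementary k ->
  elementary (fun y => k (x.1 - y.1, x.2 - y.2)).
Proof.
elim=> {k}.
- by move=> c; exact: elementary_cst.
- by apply: elementary_sub; [exact: elementary_cst|exact: elementary_fst].
- by apply: elementary_sub; [exact: elementary_cst|exact: elementary_snd].
- by move=> f g _ ef _ eg; exact: elementary_add.
- by move=> f g _ ef _ eg; exact: elementary_mul.
- by move=> f f0 _ ef; apply: elementary_inv => // y; exact: f0.
- by move=> f f0 _ ef; apply: elementary_sqrt => // y; exact: f0.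
- by move=> f f0 _ ef; apply: elementary_ln => // y; exact: f0.
- by move=> Q f _ ef; exact: elementary_ebump.
Qed.

Lemma is_derive_reflect k i x y : elementary k ->
  is_derive y (basis_vec R i) (fun y => k (x.1 - y.1, x.2 - y.2))
    (- partial i k (x.1 - y.1, x.2 - y.2)).
Proof.
move=> ek; apply/is_derive_line; set b := basis_vec R i.
have d1 : is_derive (0 : R) (1 : R) (fun h : R => x.1 - (h * b.1 + y.1)) (- b.1).
  by apply: is_derive_eq; rewrite /GRing.scale /=; ring.
have d2 : is_derive (0 : R) (1 : R) (fun h : R => x.2 - (h * b.2 + y.2)) (- b.2).
  by apply: is_derive_eq; rewrite /GRing.scale /=; ring.
have := is_derive_curve ek d1 d2.
rewrite !mul0r !add0r; move=> /is_derive_eq; apply.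
by rewrite /b; have [->|->] := ord2_cases i; move: (partial 0 k _) (partial 1 k _) => A B;
  rewrite /basis_vec /=; ring.
Qed.

Definition supported e k := forall x, ~ cbox (- e) e (- e) e x -> k x = 0.

Lemma supported_partial e k i : elementary k -> supported e k -> supported e (partial i k).
Proof.
move=> ek ke; apply: (derive_support (f := k) (i := i)) => //.
  by apply: compact_closed; [exact: norm_hausdorff|exact: compact_cbox].
by move=> x; apply: DeriveDef => //; exact: elementary_derivable.
Qed.

(** The support lies in the disc because |y|^2 <= 2 |x|^2 + 2 |y - x|^2 <= 1/2 + 1/4. *)
Lemma reflect_test k e x : elementary k -> supported e k -> e <= 1 / 4 ->
  sqnorm x <= 1 / 4 -> test_function (fun y => k (x.1 - y.1, x.2 - y.2)).
Proof.
move=> ek ke e4 x4; split; first exact/elementary_smooth/elementary_reflect.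
exists (cbox (x.1 - e) (x.1 + e) (x.2 - e) (x.2 + e)); split.
- exact: compact_cbox.
- move=> y [] /=; rewrite !in_itv /= disc_sqnorm => /andP[h1 h2] /andP[h3 h4] /=.
  move: x4; rewrite /sqnorm; move: x.1 x.2 y.1 y.2 h1 h2 h3 h4 => a b c d h1 h2 h3 h4 ab.
  have : (c - a) ^+ 2 <= (1 / 4) ^+ 2.
    by rewrite -ler_sqrt ?sqr_ge0// !sqrtr_sqr ler_norml [`|1 / 4|]ger0_norm; lra.
  have : (d - b) ^+ 2 <= (1 / 4) ^+ 2.
    by rewrite -ler_sqrt ?sqr_ge0// !sqrtr_sqr ler_norml [`|1 / 4|]ger0_norm; lra.
  have := sqr_ge0 (2 * a - c); have := sqr_ge0 (2 * b - d); nra.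
- move=> y ny; apply: ke => -[] /=; rewrite !in_itv /= => /andP[h1 h2] /andP[h3 h4].
  by apply: ny; split; rewrite /= in_itv /=; lra.
Qed.

Lemma conv_disc f k x :
  conv (f \_ (@disc R)) k x = \int[mu]_(y in @disc R) (f y * k (x.1 - y.1, x.2 - y.2)).
Proof.
rewrite /conv [RHS]Rintegral_mkcond; congr (Rintegral _ _ _); apply/funext => y.
by rewrite !patchE; case: ifPn => // _; rewrite mul0r.
Qed.

(** The definition of the weak derivative is applied to the test function k(x - .), whose derivative
    has the opposite sign; the two signs cancel. *)
Lemma conv_weak_partial f g i k e x : is_weak_partial i f g -> elementary k ->
  supported e k -> e <= 1 / 4 -> sqnorm x <= 1 / 4 ->
  conv (f \_ (@disc R)) (partial i k) x = conv (g \_ (@disc R)) k x.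
Proof.
move=> [l1 _ fg] ek ke e4 x4; rewrite !conv_disc.
have tt := reflect_test ek ke e4 x4.
have pE : partial i (fun y => k (x.1 - y.1, x.2 - y.2)) =
    fun y => - partial i k (x.1 - y.1, x.2 - y.2).
  by apply/funext => y; have [_] := is_derive_reflect i x y ek.
have I : mu.-integrable (@disc R) (EFin \o (fun y => f y *
    partial i (fun y => k (x.1 - y.1, x.2 - y.2)) y)).
  apply: (@integrableS _ _ _ _ setT) => //; first exact: measurable_disc.
  exact: locally_L1_test (test_function_partial i tt).
have h := fg _ tt; rewrite plane_measureE in h.
apply/oppr_inj; rewrite -{}h.
have h := Rintegral_comb2 (-1) 0 (@measurable_disc R) I I.
rewrite mulr0 addr0 mulrN1 in h; apply/oppr_inj; rewrite opprK -{}h.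
congr (Rintegral _ _ _); apply/funext => y; rewrite pE; ring.
Qed.

Lemma partial_tensor (u v : R -> R) : (forall t : R, derivable u t 1) ->
    partial 0 (fun x => u x.1 * v x.2) = (fun x => derive1 u x.1 * v x.2) /\
    partial 1 (fun x => v x.1 * u x.2) = (fun x => v x.1 * derive1 u x.2).
Proof.
move=> du; have dU (t : R) : is_derive t (1 : R) u (derive1 u t).
  by rewrite derive1E; exact: DeriveDef.
have shift_ (t : R) : is_derive (0 : R) (1 : R) (fun h : R => u (h + t)) (derive1 u t).
  have d1 : is_derive (0 : R) (1 : R) (fun h : R => h + t) 1.
    by apply: is_derive_eq; rewrite addr0.
  have dt : is_derive (0 + t) (1 : R) u (derive1 u t) by rewrite add0r.
  have d2 := @is_derive1_comp R u (fun h : R => h + t) 0 _ _ dt d1.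
  by rewrite mulr1 in d2.
split; apply/funext => x.
  suff: is_derive x (basis_vec R 0) (fun x => u x.1 * v x.2) (derive1 u x.1 * v x.2) by case.
  apply/is_derive_line.
  rewrite (_ : (fun h : R => _) = fun h => u (h + x.1) * v x.2); last first.
    by apply/funext => h /=; congr (u _ * v _); rewrite /GRing.scale /= ?mulr1 ?mulr0 ?add0r.
  have d := shift_ x.1; apply: is_derive_eq; rewrite /GRing.scale /=; ring.
suff: is_derive x (basis_vec R 1) (fun x => v x.1 * u x.2) (v x.1 * derive1 u x.2) by case.
apply/is_derive_line.
rewrite (_ : (fun h : R => _) = fun h => v x.1 * u (h + x.2)); last first.
  by apply/funext => h /=; congr (v _ * u _); rewrite /GRing.scale /= ?mulr1 ?mulr0 ?add0r.
have d := shift_ x.2; apply: is_derive_eq; rewrite /GRing.scale /=; ring.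
Qed.

Lemma mixed_tensor (u v : R -> R) :
  (forall t : R, derivable u t 1) -> (forall t : R, derivable v t 1) ->
  partial 1 (partial 0 (fun x => u x.1 * v x.2)) =
  partial 0 (partial 1 (fun x => u x.1 * v x.2)).
Proof.
move=> du dv; rewrite (partial_tensor v du).1 (partial_tensor u dv).2.
by rewrite (partial_tensor (derive1 u) dv).2 (partial_tensor (derive1 v) du).1.
Qed.

(** The mollifier is a product of functions of one variable, so its mixed partials can be computed
    and compared without Schwarz's theorem. *)
Lemma moll_mixed e : partial 1 (partial 0 (moll e)) = partial 0 (partial 1 (moll e)).
Proof.
pose v (t : R) := ebump 1 (1 * (t - - e)) * ebump 1 (1 * (e - t)).
have dv (t : R) : derivable v t 1.
  have comp (w : R -> R) (w' : R) : is_derive t (1 : R) w w' ->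
      derivable (fun s => ebump 1 (w s)) t 1.
    move=> dw.
    by have [] := @is_derive1_comp R (ebump 1) w t _ _ (is_derive_ebump 1 _) dw.
  apply: derivableM.
    by apply: (comp (fun t => 1 * (t - - e))).
  by apply: (comp (fun t => 1 * (e - t))).
pose c := (\int[mu]_x moll0 e x)^-1.
have -> : moll e = fun x => (c * v x.1) * v x.2.
  by apply/funext => x; rewrite /moll /moll0 /box_bump -[RHS]mulrA.
apply: (mixed_tensor (u := fun t => c * v t)); last exact: dv.
by move=> t; apply: derivableM; [exact: derivable_cst|exact: dv].
Qed.

Lemma moll_supported e : supported e (moll e).
Proof. by move=> x nx; apply: moll_out => /sub_obox_cbox. Qed.

Lemma L2_square_integrable f : L2 f -> square_integrable smu (f \_ (@disc R)).
Proof.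
move=> /L2P[mf fi2]; have mD := @measurable_disc R.
have cst1 : mu.-integrable (@disc R) (EFin \o cst 1).
  apply/integrableP; split; first by apply/measurable_EFinP; exact: measurable_cst.
  under eq_integral do rewrite /=.
  by rewrite integral_cst//= measure_disc normr1 -EFinM ltry.
have fi : mu.-integrable (@disc R) (EFin \o f).
  apply: (le_integrable_real mD mf _ (integrableD_real mD cst1 fi2)) => x _.
  rewrite -[f x ^+ 2]real_normK ?num_real// /cst.
  have := sqr_ge0 (`|f x| - 1); have := normr_ge0 (f x); nra.
split.
  have := (integrable_mkcond _ mD).1 fi; congr (integrable _ _ _).
  by apply/funext => x; rewrite /= !patchE; case: ifPn.
have := (integrable_mkcond _ mD).1 fi2; congr (integrable _ _ _).
by apply/funext => x; rewrite /= !patchE; case: ifPn => // _; rewrite expr0n.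
Qed.

Lemma conv_moll_sqr f n : square_integrable smu f ->
  mu.-integrable setT (EFin \o (fun x => conv f (moll n.+1%:R^-1) x ^+ 2)) /\
  \int[mu]_x (conv f (moll n.+1%:R^-1) x ^+ 2) <= \int[mu]_x (f x ^+ 2).
Proof.
move=> hf; have c := conv_moll_contraction n hf.
have [f1 f2] := hf.
have fE : (\int[mu]_x (f x ^+ 2)%:E)%E = (\int[mu]_x (f x ^+ 2))%:E.
  by rewrite /Rintegral fineK//; exact: integrable_fin_num.
have i : mu.-integrable setT (EFin \o (fun x => conv f (moll n.+1%:R^-1) x ^+ 2)).
  apply/integrableP; split.
    apply/measurable_EFinP; apply: measurable_funX; apply: plane_continuous_measurable.
    by apply: conv_continuous => //; exact: moll_kernel.
  under eq_integral do rewrite /= ger0_norm ?sqr_ge0//.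
  by apply: le_lt_trans c _; rewrite fE ltry.
split=> //; rewrite -lee_fin -fE /Rintegral fineK//; exact: integrable_fin_num.
Qed.

Lemma sqnorm_rot (c s : R) x : c ^+ 2 + s ^+ 2 = 1 -> sqnorm (rot c s x) = sqnorm x.
Proof.
by move=> cs; rewrite -[RHS]mul1r -cs /sqnorm /rot /=; ring.
Qed.

Lemma cutoffA_sqnorm_continuous (h : R) : 0 < h ->
  continuous (fun x => cutoffA h (sqnorm x)).
Proof.
move=> h0 x; apply: (continuous_comp (f := @sqnorm R)); first exact: sqnorm_continuous.
exact: cutoffA_continuous (sqnorm_ge0 x).
Qed.

Lemma dtheta_sqr_le (a b : R) x :
  (- x.2 * a + x.1 * b) ^+ 2 <= sqnorm x * (a ^+ 2 + b ^+ 2).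
Proof.
rewrite -subr_ge0 /sqnorm.
rewrite (_ : _ - _ = (x.1 * a + x.2 * b) ^+ 2) ?sqr_ge0//; ring.
Qed.

End WeakArea.

Section RintegralSum.
Context {R : realType} d (T : measurableType d) (m : {measure set T -> \bar R}).

Lemma Rintegral_sum4 (D : set T) (a b c e : T -> R) : measurable D ->
  m.-integrable D (EFin \o a) -> m.-integrable D (EFin \o b) ->
  m.-integrable D (EFin \o c) -> m.-integrable D (EFin \o e) ->
  m.-integrable D (EFin \o (fun x => a x + b x + (c x + e x))) /\
  \int[m]_(x in D) (a x + b x + (c x + e x)) =
  \int[m]_(x in D) a x + \int[m]_(x in D) b x +
  (\int[m]_(x in D) c x + \int[m]_(x in D) e x).
Proof.
move=> mD ai bi ci ei.
have i1 := integrableD_real mD ai bi; have i2 := integrableD_real mD ci ei.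
by split; [exact: integrableD_real|rewrite !RintegralD].
Qed.

End RintegralSum.

(** * The area inequality for weak second derivatives *)

Section WeakAreaLimit.
Context {R : realType}.
Local Notation L := (@lebesgue_measure R).
Local Notation plane := (measurableTypeR R * measurableTypeR R)%type.
Local Notation mu := (L \x L)%E.
Local Notation smu := (lebesgue2 : {sigma_finite_measure set plane -> \bar R}).
Variables (A : R * R -> R) (p : 'I_2 -> R * R -> R) (pp : 'I_2 -> 'I_2 -> R * R -> R).
Hypothesis cA : continuous A.
Hypothesis A_ge0 : forall x, 0 <= A x.
Hypothesis A_le : forall x, A x * sqnorm x <= 1.
Hypothesis A_rot : forall c s x, c ^+ 2 + s ^+ 2 = 1 -> A (rot c s x) = A x.
Hypothesis A_out : forall x, ~ sqnorm x <= 1 / 4 -> A x = 0.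
Hypothesis pE : forall i x, p i x = - (coord i x * A x).
Hypothesis p_derive : forall i j x, is_derive x (basis_vec R j) (p i) (pp i j x).
Hypothesis cpp : forall i j, continuous (pp i j).
Variables (W : R * R -> R) (D1 : 'I_2 -> R * R -> R) (D2 : 'I_2 -> 'I_2 -> R * R -> R).
Hypothesis wD1 : forall i, is_weak_partial i W (D1 i).
Hypothesis lD1 : forall i, L2 (D1 i).
Hypothesis wD2 : forall i j, is_weak_partial j (D1 i) (D2 i j).
Hypothesis lD2 : forall i j, L2 (D2 i j).
Local Notation F i := (D1 i \_ (@disc R)).
Local Notation F2 i j := (D2 i j \_ (@disc R)).

Definition sum_sqr (f : 'I_2 -> 'I_2 -> R * R -> R) x : R :=
  f 0 0 x ^+ 2 + f 0 1 x ^+ 2 + (f 1 0 x ^+ 2 + f 1 1 x ^+ 2).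

(** By Cauchy-Schwarz the squared angular derivative is at most |x|^2 times the squared gradient,
    and A |x|^2 <= 1. *)
Lemma dtheta_area_le (df : 'I_2 -> 'I_2 -> R * R -> R) x :
  A x * (dtheta df 0 x ^+ 2 + dtheta df 1 x ^+ 2) <= sum_sqr df x.
Proof.
apply: (@le_trans _ _ (A x * (sqnorm x * (df 0 0 x ^+ 2 + df 0 1 x ^+ 2) +
    sqnorm x * (df 1 0 x ^+ 2 + df 1 1 x ^+ 2)))).
  by apply: ler_wpM2l => //; apply: lerD; exact: dtheta_sqr_le.
rewrite -mulrDr mulrA; apply: ler_piMl; last exact: A_le.
by rewrite /sum_sqr !addr_ge0 ?sqr_ge0.
Qed.

Lemma sum_sqr_disc : mu.-integrable setT (EFin \o sum_sqr (fun i j => F2 i j)) /\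
  \int[mu]_x sum_sqr (fun i j => F2 i j) x = \int[mu]_(x in @disc R) sum_sqr D2 x.
Proof.
have sq i j : mu.-integrable setT (EFin \o (fun x => F2 i j x ^+ 2)).
  exact: (L2_square_integrable (lD2 i j)).2.
split.
  have [i _] := Rintegral_sum4 measurableT (sq 0 0) (sq 0 1) (sq 1 0) (sq 1 1).
  exact: i.
rewrite [RHS]Rintegral_mkcond; congr (Rintegral _ _ _); apply/funext => x.
by rewrite /sum_sqr !patchE; case: ifPn => // _; rewrite expr0n !addr0.
Qed.

Definition mollified n i := conv (F i) (moll n.+1%:R^-1).

(** The condition on [n] makes the kernel radius 1/(n + 1) at most 1/4, as [conv_weak_partial]
    requires. The right-hand side does not depend on [n]. *)
Lemma area_inequality_moll n : (3 <= n)%N ->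
  \int[mu]_x cof_quadratic pp (mollified n 0 x) (mollified n 1 x) x <=
  \int[mu]_(x in @disc R) sum_sqr D2 x.
Proof.
move=> n3; rewrite /mollified; set e := n.+1%:R^-1; pose k := moll e.
have e0 : 0 < e := invn_gt0 n.
have e4 : e <= 1 / 4.
  by rewrite /e div1r lef_pV2 ?posrE ?ltr0n// ler_nat.
have kk : is_kernel k := moll_kernel e.
have ks : supported e k := @moll_supported _ e.
have kmix : partial 1 (partial 0 k) = partial 0 (partial 1 k) := moll_mixed e.
have Fi i : mu.-integrable setT (EFin \o F i) := (L2_square_integrable (lD1 i)).1.
have ct i j : mu.-integrable setT (EFin \o (fun x => conv (F2 i j) k x ^+ 2)) /\
    \int[mu]_x (conv (F2 i j) k x ^+ 2) <= \int[mu]_x (F2 i j x ^+ 2).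
  exact: (conv_moll_sqr n (L2_square_integrable (lD2 i j))).
rewrite -/k; move: k kk ks kmix ct => k kk ks kmix ct.
have kp i : is_kernel (partial i k) := kernel_partial i kk.
have kps i : supported e (partial i k) := supported_partial i kk.1 ks.
pose f i := conv (F i) k.
pose df i j := conv (F i) (partial j k).
have cf i : continuous (f i) := conv_continuous (Fi i) kk.
have cdf i j : continuous (df i j) := conv_continuous (Fi i) (kp j).
have dfd i j x : is_derive x (basis_vec R j) (f i) (df i j x).
  exact: is_derive_conv.
have rotd i (x : plane) (t : R) : is_derive t (1 : R)
    (fun s => f i (rot (cos s) (sin s) x)) (dtheta df i (rot (cos t) (sin t) x)).
  have du (s : R) : is_derive s (1 : R) (fun s => cos s * x.1 - sin s * x.2)
      (- (sin s * x.1 + cos s * x.2)).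
    by apply: is_derive_eq; rewrite /GRing.scale /=; ring.
  have dv (s : R) : is_derive s (1 : R) (fun s => sin s * x.1 + cos s * x.2)
      (cos s * x.1 - sin s * x.2).
    by apply: is_derive_eq; rewrite /GRing.scale /=; ring.
  have bd (s : R) : `|- (sin s * x.1 + cos s * x.2)| <= `|x.1| + `|x.2| /\
      `|cos s * x.1 - sin s * x.2| <= `|x.1| + `|x.2|.
    have tri (a b : R) : `|a| <= 1 -> `|b| <= 1 -> `|a * x.1 + b * x.2| <= `|x.1| + `|x.2|.
      move=> a1 b1; apply: (le_trans (ler_normD _ _)); rewrite !normrM.
      by apply: lerD; apply: ler_piMl.
    have s1 : `|sin s| <= 1 by rewrite ler_norml sin_geN1 sin_le1.
    have c1 : `|cos s| <= 1 by rewrite ler_norml cos_geN1 cos_le1.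
    by rewrite normrN -mulNr; split; apply: tri; rewrite ?normrN.
  have := is_derive_conv_curve (u' := fun s => - (sin s * x.1 + cos s * x.2))
    (v' := fun s => cos s * x.1 - sin s * x.2) t (Fi i) kk du dv bd.
  move=> /is_derive_eq; apply; rewrite /dtheta /df /rot /=.
  move: (conv _ _ _) (conv _ _ _) => a b; ring.
(* Both mixed derivatives are the convolution of [W] with the mixed second partial of the kernel. *)
have sym x : sqnorm x <= 1 / 4 -> df 0 1 x = df 1 0 x.
  move=> x4; rewrite /df.
  have h1 := conv_weak_partial (wD1 0) (kp 1).1 (kps 1) e4 x4.
  have h2 := conv_weak_partial (wD1 1) (kp 0).1 (kps 0) e4 x4.
  refine (etrans (esym h1) (etrans _ h2)).
  exact: (congr1 (fun z => conv (W \_ (@disc R)) z x) (esym kmix)).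
have area := area_inequality cA A_ge0 A_rot A_out pE p_derive cpp cf cdf dfd rotd sym.
apply: (le_trans area).
have ct4 := Rintegral_sum4 measurableT (ct 0 0).1 (ct 0 1).1 (ct 1 0).1 (ct 1 1).1.
have sq i j : mu.-integrable setT (EFin \o (fun x => F2 i j x ^+ 2)).
  exact: (L2_square_integrable (lD2 i j)).2.
have sq4 := Rintegral_sum4 measurableT (sq 0 0) (sq 0 1) (sq 1 0) (sq 1 1).
have le_eq (a b : R) : a = b -> a <= b by move=> ->.
pose g1 x := A x * (dtheta df 0 x ^+ 2 + dtheta df 1 x ^+ 2).
pose g2 x := sum_sqr (fun i j => conv (F2 i j) k) x.
have i1 : mu.-integrable setT (EFin \o g1).
  have ctheta := dtheta_continuous cdf.
  apply: half_disc_support.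
    by move=> x; apply: cvgM; [exact: cA|apply: cvgD; apply: cvgM; exact: ctheta].
  by move=> x /A_out; rewrite /g1 => ->; rewrite mul0r.
have g12 x : g1 x <= g2 x.
  rewrite /g1 /g2; have [hx|/A_out ->] := pselect (sqnorm x <= 1 / 4); last first.
    by rewrite mul0r /sum_sqr !addr_ge0 ?sqr_ge0.
  (* On the half disc the derivatives of the mollified gradient are mollified weak second
     derivatives, to which the L^2 contraction applies. *)
  have dE i j : conv (F2 i j) k x = df i j x.
    exact: (esym (conv_weak_partial (wD2 i j) kk.1 ks e4 hx)).
  have -> : sum_sqr (fun i j => conv (F2 i j) k) x = sum_sqr df x by rewrite /sum_sqr !dE.
  exact: dtheta_area_le.
have h := lerD (lerD (ct 0 0).2 (ct 0 1).2) (lerD (ct 1 0).2 (ct 1 1).2).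
have h1 := le_Rintegral measurableT i1 ct4.1 (fun x _ => g12 x).
refine (le_trans h1 (le_trans (le_eq _ _ ct4.2) (le_trans h _))).
exact: (le_trans (le_eq _ _ (esym sq4.2)) (le_eq _ _ sum_sqr_disc.2)).
Qed.

(** The second derivatives of the cutoff are bounded, so the quadratic form passes to the L^2 limit
    of the mollified gradients, and the uniform bound [area_inequality_moll] survives. *)
Lemma weak_area_inequality :
  mu.-integrable (@disc R) (EFin \o (fun x => cof_quadratic pp (D1 0 x) (D1 1 x) x)) /\
  \int[mu]_(x in @disc R) cof_quadratic pp (D1 0 x) (D1 1 x) x <=
  \int[mu]_(x in @disc R) sum_sqr D2 x.
Proof.
have sF i : square_integrable smu (F i) := L2_square_integrable (lD1 i).
have mF i : measurable_fun [set: plane] (F i : plane -> measurableTypeR R).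
  exact: measurable_integrable (sF i).1.
have [M M0 hM] : exists2 M : R, 0 <= M & forall i j x, `|pp i j x| <= M.
  have b i j : exists2 M : R, 0 <= M & forall x, `|pp i j x| <= M.
    have [M M0 hM] := continuous_bounded_on_compact (@cpp i j) (@compact_half_disc R).
    exists M => // x; have [hx|hx] := pselect (sqnorm x <= 1 / 4); first exact: hM.
    by rewrite (pp_out A_out pE p_derive) ?normr0.
  have [M1 p1 h1] := b 0 0; have [M2 p2 h2] := b 0 1.
  have [M3 p3 h3] := b 1 0; have [M4 p4 h4] := b 1 1.
  exists (M1 + M2 + M3 + M4) => [|i j x]; first by rewrite !addr_ge0.
  have := h1 x; have := h2 x; have := h3 x; have := h4 x.
  by have [->|->] := ord2_cases i; have [->|->] := ord2_cases j; lra.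
pose p01 x := pp 1 0 x + pp 0 1 x.
have mp i j : measurable_fun [set: plane] (pp i j : plane -> measurableTypeR R).
  exact: plane_continuous_measurable.
have cpp01 : continuous p01.
  by move=> x; apply: cvgD; exact: cpp.
have mp01 : measurable_fun [set: plane] (p01 : plane -> measurableTypeR R).
  exact: plane_continuous_measurable.
have hp01 x : `|p01 x| <= 2 * M.
  by apply: (le_trans (ler_normD _ _)); have := hM 1 0 x; have := hM 0 1 x; lra.
have cm n i : continuous (mollified n i) := conv_continuous (sF i).1 (moll_kernel _).
have qi n : mu.-integrable setT (EFin \o qform (pp 1 1) (pp 0 0) p01 (mollified n 0) (mollified n 1)).
  apply: half_disc_support.
    move=> x; apply: cvgB; [apply: cvgD; apply: cvgM|apply: cvgM].
    - by apply: cvgM; exact: cm.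
    - exact: cpp.
    - by apply: cvgM; exact: cm.
    - exact: cpp.
    - by apply: cvgM; exact: cm.
    - exact: cpp01.
  move=> x hx; rewrite /qform /p01.
  by rewrite !(pp_out A_out pE p_derive)// !(mulr0, addr0, subr0).
have iQ := qform_integrable (mp 1 1) (mp 0 0) mp01 (hM 1 1) (hM 0 0) hp01
  (mF 0) (mF 1) (sF 0).2 (sF 1).2.
have mm n i := plane_continuous_measurable (cm n i).
have ca := mollification_cvg (sF 0); have cb := mollification_cvg (sF 1).
have lim := qform_limit (m := mu) M0 (mp 1 1) (mp 0 0) mp01 (hM 1 1) (hM 0 0) hp01
  (mF 0) (mF 1) (sF 0).2 (sF 1).2 (mm^~ 0) (mm^~ 1) ca cb
  (fun n hn => conj (qi n) (area_inequality_moll hn)).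
have E : (fun x => cof_quadratic pp (D1 0 x) (D1 1 x) x) \_ (@disc R) =
    qform (pp 1 1) (pp 0 0) p01 (F 0) (F 1).
  apply/funext => x; rewrite /qform /cof_quadratic !patchE; case: ifPn => // _.
  by rewrite expr0n /= !mul0r addr0 subr0.
split.
  apply/(integrable_mkcond _ (@measurable_disc R)).
  have : mu.-integrable setT (EFin \o ((fun x => cof_quadratic pp (D1 0 x) (D1 1 x) x) \_ (@disc R))).
    by rewrite E; exact: iQ.
  by congr (integrable _ _ _); apply/funext => x; rewrite /= !patchE; case: ifPn.
by rewrite Rintegral_mkcond E.
Qed.

End WeakAreaLimit.

(** * Lower bound *)

Section LowerIntegral.
Context {R : realType} d (T : measurableType d) (m : {measure set T -> \bar R}).

(** The energy of an admissible pair may be infinite, in which case the inequality is trivial;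
    otherwise [E] is integrable and real integrals can be compared. *)
Lemma le_Rintegral_ge0 (D : set T) (l E : T -> R) : measurable D ->
  m.-integrable D (EFin \o l) -> measurable_fun D E -> (forall x, D x -> 0 <= E x) ->
  (forall x, D x -> l x <= E x) ->
  ((\int[m]_(x in D) l x)%:E <= \int[m]_(x in D) (E x)%:E)%E.
Proof.
move=> mD il mE E0 lE.
have [fin|] := boolP (\int[m]_(x in D) (E x)%:E < +oo)%E; last first.
  by rewrite ltey negbK => /eqP ->; rewrite leey.
have iE : m.-integrable D (EFin \o E).
  apply/integrableP; split; first exact/measurable_EFinP.
  apply: le_lt_trans fin; rewrite le_eqVlt; apply/orP; left; apply/eqP.
  by apply: eq_integral => x /set_mem Dx; rewrite /= ger0_norm// E0.
have h : \int[m]_(x in D) l x <= \int[m]_(x in D) E x by exact: le_Rintegral.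
have -> : (\int[m]_(x in D) (E x)%:E = (\int[m]_(x in D) E x)%:E)%E.
  by rewrite /Rintegral fineK//; exact: integrable_fin_num.
by rewrite lee_fin.
Qed.

Lemma Rintegral_scale (D : set T) (f : T -> R) (k : R) : measurable D ->
  m.-integrable D (EFin \o f) -> \int[m]_(x in D) (k * f x) = k * \int[m]_(x in D) f x.
Proof. by move=> mD fi; rewrite RintegralZl. Qed.

Lemma Rintegral_lin5 (D : set T) (a b c e f : T -> R) (k l : R) : measurable D ->
  m.-integrable D (EFin \o a) -> m.-integrable D (EFin \o b) ->
  m.-integrable D (EFin \o c) -> m.-integrable D (EFin \o e) ->
  m.-integrable D (EFin \o f) ->
  m.-integrable D (EFin \o (fun x => - a x - b x + k * c x + e x - l * f x)) /\
  \int[m]_(x in D) (- a x - b x + k * c x + e x - l * f x) =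
  - (\int[m]_(x in D) a x) - (\int[m]_(x in D) b x) + k * (\int[m]_(x in D) c x)
  + (\int[m]_(x in D) e x) - l * (\int[m]_(x in D) f x).
Proof.
move=> mD ai bi ci ei fi.
have i0 := integrableZ_real (-1) mD ai.
have i1 := integrableB_real mD i0 bi.
have kc := integrableZ_real k mD ci.
have i2 := integrableD_real mD i1 kc.
have i3 := integrableD_real mD i2 ei.
have lf := integrableZ_real l mD fi.
have i4 := integrableB_real mD i3 lf.
have E : (fun x => - a x - b x + k * c x + e x - l * f x) =
    (fun x => -1 * a x - b x + k * c x + e x - l * f x).
  by apply/funext => x; rewrite mulN1r.
rewrite E; split; first exact: i4.
rewrite RintegralB// RintegralD// RintegralD// RintegralB// !RintegralZl//.
by rewrite mulN1r.
Qed.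

End LowerIntegral.

(** * The energy density in coordinates *)

Section EnergyDensity.
Context {R : realType}.
Local Notation L := (@lebesgue_measure R).
Local Notation plane := (measurableTypeR R * measurableTypeR R)%type.
Local Notation mu := (L \x L)%E.
Implicit Types (u d : 'I_2 -> 'I_2 -> R * R -> R) (w : 'I_2 -> R * R -> R).

Definition strain (Delta : R) u w (i j : 'I_2) (x : R * R) : R :=
  u i j x + u j i x + w i x * w j x - Delta ^+ 2 * (hat_perp x i 0 * hat_perp x j 0).

Definition density (h Delta : R) u w d (x : R * R) : R :=
  sum_sqr (strain Delta u w) x + h ^+ 2 * sum_sqr d x.

Lemma sum2 (V : zmodType) (F : 'I_2 -> V) : \sum_i F i = F 0 + F 1.
Proof.
by rewrite big_ord_recl big_ord_recl big_ord0 addr0; congr (F _ + F _); exact/val_inj.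
Qed.

Lemma frobenius_sqr (M : 'M[R]_2) :
  frobenius M ^+ 2 = M 0 0 ^+ 2 + M 0 1 ^+ 2 + (M 1 0 ^+ 2 + M 1 1 ^+ 2).
Proof.
rewrite /frobenius sqr_sqrtr; first by rewrite !sum2.
by apply: sumr_ge0 => i _; apply: sumr_ge0 => j _; exact: sqr_ge0.
Qed.

Lemma energy_density h Delta (U : R * R -> 'cV[R]_2) (W : R * R -> R) :
  energy_vK h Delta U W = (\int[mu]_(x in @disc R)
   (density h Delta (fun i j => weak_partial j (fun y => U y i 0))
     (fun i => weak_partial i W) (fun i j => weak_partial j (weak_partial i W)) x)%:E)%E.
Proof.
rewrite /energy_vK plane_measureE; apply: eq_integral => x _; congr (_%:E).
rewrite !frobenius_sqr /density /sum_sqr; congr (_ + _ * _); last by rewrite !mxE.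
have E i j : (2 *: sym (weak_jacobian U x) + tensor (weak_grad W x) (weak_grad W x) -
     Delta ^+ 2 *: tensor (hat_perp x) (hat_perp x)) i j =
   strain Delta (fun i j => weak_partial j (fun y => U y i 0)) (fun i => weak_partial i W) i j x.
  rewrite /strain /sym /tensor scalerA mulfV// scale1r.
  by rewrite !mxE !big_ord1 !mxE.
by rewrite !E.
Qed.

Lemma hat_perpE (x : R * R) :
  hat_perp x 0 0 = - x.2 / euclid x /\ hat_perp x 1 0 = x.1 / euclid x.
Proof. by rewrite !mxE /= mulrC; split=> //; rewrite mulrC. Qed.

Lemma measurable_inv : measurable_fun setT (fun t : measurableTypeR R => t^-1 : measurableTypeR R).
Proof.
have -> : [set: measurableTypeR R] = [set t : R | t != 0] `|` [set 0].
  apply/seteqP; split=> // t _; have [->|t0] := eqVneq t 0; [by right|by left].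
have o : open [set t : R | t != 0].
  rewrite (_ : [set t : R | t != 0] = ~` [set 0]); last first.
    by apply/seteqP; split=> t /= /eqP.
  by apply: closed_openC; exact: closed_eq.
apply/measurable_funU; [exact: open_measurable|exact: measurable_set1|split; last exact: measurable_fun_set1].
apply: open_continuous_measurable_fun => // t /set_mem /= t0.
exact: inv_continuous.
Qed.

Lemma measurable_euclid : measurable_fun setT (@euclid R : plane -> measurableTypeR R).
Proof.
apply: plane_continuous_measurable => x.
exact: (@continuous_comp _ _ _ (@sqnorm R) (@Num.sqrt R) x (@sqnorm_continuous R x) (@sqrt_continuous R _)).
Qed.

Lemma measurable_hat_perp i : measurable_fun setT
  ((fun x => hat_perp x i 0) : plane -> measurableTypeR R).
Proof.
have mi : measurable_fun setT ((fun x => (euclid x)^-1) : plane -> measurableTypeR R).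
  exact: measurableT_comp measurable_inv measurable_euclid.
have m2 : measurable_fun setT ((fun x => - x.2) : plane -> measurableTypeR R).
  by apply: measurableT_comp; [exact: measurable_realfun.oppr_measurable|exact: measurable_snd].
have [->|->] := ord2_cases i.
  rewrite (_ : (fun x => _) = fun x : R * R => - x.2 * (euclid x)^-1).
    exact: measurable_realfun.measurable_funM.
  by apply/funext => x; exact: (hat_perpE x).1.
rewrite (_ : (fun x => _) = fun x : R * R => x.1 * (euclid x)^-1).
  by apply: measurable_realfun.measurable_funM => //; exact: measurable_fst.
by apply/funext => x; exact: (hat_perpE x).2.
Qed.

Lemma measurable_sum_sqr d : (forall i j, measurable_fun (@disc R) (d i j : plane -> measurableTypeR R)) ->
  measurable_fun (@disc R) (sum_sqr d : plane -> measurableTypeR R).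
Proof.
by move=> md; repeat (apply: measurable_realfun.measurable_funD); apply: measurable_funX; exact: md.
Qed.

Lemma measurable_density h Delta u w d :
  (forall i j, measurable_fun (@disc R) (u i j : plane -> measurableTypeR R)) ->
  (forall i, measurable_fun (@disc R) (w i : plane -> measurableTypeR R)) ->
  (forall i j, measurable_fun (@disc R) (d i j : plane -> measurableTypeR R)) ->
  measurable_fun (@disc R) (density h Delta u w d : plane -> measurableTypeR R).
Proof.
move=> mu_ mw md.
have mh i : measurable_fun (@disc R) ((fun x => hat_perp x i 0) : plane -> measurableTypeR R).
  exact: measurable_funS (measurable_hat_perp i).
have mc (c : R) : measurable_fun (@disc R) (cst c : plane -> measurableTypeR R).
  exact: measurable_cst.
apply: measurable_realfun.measurable_funD.
  apply: measurable_sum_sqr => i j; apply: measurable_realfun.measurable_funB.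
    apply: measurable_realfun.measurable_funD; first by apply: measurable_realfun.measurable_funD; exact: mu_.
    by apply: measurable_realfun.measurable_funM; exact: mw.
  by apply: measurable_realfun.measurable_funM => //; apply: measurable_realfun.measurable_funM; exact: mh.
by apply: measurable_realfun.measurable_funM => //; exact: measurable_sum_sqr.
Qed.

Lemma sum_sqr_ge0 d x : 0 <= sum_sqr d x.
Proof. by rewrite /sum_sqr !addr_ge0 ?sqr_ge0. Qed.

Lemma density_ge0 h Delta u w d x : 0 <= density h Delta u w d x.
Proof. by rewrite addr_ge0 ?sum_sqr_ge0// mulr_ge0 ?sum_sqr_ge0 ?sqr_ge0. Qed.

End EnergyDensity.

Section LowerBound.
Context {R : realType}.
Local Notation L := (@lebesgue_measure R).
Local Notation plane := (measurableTypeR R * measurableTypeR R)%type.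
Local Notation mu := (L \x L)%E.

Lemma euclid_sqr (x : R * R) : euclid x ^+ 2 = sqnorm x.
Proof. by rewrite sqr_sqrtr// sqnorm_ge0. Qed.

Lemma sqnorm_eq0 (x : R * R) : sqnorm x = 0 -> x.1 = 0 /\ x.2 = 0.
Proof.
move=> /eqP; rewrite paddr_eq0 ?sqr_ge0// !sqrf_eq0 => /andP[/eqP-> /eqP->].
by [].
Qed.

Section Pointwise.
Variables (A B : R * R -> R) (pp : 'I_2 -> 'I_2 -> R * R -> R).
Hypothesis A_ge0 : forall x, 0 <= A x.
Hypothesis ppE : forall i j x,
  pp i j x = coord i x * coord j x * B x - (i == j)%:R * A x.

(* Equality holds except at the origin, where [hat_perp] is zero. *)
Lemma hat_perp_cof x :
  sqnorm x * B x - A x <= hat_perp x 0 0 ^+ 2 * pp 1 1 x + hat_perp x 1 0 ^+ 2 * pp 0 0 x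
    - 2 * (hat_perp x 0 0 * hat_perp x 1 0 * pp 0 1 x).
Proof.
rewrite (hat_perpE x).1 (hat_perpE x).2 !ppE /coord /=.
have Es := euclid_sqr x.
have [s0|s0] := eqVneq (sqnorm x) 0.
  have [-> ->] := sqnorm_eq0 s0; rewrite s0 !mul0r oppr0 !mul0r.
  by have := A_ge0 x; lra.
have E0 : euclid x != 0 by rewrite -sqrf_eq0 Es.
rewrite le_eqVlt; apply/orP; left; apply/eqP; rewrite -Es /sqnorm in s0 *.
have {}Es : x.2 ^+ 2 = euclid x ^+ 2 - x.1 ^+ 2 by rewrite Es /sqnorm; ring.
move: (euclid x) E0 Es => E E0 Es.
rewrite mul1r mul0r subr0.
have -> : (- x.2 / E) ^+ 2 * (x.2 * x.2 * B x - A x) + (x.1 / E) ^+ 2 * (x.1 * x.1 * B x - A x) -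
   2 * (- x.2 / E * (x.1 / E) * (x.1 * x.2 * B x)) =
   ((x.1 ^+ 2 + x.2 ^+ 2) ^+ 2 * B x - (x.1 ^+ 2 + x.2 ^+ 2) * A x) / E ^+ 2 by field.
by rewrite Es; field.
Qed.

Implicit Types (u d : 'I_2 -> 'I_2 -> R * R -> R) (w : 'I_2 -> R * R -> R).

(** Twice the symmetric part of the matrix [u], contracted with the cofactor matrix of [pp]. *)
Definition stress u (x : R * R) : R :=
  2 * (u 0 0 x * pp 1 1 x + u 1 1 x * pp 0 0 x - (u 0 1 x + u 1 0 x) * pp 0 1 x).

(* Completing the square in [strain + h^2 / 2 * cofactor]. *)
Lemma density_lower (h Delta : R) u w d x :
  h ^+ 2 * (- stress u x - cof_quadratic pp (w 0 x) (w 1 x) x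
    + Delta ^+ 2 * (sqnorm x * B x - A x) + sum_sqr d x - h ^+ 2 / 4 * sum_sqr pp x)
  <= density h Delta u w d x.
Proof.
have s01 : pp 1 0 x = pp 0 1 x by rewrite !ppE /=; ring.
have hc := hat_perp_cof x.
rewrite /density /stress /cof_quadratic /sum_sqr /strain s01.
move: hc; move: (hat_perp x 0 0) (hat_perp x 1 0) (sqnorm x * B x - A x) => t0 t1 e hc.
move: (pp 1 1 x) (pp 0 0 x) (pp 0 1 x) (u 0 0 x) (u 0 1 x) (u 1 0 x) (u 1 1 x)
  (w 0 x) (w 1 x) (d 0 0 x) (d 0 1 x) (d 1 0 x) (d 1 1 x) hc
  => a b c u0 u1 u2 u3 w0 w1 d0 d1 d2 d3 hc.
rewrite -subr_ge0.
rewrite [leRHS](_ : _ = (u0 + u0 + w0 * w0 - Delta ^+ 2 * (t0 * t0) + h ^+ 2 / 2 * a) ^+ 2 +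
  (u3 + u3 + w1 * w1 - Delta ^+ 2 * (t1 * t1) + h ^+ 2 / 2 * b) ^+ 2 +
  2 * (u1 + u2 + w0 * w1 - Delta ^+ 2 * (t0 * t1) - h ^+ 2 / 2 * c) ^+ 2 +
  h ^+ 2 * Delta ^+ 2 * (t0 ^+ 2 * a + t1 ^+ 2 * b - 2 * (t0 * t1 * c) - e)); last by field.
do 3 ?[apply: addr_ge0]; rewrite ?sqr_ge0 ?(mulr_ge0 (ler0n _ 2)) ?sqr_ge0//.
by apply: mulr_ge0; [rewrite mulr_ge0 ?sqr_ge0|rewrite subr_ge0].
Qed.

Hypothesis pp_test : forall i j, test_function (pp i j).
(** This and the next hypothesis say that the rows of the cofactor matrix are divergence free. *)
Hypothesis pp_third0 : partial 0 (pp 1 1) = partial 1 (pp 0 1).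
Hypothesis pp_third1 : partial 1 (pp 0 0) = partial 0 (pp 0 1).

Lemma stress_integral (U : 'I_2 -> R * R -> R) u :
  (forall i j, is_weak_partial j (U i) (u i j)) ->
  mu.-integrable (@disc R) (EFin \o stress u) /\ \int[mu]_(x in @disc R) stress u x = 0.
Proof.
move=> wU; have mD := @measurable_disc R.
have lu i j : locally_L1 (u i j) by have [] := wU i j.
have iu i j phi : test_function phi ->
    mu.-integrable (@disc R) (EFin \o (fun x => u i j x * phi x)).
  move=> tphi; apply: (@integrableS _ _ _ _ setT) => //.
  exact: locally_L1_test.
have wd i j phi : test_function phi -> \int[mu]_(x in @disc R) (u i j x * phi x) =
    - \int[mu]_(x in @disc R) (U i x * partial j phi x).
  by move=> tphi; have [_ _ /(_ _ tphi)] := wU i j; rewrite plane_measureE => ->; rewrite opprK.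
have tt := pp_test.
have i0 := integrableZ_real 2 mD (iu 0 0 _ (tt 1 1)).
have i1 := integrableZ_real (-2) mD (iu 0 1 _ (tt 0 1)).
have i2 := integrableZ_real 2 mD (iu 1 1 _ (tt 0 0)).
have i3 := integrableZ_real (-2) mD (iu 1 0 _ (tt 0 1)).
have [I E] := Rintegral_sum4 mD i0 i1 i2 i3.
have SE : stress u = fun x => 2 * (u 0 0 x * pp 1 1 x) + -2 * (u 0 1 x * pp 0 1 x) +
   (2 * (u 1 1 x * pp 0 0 x) + -2 * (u 1 0 x * pp 0 1 x)).
  by apply/funext => x; rewrite /stress; ring.
rewrite SE; split; first exact: I.
have Z k i j phi : test_function phi -> \int[mu]_(x in @disc R) (k * (u i j x * phi x)) =
    k * - \int[mu]_(x in @disc R) (U i x * partial j phi x).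
  by move=> tphi; rewrite -wd//; apply: RintegralZl => //; exact: iu.
have z1 := Z 2 0 0 _ (tt 1 1); have z2 := Z (-2) 0 1 _ (tt 0 1).
have z3 := Z 2 1 1 _ (tt 0 0); have z4 := Z (-2) 1 0 _ (tt 0 1).
refine (etrans E (etrans (congr2 +%R (congr2 +%R z1 z2) (congr2 +%R z3 z4)) _)).
rewrite pp_third0 pp_third1.
by move: (\int[_]_(_ in _) (U 0 _ * _)) (\int[_]_(_ in _) (U 1 _ * _)) => a b; ring.
Qed.

End Pointwise.

Section CutoffHessian.
Variable h : R.
Hypothesis h_gt0 : 0 < h.

Definition cutoff_grad (i : 'I_2) (x : R * R) : R := - (coord i x * cutoffA h (sqnorm x)).

Definition cutoff_hess (i j : 'I_2) (x : R * R) : R :=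
  coord i x * coord j x * cutoffB h (sqnorm x) - (i == j)%:R * cutoffA h (sqnorm x).

Lemma cutoff_hessE i j : partial j (partial i (cutoff_fun h)) = cutoff_hess i j.
Proof. by apply/funext => x; rewrite cutoff_fun_partial2E. Qed.

Lemma cutoff_hess_test i j : test_function (cutoff_hess i j).
Proof.
rewrite -cutoff_hessE; apply: test_function_partial; apply: test_function_partial.
exact: cutoff_fun_test.
Qed.

Lemma cutoff_grad_derive i j x : is_derive x (basis_vec R j) (cutoff_grad i) (cutoff_hess i j x).
Proof.
rewrite -cutoff_hessE.
have -> : cutoff_grad i = partial i (cutoff_fun h) by rewrite cutoff_fun_partialE.
by apply: test_is_derive; apply: test_function_partial; exact: cutoff_fun_test.
Qed.

Lemma cutoff_hess_derive i j k x : is_derive x (basis_vec R k) (cutoff_hess i j)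
  (((i == k)%:R * coord j x + (j == k)%:R * coord i x + (i == j)%:R * coord k x)
     * cutoffB h (sqnorm x)
   + 2 * (coord i x * coord j x * coord k x) * derive1 (cutoffB h) (sqnorm x)).
Proof.
have s0 := sqnorm_ge0 x.
have dB : is_derive (sqnorm x) (1 : R) (cutoffB h) (derive1 (cutoffB h) (sqnorm x)).
  by rewrite derive1E; apply: DeriveDef => //; exact: cutoffB_derivable.
have d1 := is_derive_comp_line (is_derive_cutoffA h_gt0 s0) (is_derive_sqnorm k x).
have d1' : is_derive x (basis_vec R k) (fun x => cutoffA h (sqnorm x)) _ := d1.
have d2 := is_derive_comp_line dB (is_derive_sqnorm k x).
have d2' : is_derive x (basis_vec R k) (fun x => cutoffB h (sqnorm x)) _ := d2.
have d3 := is_derive_coord i k x; have d4 := is_derive_coord j k x.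
by rewrite /cutoff_hess; apply: is_derive_eq; rewrite /GRing.scale /=; field.
Qed.

(** In ['I_2] the index [i + 1] is the other one; the two values of [i] give [pp_third0] and
    [pp_third1]. Both sides are instances of an expression symmetric in three indices. *)
Lemma cutoff_hess_third i : partial i (cutoff_hess (i + 1) (i + 1)) = partial (i + 1) (cutoff_hess 0 1).
Proof.
apply/funext => x.
have [_ e1] := cutoff_hess_derive (i + 1) (i + 1) i x.
have [_ e2] := cutoff_hess_derive 0 1 (i + 1) x.
rewrite /partial e1 e2.
by have [->|->] := ord2_cases i; rewrite /coord /=; ring.
Qed.

Lemma cutoffA_ge0 (x : R * R) : 0 <= cutoffA h (sqnorm x).
Proof.
have /andP[] := cutoffA_itv h_gt0 (sqnorm_ge0 x).
by rewrite pmulr_lge0// reg_sqnorm_gt0.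
Qed.

Lemma cutoffA_sqnorm_le (x : R * R) : cutoffA h (sqnorm x) * sqnorm x <= 1.
Proof.
have /andP[_] := cutoffA_itv h_gt0 (sqnorm_ge0 x); apply: le_trans.
by apply: ler_wpM2l; [exact: cutoffA_ge0|rewrite lerDl sqr_ge0].
Qed.

Lemma cutoffA_sqnorm_out (x : R * R) : ~ sqnorm x <= 1 / 4 -> cutoffA h (sqnorm x) = 0.
Proof. by move=> /negP; rewrite -ltNge => /ltW/(cutoff_out h_gt0)[]. Qed.

(** Both A and |x|^2 B are of order 1/(|x|^2 + h^2), with constants 1 and [K]; the factor 4 counts
    the entries. *)
Lemma cutoff_hess_le (K : R) :
  (forall s, `|ebump 'X^3 (log_scale h s) + 2 * ebump (1 + 'X) (log_scale h s)| <= K) ->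
  forall x, sum_sqr cutoff_hess x <= 4 * (K + 1) ^+ 2 * ((sqnorm x + h ^+ 2) ^+ 2)^-1.
Proof.
move=> hK x; have p := reg_sqnorm_gt0 h_gt0 x; set D := sqnorm x + h ^+ 2 in p *.
have s0 := sqnorm_ge0 x.
have sD : sqnorm x <= D by rewrite lerDl sqr_ge0.
have hA : `|cutoffA h (sqnorm x)| <= D^-1.
  rewrite ger0_norm ?cutoffA_ge0// -[leRHS]mul1r ler_pdivlMr//.
  by have /andP[] := cutoffA_itv h_gt0 s0.
have hB : `|cutoffB h (sqnorm x)| <= K / D ^+ 2.
  by rewrite /cutoffB normrM normfV [`|_ ^+ 2|]ger0_norm ?sqr_ge0// ler_pM2r ?invr_gt0 ?exprn_gt0.
have K0 : 0 <= K by apply: le_trans (hK 0).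
have cc i j : `|coord i x * coord j x| <= D.
  apply: le_trans sD; rewrite /sqnorm /coord normrM.
  rewrite -[X in _ <= X + _]real_normK ?num_real// -[X in _ <= _ + X]real_normK ?num_real//.
  have := sqr_ge0 (`|x.1| - `|x.2|); have := sqr_ge0 (`|x.1|); have := sqr_ge0 (`|x.2|).
  by case: (i == 0); case: (j == 0); nra.
have e i j : cutoff_hess i j x ^+ 2 <= ((K + 1) / D) ^+ 2.
  rewrite -[leLHS]real_normK ?num_real//; apply: lerXn2r; rewrite ?nnegrE//.
    by apply: divr_ge0; [exact: addr_ge0|exact: ltW].
  apply: (le_trans (ler_normB _ _)); rewrite mulrDl; apply: lerD.
    rewrite normrM (_ : K / D = D * (K / D ^+ 2)); last by field; rewrite gt_eqF.
    by apply: ler_pM.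
  rewrite normrM mul1r; apply: le_trans hA; case: (i == j); rewrite ?normr1 ?mul1r//.
  by rewrite normr0 mul0r.
have -> : 4 * (K + 1) ^+ 2 * (D ^+ 2)^-1 = ((K + 1) / D) ^+ 2 + ((K + 1) / D) ^+ 2 +
   (((K + 1) / D) ^+ 2 + ((K + 1) / D) ^+ 2) by field; rewrite gt_eqF.
by rewrite /sum_sqr !lerD.
Qed.

Lemma reg_integral : mu.-integrable (@disc R) (EFin \o (fun x => ((sqnorm x + h ^+ 2) ^+ 2)^-1)) /\
  \int[mu]_(x in @disc R) ((sqnorm x + h ^+ 2) ^+ 2)^-1 <= pi / h ^+ 2.
Proof.
have h2 : 0 < h ^+ 2 by rewrite exprn_gt0.
pose f (t : R) := ((t + h ^+ 2) ^+ 2)^-1.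
pose F (t : R) := - (t + h ^+ 2)^-1.
have d1 (t : R) : is_derive t (1 : R) (fun t => t + h ^+ 2) 1.
  by apply: is_derive_eq; rewrite addr0.
have dF (t : R) : 0 <= t <= 1 -> is_derive t (1 : R) F (f t).
  move=> /andP[t0 _]; have pn : t + h ^+ 2 != 0 by rewrite gt_eqF ?reg_gt0.
  have d2 := @is_deriveV R (fun t => t + h ^+ 2) t 1 1 pn (d1 t).
  by rewrite /F /f; apply: is_derive_eq; rewrite /GRing.scale /=; field.
have cf (t : R) : 0 <= t <= 1 -> {for t, continuous f}.
  move=> /andP[t0 _]; apply: cvgV; first by rewrite expf_neq0// gt_eqF ?reg_gt0.
  by apply: cvgM; apply: cvgD; do ?[exact: cvg_id|exact: cvg_cst].
have hM (t : R) : 0 <= t <= 1 -> `|f t| <= (h ^+ 2) ^- 2.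
  move=> /andP[t0 _]; rewrite /f ger0_norm ?invr_ge0 ?sqr_ge0//.
  rewrite lef_pV2 ?posrE ?exprn_gt0 ?reg_gt0//.
  by apply: lerXn2r; rewrite ?nnegrE ?lerDr// ltW// reg_gt0.
have [I E] := disc_radial hM dF cf; split; first exact: I.
rewrite [leLHS]E; apply: ler_wpM2l; first exact: pi_ge0.
rewrite /F opprK add0r addrC gerBl invr_ge0; exact: ltW (reg_gt0 h_gt0 ler01).
Qed.

Lemma cutoff_hess_integral (K : R) :
  (forall s, `|ebump 'X^3 (log_scale h s) + 2 * ebump (1 + 'X) (log_scale h s)| <= K) ->
  mu.-integrable (@disc R) (EFin \o sum_sqr cutoff_hess) /\
  \int[mu]_(x in @disc R) sum_sqr cutoff_hess x <= 4 * (K + 1) ^+ 2 * (pi / h ^+ 2).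
Proof.
move=> hK; have mD := @measurable_disc R.
have le_ := cutoff_hess_le hK.
have [Ir Er] := reg_integral.
have Ik := integrableZ_real (4 * (K + 1) ^+ 2) mD Ir.
have ms : measurable_fun (@disc R) (sum_sqr cutoff_hess : plane -> measurableTypeR R).
  apply: measurable_sum_sqr => i j; apply: measurable_funS (test_function_measurable (cutoff_hess_test i j)) => //.
have I : mu.-integrable (@disc R) (EFin \o sum_sqr cutoff_hess).
  by apply: (le_integrable_real mD ms _ Ik) => x _; rewrite ger0_norm ?sum_sqr_ge0.
split=> //.
have h1 := le_Rintegral mD I Ik (fun x _ => le_ x).
apply: (le_trans h1).
have -> := Rintegral_scale (4 * (K + 1) ^+ 2) mD Ir.
by apply: ler_wpM2l => //; rewrite mulr_ge0 ?sqr_ge0.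
Qed.

(** Integrate [density_lower]: the stress term vanishes, the squared Hessian absorbs the quadratic
    form in the gradient, and the last term is bounded because the factor h^2 / 4 meets an integral
    of order h^-2. *)
Lemma density_integral_lower (K Delta : R) (V : 'I_2 -> R * R -> R) u (W : R * R -> R) w d :
  (forall s, `|ebump 'X^3 (log_scale h s) + 2 * ebump (1 + 'X) (log_scale h s)| <= K) ->
  (forall i j, is_weak_partial j (V i) (u i j)) ->
  (forall i, is_weak_partial i W (w i)) -> (forall i, L2 (w i)) ->
  (forall i j, is_weak_partial j (w i) (d i j)) -> (forall i j, L2 (d i j)) ->
  ((h ^+ 2 * (2 * pi * Delta ^+ 2 * cutoff h 0 - pi * (K + 1) ^+ 2))%:E <=
   \int[mu]_(x in @disc R) (density h Delta u w d x)%:E)%E.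
Proof.
move=> hK wu wW lw ww ld; have mD := @measurable_disc R.
have ppE i j (x : R * R) : cutoff_hess i j x = coord i x * coord j x * cutoffB h (sqnorm x)
  - (i == j)%:R * cutoffA h (sqnorm x) by [].
have t0 : partial 0 (cutoff_hess 1 1) = partial 1 (cutoff_hess 0 1).
  by have := cutoff_hess_third 0; rewrite add0r.
have t1 : partial 1 (cutoff_hess 0 0) = partial 0 (cutoff_hess 0 1).
  by have := cutoff_hess_third 1; rewrite (_ : 1 + 1 = 0)//; exact/val_inj.
have [Is Es] := stress_integral cutoff_hess_test t0 t1 wu.
have cpp i j : continuous (cutoff_hess i j) := test_continuous (cutoff_hess_test i j).
have [Ic Hc] := weak_area_inequality (cutoffA_sqnorm_continuous h_gt0) cutoffA_ge0 cutoffA_sqnorm_le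
  (fun c s x cs => congr1 (cutoffA h) (sqnorm_rot x cs)) cutoffA_sqnorm_out
  (fun i x => erefl) cutoff_grad_derive cpp wW lw ww ld.
have [Ir Er] := radial_hessian_integral h_gt0.
have [In Hn] := cutoff_hess_integral hK.
have sq i j : mu.-integrable (@disc R) (EFin \o (fun x => d i j x ^+ 2)).
  by have /L2P[] := ld i j.
have [Id _] := Rintegral_sum4 mD (sq 0 0) (sq 0 1) (sq 1 0) (sq 1 1).
have Id' : mu.-integrable (@disc R) (EFin \o sum_sqr d) by exact: Id.
have [Il El] := Rintegral_lin5 (Delta ^+ 2) (h ^+ 2 / 4) mD Is Ic Ir Id' In.
have Ihl := integrableZ_real (h ^+ 2) mD Il.
have Ehl := Rintegral_scale (h ^+ 2) mD Il.
have md : measurable_fun (@disc R) (density h Delta u w d : plane -> measurableTypeR R).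
  apply: measurable_density => [i j|i|i j].
  - by have [_ /locally_L1_measurable] := wu i j.
  - by have [_ /locally_L1_measurable] := wW i.
  - by have [_ /locally_L1_measurable] := ww i j.
have lo := le_Rintegral_ge0 mD Ihl md (fun x _ => density_ge0 h Delta u w d x)
  (fun x _ => density_lower cutoffA_ge0 ppE h Delta u w d x).
apply: le_trans lo; rewrite lee_fin Ehl El Es.
apply: ler_wpM2l; first exact: sqr_ge0.
rewrite Er oppr0 sub0r.
have h2 : 0 < h ^+ 2 by rewrite exprn_gt0.
move: Hc Hn.
move: (\int[_]_(_ in _) cof_quadratic _ _ _ _) (\int[_]_(_ in _) sum_sqr d _)
  (\int[_]_(_ in _) sum_sqr cutoff_hess _) => q s n qs ns.
have nK : h ^+ 2 / 4 * n <= pi * (K + 1) ^+ 2.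
  apply: (@le_trans _ _ (h ^+ 2 / 4 * (4 * (K + 1) ^+ 2 * (pi / h ^+ 2)))).
    by apply: ler_wpM2l => //; rewrite divr_ge0// ltW.
  by rewrite le_eqVlt; apply/orP; left; apply/eqP; field; rewrite gt_eqF.
have -> : Delta ^+ 2 * (2 * pi * cutoff h 0) = 2 * pi * Delta ^+ 2 * cutoff h 0 by ring.
clear - qs nK; lra.
Qed.

End CutoffHessian.


Lemma energy_lower : exists2 C : R, 0 <= C & forall (h Delta : R)
    (U : R * R -> 'cV[R]_2) (W : R * R -> R), 0 < h -> W12_vec U -> W22 W ->
  ((h ^+ 2 * (2 * pi * Delta ^+ 2 * (- ln h - ln 2 - 1) - C))%:E <= energy_vK h Delta U W)%E.
Proof.
have [K1 K10 hK1] := @ebump_le R 'X^3 0.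
(* [K1] bounds the first summand in the numerator of [cutoffB], and [ebumpX_itv] bounds the second
   by 2, uniformly in [h]. *)
pose K := K1 + 2.
have K0 : 0 <= K by rewrite addr_ge0.
exists (pi * (K + 1) ^+ 2); first by rewrite mulr_ge0 ?pi_ge0 ?sqr_ge0.
move=> h Delta U W h0 hU hW.
have hK s : `|ebump 'X^3 (log_scale h s) + 2 * ebump (1 + 'X) (log_scale h s)| <= K.
  apply: (le_trans (ler_normD _ _)); apply: lerD.
    by apply: le_trans (hK1 _) _; rewrite expr0 mulr1.
  rewrite normrM ger0_norm//; have /andP[e0 e1] := ebumpX_itv (log_scale h s).
  by rewrite ger0_norm// ler_piMr.
rewrite energy_density.
have wU i j : is_weak_partial j (fun y => U y i 0) (weak_partial j (fun y => U y i 0)).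
  by have [_ /(_ j)[g [ig _]]] := hU i; exact: weak_partialP ig.
have wW i : is_weak_partial i W (weak_partial i W) /\ L2 (weak_partial i W).
  have [[_ /(_ i)[g [ig lg]]] _] := hW.
  by split; [exact: weak_partialP ig|exact: L2_weak_partial ig lg].
have wW2 i j : is_weak_partial j (weak_partial i W) (weak_partial j (weak_partial i W)) /\
    L2 (weak_partial j (weak_partial i W)).
  have [_ /(_ i)[_ /(_ j)[g [ig lg]]]] := hW.
  by split; [exact: weak_partialP ig|exact: L2_weak_partial ig lg].
have lo := density_integral_lower h0 Delta hK wU (fun i => (wW i).1) (fun i => (wW i).2)
  (fun i j => (wW2 i j).1) (fun i j => (wW2 i j).2).
apply: le_trans lo; rewrite lee_fin; apply: ler_wpM2l; first exact: sqr_ge0.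
rewrite lerD2r; apply: ler_wpM2l; last exact: cutoff0_ge.
by rewrite mulr_ge0 ?sqr_ge0// mulr_ge0 ?pi_ge0.
Qed.

End LowerBound.

(** * Upper bound *)

Section ClassicalEnergy.
Context {R : realType}.
Local Notation L := (@lebesgue_measure R).
Local Notation plane := (measurableTypeR R * measurableTypeR R)%type.
Local Notation mu := (L \x L)%E.
Implicit Types (f g : R * R -> R) (u d : 'I_2 -> 'I_2 -> R * R -> R) (w : 'I_2 -> R * R -> R).

Lemma plane_aeI (P Q : R * R -> Prop) :
  {ae mu, forall x, P x} -> {ae mu, forall x, Q x} -> {ae mu, forall x, P x /\ Q x}.
Proof. by move=> hP hQ; apply: (@filterI _ (almost_everywhere mu)). Qed.

Lemma plane_ae_ord2 (P : 'I_2 -> R * R -> Prop) :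
  (forall i, {ae mu, forall x, P i x}) -> {ae mu, forall x, forall i, P i x}.
Proof.
move=> h; apply: plane_aeS (plane_aeI (h 0) (h 1)) => x [h0 h1] i.
by have [->|->] := ord2_cases i.
Qed.

Lemma continuous_L2 f : continuous f -> L2 f.
Proof.
move=> cf; apply/L2P; have mD := @measurable_disc R; split.
  exact: measurable_funS (plane_continuous_measurable cf).
have c2 : continuous (fun x => f x ^+ 2) by move=> x; apply: cvgM; exact: cf.
have I := continuous_integrable_compact c2 (@compact_cbox R (-1) 1 (-1) 1).
apply: (integrableS _ _ _ I) => //.
- exact: measurable_cbox.
- move=> x; rewrite disc_sqnorm /= => hx.
  have := sqr_ge0 x.1; have := sqr_ge0 x.2 => h1 h2.
  by split; rewrite /= in_itv /= -ler_norml -(@ler_pXn2r _ 2)// ?nnegrE//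
    real_normK ?num_real// expr1n; lra.
Qed.

(** The Hessian in the energy differentiates the chosen representative [weak_partial i W], which
    agrees with the explicit derivative only almost everywhere. *)
Lemma weak_partial_congr f f' g i : is_weak_partial i f g -> locally_L1 f' ->
  {ae mu, forall x, @disc R x -> f' x = f x} -> is_weak_partial i f' g.
Proof.
move=> [lf lg fg] lf' ff; split=> // phi tphi; rewrite -fg// plane_measureE.
have mD := @measurable_disc R.
have mp : measurable_fun (@disc R) (partial i phi : plane -> measurableTypeR R).
  exact: measurable_funS (test_function_measurable (test_function_partial i tphi)).
apply: Rintegral_ae_eq => //.
- by apply: measurable_realfun.measurable_funM => //; exact: locally_L1_measurable.
- by apply: measurable_realfun.measurable_funM => //; exact: locally_L1_measurable.
- by apply: plane_aeS ff => x h Dx; rewrite h.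
Qed.

Lemma density_ae_eq h Delta u u' w w' d d' :
  (forall i j, measurable_fun (@disc R) (u i j : plane -> measurableTypeR R)) ->
  (forall i, measurable_fun (@disc R) (w i : plane -> measurableTypeR R)) ->
  (forall i j, measurable_fun (@disc R) (d i j : plane -> measurableTypeR R)) ->
  (forall i j, measurable_fun (@disc R) (u' i j : plane -> measurableTypeR R)) ->
  (forall i, measurable_fun (@disc R) (w' i : plane -> measurableTypeR R)) ->
  (forall i j, measurable_fun (@disc R) (d' i j : plane -> measurableTypeR R)) ->
  (forall i j, {ae mu, forall x, @disc R x -> u i j x = u' i j x}) ->
  (forall i, {ae mu, forall x, @disc R x -> w i x = w' i x}) ->
  (forall i j, {ae mu, forall x, @disc R x -> d i j x = d' i j x}) ->
  (\int[mu]_(x in @disc R) (density h Delta u w d x)%:E =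
   \int[mu]_(x in @disc R) (density h Delta u' w' d' x)%:E)%E.
Proof.
move=> mu_ mw md mu' mw' md' eu ew ed.
have mD := @measurable_disc R.
apply: ae_eq_integral => //.
- by apply/measurable_EFinP; exact: measurable_density.
- by apply/measurable_EFinP; exact: measurable_density.
have aeu := plane_ae_ord2 (fun i => plane_ae_ord2 (eu i)).
have aed := plane_ae_ord2 (fun i => plane_ae_ord2 (ed i)).
have aew := plane_ae_ord2 ew.
apply: plane_aeS (plane_aeI aeu (plane_aeI aed aew)) => x [hu [hd hw]] Dx.
by rewrite /density /sum_sqr /strain !hu// !hd// !hw.
Qed.

Section Fields.
Variables (U : R * R -> 'cV[R]_2) (W : R * R -> R).
Variables (U1 : 'I_2 -> 'I_2 -> R * R -> R) (W1 : 'I_2 -> R * R -> R)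
  (W2 : 'I_2 -> 'I_2 -> R * R -> R).
Hypothesis LU : forall i, L2 (fun x => U x i 0).
Hypothesis LW : L2 W.
Hypothesis LU1 : forall i j, L2 (U1 i j).
Hypothesis LW1 : forall i, L2 (W1 i).
Hypothesis LW2 : forall i j, L2 (W2 i j).
Hypothesis wU : forall i j, is_weak_partial j (fun x => U x i 0) (U1 i j).
Hypothesis wW : forall i, is_weak_partial i W (W1 i).
Hypothesis wW1 : forall i j, is_weak_partial j (W1 i) (W2 i j).

Lemma weak_partial2 i j : is_weak_partial j (weak_partial i W) (W2 i j).
Proof.
apply: (weak_partial_congr (wW1 i j)); last exact: weak_partial_ae.
by have [_ l _] := weak_partialP (wW i).
Qed.

Lemma fields_W12_vec : W12_vec U.
Proof. by move=> i; split=> // j; exists (U1 i j). Qed.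

Lemma fields_W22 : W22 W.
Proof.
split; first by split=> // i; exists (W1 i).
move=> i; split; first exact: L2_weak_partial (wW i) _.
by move=> j; exists (W2 i j); split=> //; exact: weak_partial2.
Qed.

Lemma energy_classical h Delta : energy_vK h Delta U W =
  (\int[mu]_(x in @disc R) (density h Delta U1 W1 W2 x)%:E)%E.
Proof.
have ml f : locally_L1 f -> measurable_fun (@disc R) (f : plane -> measurableTypeR R).
  exact: locally_L1_measurable.
have mw i f g : is_weak_partial i f g -> measurable_fun (@disc R) (g : plane -> measurableTypeR R) /\
    measurable_fun (@disc R) (weak_partial i f : plane -> measurableTypeR R).
  by move=> wf; have [_ lg _] := wf; have [_ lp _] := weak_partialP wf; split; exact: ml.
rewrite energy_density; apply: density_ae_eq.
- by move=> i j; exact: (mw _ _ _ (wU i j)).2.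
- by move=> i; exact: (mw _ _ _ (wW i)).2.
- by move=> i j; exact: (mw _ _ _ (weak_partial2 i j)).2.
- by move=> i j; exact: (mw _ _ _ (wU i j)).1.
- by move=> i; exact: (mw _ _ _ (wW i)).1.
- by move=> i j; exact: (mw _ _ _ (wW1 i j)).1.
- by move=> i j; exact: weak_partial_ae (wU i j).
- by move=> i; exact: weak_partial_ae (wW i).
- by move=> i j; exact: weak_partial_ae (weak_partial2 i j).
Qed.

End Fields.
End ClassicalEnergy.

(** * The regularised cones and their derivatives *)

Section ConeFields.
Context {R : realType}.
Variables (a h al be : R).
Hypothesis h_gt0 : 0 < h.
Implicit Types (x : R * R) (i j k : 'I_2).

(** A smooth substitute for 1/|x| at scale [h]. The cone itself corresponds to (al, be) = (1, 0),
    its rotation by pi / 4 to (0, 1). *)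
Definition rho x : R := (Num.sqrt (sqnorm x + h ^+ 2))^-1.

Lemma rho_sqr x : rho x ^+ 2 = (sqnorm x + h ^+ 2)^-1.
Proof. by rewrite exprVn sqr_sqrtr// ltW// reg_sqnorm_gt0. Qed.

Lemma elementary_rho : elementary rho.
Proof.
apply: (elementary_inv (f := fun x => Num.sqrt (sqnorm x + h ^+ 2))).
  by move=> x; rewrite sqrtr_gt0 reg_sqnorm_gt0.
apply: (elementary_sqrt (f := fun x => sqnorm x + h ^+ 2)); last exact: elementary_reg.
by move=> x; exact: reg_sqnorm_gt0.
Qed.

Lemma is_derive_rho i x : is_derive x (basis_vec R i) rho (- (coord i x * rho x ^+ 3)).
Proof.
have D0 := reg_sqnorm_gt0 h_gt0 x.
have d1 : is_derive x (basis_vec R i) (fun x => sqnorm x + h ^+ 2) (2 * coord i x).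
  by have d0 := is_derive_sqnorm i x; apply: is_derive_eq; rewrite addr0.
have d2 := is_derive_comp_line (phi := Num.sqrt) (is_derive1_sqrt D0) d1.
have d2' : is_derive x (basis_vec R i) (fun x => Num.sqrt (sqnorm x + h ^+ 2)) _ := d2.
have S0 : Num.sqrt (sqnorm x + h ^+ 2) != 0 by rewrite gt_eqF// sqrtr_gt0.
have d3 : is_derive (Num.sqrt (sqnorm x + h ^+ 2)) (1 : R) (fun t : R => t^-1)
    (- (Num.sqrt (sqnorm x + h ^+ 2)) ^- 2).
  have := @is_deriveV R id (Num.sqrt (sqnorm x + h ^+ 2)) 1 1 S0 _.
  by move=> /(_ _)/is_derive_eq; apply; rewrite /GRing.scale /= mulr1.
have := is_derive_comp_line d3 d2'.
by move=> /is_derive_eq; apply; rewrite /rho; field.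
Qed.

(* [pu] and [pv] are |x|^2 cos and |x|^2 sin of twice the angle from a fixed
   direction. *)
Definition pu x : R := al * (coord 0 x * coord 0 x - coord 1 x * coord 1 x)
  + be * (2 * (coord 0 x * coord 1 x)).
Definition pv x : R := al * (2 * (coord 0 x * coord 1 x))
  - be * (coord 0 x * coord 0 x - coord 1 x * coord 1 x).
Definition dpu i x : R := if i == 0 then 2 * (al * coord 0 x + be * coord 1 x)
  else 2 * (be * coord 0 x - al * coord 1 x).
Definition dpv i x : R := if i == 0 then 2 * (al * coord 1 x - be * coord 0 x)
  else 2 * (al * coord 0 x + be * coord 1 x).
Definition ddpu i j : R := if i == 0 then (if j == 0 then 2 * al else 2 * be)
  else (if j == 0 then 2 * be else - 2 * al).
(** The components of |x| times [hat_perp]. *)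
Definition nrm k x : R := if k == 0 then - coord 1 x else coord 0 x.
Definition dnrm k i : R := if k == 0 then - (1 == i)%:R else (0 == i)%:R.

Lemma is_derive_pu i x : is_derive x (basis_vec R i) pu (dpu i x).
Proof.
have d0 := is_derive_coord 0 i x; have d1 := is_derive_coord 1 i x.
rewrite /pu /dpu; apply: is_derive_eq; rewrite /GRing.scale /=.
by have [->|->] := ord2_cases i; rewrite /=; ring.
Qed.

Lemma is_derive_pv i x : is_derive x (basis_vec R i) pv (dpv i x).
Proof.
have d0 := is_derive_coord 0 i x; have d1 := is_derive_coord 1 i x.
rewrite /pv /dpv; apply: is_derive_eq; rewrite /GRing.scale /=.
by have [->|->] := ord2_cases i; rewrite /=; ring.
Qed.

Lemma is_derive_dpu i j x : is_derive x (basis_vec R j) (dpu i) (ddpu i j).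
Proof.
have d0 := is_derive_coord 0 j x; have d1 := is_derive_coord 1 j x.
have [->|->] := ord2_cases i; rewrite /dpu /ddpu /=; apply: is_derive_eq; rewrite /GRing.scale /=;
  by have [->|->] := ord2_cases j; rewrite /=; ring.
Qed.

Lemma is_derive_nrm k i x : is_derive x (basis_vec R i) (nrm k) (dnrm k i).
Proof.
have d0 := is_derive_coord 0 i x; have d1 := is_derive_coord 1 i x.
have [->|->] := ord2_cases k; [exact: (is_deriveN d1)|exact: d0].
Qed.

Definition cone_W x : R := a * (pu x * rho x).
Definition cone_W1 i x : R := a * (dpu i x * rho x - pu x * coord i x * rho x ^+ 3).
Definition cone_W2 i j x : R := a * (ddpu i j * rho x
  - (dpu i x * coord j x + dpu j x * coord i x + (i == j)%:R * pu x) * rho x ^+ 3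
  + 3 * (pu x * coord i x * coord j x) * rho x ^+ 5).
(* The displacement that cancels the strain of [cone_W] when [h = 0]. *)
Definition cone_V k x : R := - (a ^+ 2 / 2) * (pu x * pu x * coord k x)
  + 5 * a ^+ 2 / 8 * (pu x * pv x * nrm k x).
(** The power of [rho] makes the field homogeneous of degree one when h = 0. With f = a cos 2 theta
    the radial part is - r f^2 / 2; the tangential part r g has g' = (5/4) a^2 cos 4 theta, hence g
    = (5/8) a^2 cos 2 theta sin 2 theta. *)
Definition cone_U k x : R := cone_V k x * rho x ^+ 4.
Definition cone_U1 k i x : R :=
  (- (a ^+ 2 / 2) * (2 * (pu x * dpu i x * coord k x) + (k == i)%:R * (pu x * pu x))
   + 5 * a ^+ 2 / 8 * ((dpu i x * pv x + pu x * dpv i x) * nrm k x + pu x * pv x * dnrm k i))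
  * rho x ^+ 4 - 4 * (cone_V k x * coord i x * rho x ^+ 6).

Lemma is_derive_cone_W i x : is_derive x (basis_vec R i) cone_W (cone_W1 i x).
Proof.
have d1 := is_derive_pu i x; have d2 := is_derive_rho i x.
rewrite /cone_W /cone_W1; apply: is_derive_eq; rewrite /GRing.scale /=.
move: (pu x) (dpu i x) (rho x) (coord i x) => *; ring.
Qed.

Lemma is_derive_cone_W1 i j x : is_derive x (basis_vec R j) (cone_W1 i) (cone_W2 i j x).
Proof.
have d1 := is_derive_pu j x; have d2 := is_derive_rho j x; have d3 := is_derive_dpu i j x.
have d4 := is_derive_coord i j x.
rewrite /cone_W1 /cone_W2; apply: is_derive_eq; rewrite /GRing.scale /=.
move: (pu x) (dpu i x) (dpu j x) (rho x) (coord i x) (coord j x) (ddpu i j) => *; ring.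
Qed.

Lemma is_derive_cone_U k i x : is_derive x (basis_vec R i) (cone_U k) (cone_U1 k i x).
Proof.
have d1 := is_derive_pu i x; have d2 := is_derive_rho i x; have d3 := is_derive_pv i x.
have d4 := is_derive_coord k i x; have d5 := is_derive_nrm k i x.
rewrite /cone_U1 /cone_U /cone_V; apply: is_derive_eq; rewrite /GRing.scale /=.
move: (pu x) (dpu i x) (pv x) (dpv i x) (rho x) (coord i x) (coord k x) (nrm k x) (dnrm k i).
by move=> *; field.
Qed.

Lemma elementary_coord i : elementary (coord i : R * R -> R).
Proof.
by have [->|->] := ord2_cases i; [exact: elementary_fst|exact: elementary_snd].
Qed.

Lemma elementary_nrm k : elementary (nrm k).
Proof.
have [->|->] := ord2_cases k; last exact: (elementary_coord 0).
exact: (elementary_opp (elementary_coord 1)).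
Qed.

Lemma elementary_pu : elementary pu.
Proof.
rewrite /pu; repeat first [exact: elementary_cst|exact: elementary_coord|apply: elementary_sub
  |apply: elementary_add|apply: elementary_mul].
Qed.

Lemma elementary_pv : elementary pv.
Proof.
rewrite /pv; repeat first [exact: elementary_cst|exact: elementary_coord|apply: elementary_sub
  |apply: elementary_add|apply: elementary_mul].
Qed.

Lemma elementary_cone_W : elementary cone_W.
Proof.
apply: elementary_mul; first exact: elementary_cst.
by apply: elementary_mul; [exact: elementary_pu|exact: elementary_rho].
Qed.

Lemma elementary_cone_U k : elementary (cone_U k).
Proof.
have eu := elementary_pu; have ev := elementary_pv.
apply: elementary_mul; last by apply: elementary_exp; exact: elementary_rho.
apply: elementary_add; apply: elementary_mul; do ?exact: elementary_cst.
  by apply: elementary_mul; [exact: elementary_mul|exact: elementary_coord].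
by apply: elementary_mul; [exact: elementary_mul|exact: elementary_nrm].
Qed.

Lemma elementary_classical (f f' : R * R -> R) i : elementary f ->
  (forall x, is_derive x (basis_vec R i) f (f' x)) ->
  [/\ elementary f', is_weak_partial i f f' & L2 f'].
Proof.
move=> ef df; have E : f' = partial i f by apply/funext => x; have [_] := df x.
have ef' : elementary f' by rewrite E; exact: elementary_partial.
have cf' := elementary_continuous ef'.
split=> //; last exact: continuous_L2.
by apply: classical_weak_partial => //; exact: elementary_continuous.
Qed.

Definition cone_Uvec x : 'cV[R]_2 := \col_k cone_U k x.

Lemma cone_fields Delta : [/\ W12_vec cone_Uvec, W22 cone_W &
  energy_vK h Delta cone_Uvec cone_W =
  (\int[(lebesgue_measure \x lebesgue_measure)%E]_(x in @disc R)
    (density h Delta cone_U1 cone_W1 cone_W2 x)%:E)%E].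
Proof.
have UE i : (fun x => cone_Uvec x i 0) = cone_U i by apply/funext => x; rewrite mxE.
have cU i j := elementary_classical (elementary_cone_U i) (is_derive_cone_U i j).
have cW i := elementary_classical elementary_cone_W (is_derive_cone_W i).
have cW1 i j : [/\ elementary (cone_W2 i j), is_weak_partial j (cone_W1 i) (cone_W2 i j) & L2 (cone_W2 i j)].
  by apply: elementary_classical (is_derive_cone_W1 i j); have [] := cW i.
have wU i j : is_weak_partial j (fun x => cone_Uvec x i 0) (cone_U1 i j).
  by rewrite UE; have [] := cU i j.
have LU i : L2 (fun x => cone_Uvec x i 0).
  rewrite UE; apply: continuous_L2; apply: elementary_continuous; exact: elementary_cone_U.
have LW : L2 cone_W.
  by apply: continuous_L2; apply: elementary_continuous; exact: elementary_cone_W.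
have LU1 i j : L2 (cone_U1 i j) by have [] := cU i j.
have LW1 i : L2 (cone_W1 i) by have [] := cW i.
have wW i : is_weak_partial i cone_W (cone_W1 i) by have [] := cW i.
have LW2 i j : L2 (cone_W2 i j) by have [] := cW1 i j.
have wW1 i j : is_weak_partial j (cone_W1 i) (cone_W2 i j) by have [] := cW1 i j.
split.
- exact: fields_W12_vec LU LU1 wU.
- exact: fields_W22 LW LW1 LW2 wW wW1.
- exact: energy_classical wU wW wW1 h Delta.
Qed.

End ConeFields.

(** * Strain and bending of the two cones *)

Section UpperBound.
Context {R : realType}.
Local Notation L := (@lebesgue_measure R).
Local Notation plane := (measurableTypeR R * measurableTypeR R)%type.
Local Notation mu := (L \x L)%E.

(** Each monomial is at most 1 on the unit disc. These eight are the ones that occur in the residual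
    strain, as a polynomial in X = x_1 rho and Y = x_2 rho. *)
Lemma quartic_bound (X Y c1 c2 c3 c4 c5 c6 c7 c8 : R) : X ^+ 2 + Y ^+ 2 <= 1 ->
  `|c1 * (X ^+ 2 * X ^+ 2) + c2 * (X ^+ 2 * Y ^+ 2) + c3 * (Y ^+ 2 * Y ^+ 2) + c4 * X ^+ 2
    + c5 * Y ^+ 2 + c6 * (X * Y) + c7 * (X ^+ 2 * (X * Y)) + c8 * (Y ^+ 2 * (X * Y))|
  <= `|c1| + `|c2| + `|c3| + `|c4| + `|c5| + `|c6| + `|c7| + `|c8|.
Proof.
move=> XY; have X0 := sqr_ge0 X; have Y0 := sqr_ge0 Y.
have nX : `|X ^+ 2| <= 1 by rewrite ger0_norm//; lra.
have nY : `|Y ^+ 2| <= 1 by rewrite ger0_norm//; lra.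
have nXY : `|X * Y| <= 1.
  by rewrite ler_norml; have := sqr_ge0 (X - Y); have := sqr_ge0 (X + Y);
    rewrite sqrrD sqrrB; move: XY; lra.
have m (u v : R) : `|u| <= 1 -> `|v| <= 1 -> `|u * v| <= 1.
  by move=> u1 v1; rewrite normrM mulr_ile1.
have t (c u : R) : `|u| <= 1 -> `|c * u| <= `|c| by move=> u1; rewrite normrM ler_piMr.
do 7! [apply: (le_trans (ler_normD _ _)); apply: lerD; last by apply: t => //; apply: m].
by apply: t; apply: m.
Qed.

Variables (a h Delta : R).
Hypothesis h_gt0 : 0 < h.
Hypothesis aE : Delta ^+ 2 = 3 / 2 * a ^+ 2.
Local Notation eps x := (h ^+ 2 * rho h x ^+ 2).

Lemma eps_ge0 x : 0 <= eps x.
Proof. by rewrite mulr_ge0 ?sqr_ge0. Qed.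

Lemma eps_eq x : eps x = 1 - ((coord 0 x * rho h x) ^+ 2 + (coord 1 x * rho h x) ^+ 2).
Proof.
have D0 := reg_sqnorm_gt0 h_gt0 x.
have e : rho h x ^+ 2 * (sqnorm x + h ^+ 2) = 1 by rewrite rho_sqr// mulVf// gt_eqF.
have -> : eps x = rho h x ^+ 2 * (sqnorm x + h ^+ 2) - rho h x ^+ 2 * sqnorm x by ring.
by rewrite e /sqnorm /coord /=; ring.
Qed.

(** Away from the origin [nrm] is |x| times [hat_perp], and |x|^2 rho^2 - 1 = - eps; at the origin
    both products vanish. *)
Lemma hat_perp_close i j x :
  `|nrm i x * nrm j x * rho h x ^+ 2 - hat_perp x i 0 * hat_perp x j 0| <= eps x.
Proof.
have D0 := reg_sqnorm_gt0 h_gt0 x.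
have hE k : hat_perp x k 0 = nrm k x / euclid x.
  by have [->|->] := ord2_cases k; rewrite /nrm /coord /=; [exact: (hat_perpE x).1|exact: (hat_perpE x).2].
rewrite !hE; have [s0|s0] := eqVneq (sqnorm x) 0.
  have [x1 x2] := sqnorm_eq0 s0.
  have n0 k : nrm k x = 0 by have [->|->] := ord2_cases k; rewrite /nrm /coord /= ?x1 ?x2 ?oppr0.
  by rewrite !n0 !mul0r subr0 normr0 eps_ge0.
have Es := euclid_sqr x.
have E0 : euclid x != 0 by rewrite -sqrf_eq0 Es.
have -> : nrm i x * nrm j x * rho h x ^+ 2 - nrm i x / euclid x * (nrm j x / euclid x) =
    - (nrm i x * nrm j x / sqnorm x) * eps x.
  rewrite rho_sqr// -Es; move: (nrm i x) (nrm j x) => u v; rewrite -Es in D0 *.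
  by field; rewrite E0 gt_eqF.
rewrite normrM [`|eps x|]ger0_norm ?eps_ge0//; apply: ler_piMl; first exact: eps_ge0.
have sp : 0 < sqnorm x by rewrite lt0r s0 sqnorm_ge0.
rewrite normrN normrM normfV [`|sqnorm x|]gtr0_norm// ler_pdivrMr// mul1r.
rewrite ler_norml /sqnorm /nrm /coord.
have := sqr_ge0 (x.1 - x.2); have := sqr_ge0 (x.1 + x.2); have := sqr_ge0 x.1; have := sqr_ge0 x.2.
by have [->|->] := ord2_cases i; have [->|->] := ord2_cases j => /=;
  rewrite sqrrD sqrrB => *; apply/andP; split; lra.
Qed.

Definition smooth_strain al be i j x : R :=
  cone_U1 a h al be i j x + cone_U1 a h al be j i x + cone_W1 a h al be i x * cone_W1 a h al be j x
  - Delta ^+ 2 * (nrm i x * nrm j x * rho h x ^+ 2).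

Local Ltac strain_coefficients := first
  [ by rewrite ?normrN !ger0_norm//; lra
  | rewrite /smooth_strain aE /cone_U1 /cone_W1 /cone_V /dpu /dpv /dnrm /nrm /pu /pv /coord /=;
    by field ].

(* The homogeneous cone [h = 0] has no strain, hence the factor
   [eps x = h ^ 2 / (|x| ^ 2 + h ^ 2)]. *)
Lemma smooth_strain_le al be i j x : (al = 1 /\ be = 0) \/ (al = 0 /\ be = 1) ->
  `|smooth_strain al be i j x| <= 16 * a ^+ 2 * eps x.
Proof.
move=> ab.
pose X := coord 0 x * rho h x; pose Y := coord 1 x * rho h x.
have XY1 : X ^+ 2 + Y ^+ 2 <= 1.
  by have := eps_ge0 x; rewrite eps_eq -/X -/Y; lra.
suff [q [-> hq]] : exists q, smooth_strain al be i j x = a ^+ 2 * ((1 - (X ^+ 2 + Y ^+ 2)) * q) /\ `|q| <= 16.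
  rewrite -eps_eq normrM [`|a ^+ 2|]ger0_norm ?sqr_ge0// normrM [`|eps x|]ger0_norm ?eps_ge0//.
  rewrite -mulrA [leRHS]mulrCA; apply: ler_wpM2l; first exact: sqr_ge0.
  by rewrite [leRHS]mulrC; apply: ler_wpM2l => //; exact: eps_ge0.
have quart c1 c2 c3 c4 c5 c6 c7 c8 := @quartic_bound X Y c1 c2 c3 c4 c5 c6 c7 c8 XY1.
have fin (c1 c2 c3 c4 c5 c6 c7 c8 : R) : `|c1| + `|c2| + `|c3| + `|c4| + `|c5| + `|c6| + `|c7| + `|c8| <= 16 ->
    smooth_strain al be i j x = a ^+ 2 * ((1 - (X ^+ 2 + Y ^+ 2)) *
      (c1 * (X ^+ 2 * X ^+ 2) + c2 * (X ^+ 2 * Y ^+ 2) + c3 * (Y ^+ 2 * Y ^+ 2) + c4 * X ^+ 2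
    + c5 * Y ^+ 2 + c6 * (X * Y) + c7 * (X ^+ 2 * (X * Y)) + c8 * (Y ^+ 2 * (X * Y)))) ->
    exists q, smooth_strain al be i j x = a ^+ 2 * ((1 - (X ^+ 2 + Y ^+ 2)) * q) /\ `|q| <= 16.
  by move=> c16 e; eexists; split; [exact: e|exact: le_trans (quart _ _ _ _ _ _ _ _) c16].
move: fin; case: ab => -[-> ->]; have [->|->] := ord2_cases i;
  have [->|->] := ord2_cases j => fin; rewrite /X /Y in fin *.
(* The numbers are the coefficients of the strain divided by a^2 (1 - X^2 - Y^2); in each case their
   absolute values add up to at most 31/2, whence the constant 16. *)
- apply: (fin (-5) 5 0 4 (- (3 / 2)) 0 0 0); strain_coefficients.
- apply: (fin 0 0 0 0 0 (- (5 / 2)) 0 0); strain_coefficients.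
- apply: (fin 0 0 0 0 0 (- (5 / 2)) 0 0); strain_coefficients.
- apply: (fin 0 5 (-5) (- (3 / 2)) 4 0 0 0); strain_coefficients.
- apply: (fin 0 (-10) 0 0 (5 / 2) 0 0 0); strain_coefficients.
- apply: (fin 0 0 0 0 0 (11 / 2) (-5) (-5)); strain_coefficients.
- apply: (fin 0 0 0 0 0 (11 / 2) (-5) (-5)); strain_coefficients.
- apply: (fin 0 (-10) 0 (5 / 2) 0 0 0 0); strain_coefficients.
Qed.

(** The constant is 16 from [smooth_strain_le], plus Delta^2 = 3 a^2 / 2 <= 2 a^2 from replacing
    [nrm * rho] by [hat_perp]. *)
Lemma strain_le al be i j x : (al = 1 /\ be = 0) \/ (al = 0 /\ be = 1) ->
  strain Delta (cone_U1 a h al be) (cone_W1 a h al be) i j x ^+ 2 <= (18 * a ^+ 2 * eps x) ^+ 2.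
Proof.
move=> ab; have h1 := smooth_strain_le i j x ab; have h2 := hat_perp_close i j x.
have a2 := sqr_ge0 a; have e0 := eps_ge0 x.
rewrite -[leLHS]real_normK ?num_real//; apply: lerXn2r; rewrite ?nnegrE//.
  by rewrite mulr_ge0// mulr_ge0.
have -> : strain Delta (cone_U1 a h al be) (cone_W1 a h al be) i j x =
   smooth_strain al be i j x + Delta ^+ 2 *
     (nrm i x * nrm j x * rho h x ^+ 2 - hat_perp x i 0 * hat_perp x j 0).
  by rewrite /strain /smooth_strain; ring.
apply: (le_trans (ler_normD _ _)).
have -> : 18 * a ^+ 2 * eps x = 16 * a ^+ 2 * eps x + 2 * a ^+ 2 * eps x by ring.
apply: lerD => //; rewrite normrM [`|Delta ^+ 2|]ger0_norm ?sqr_ge0// aE.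
apply: ler_pM => //; last by lra.
by rewrite mulr_ge0// divr_ge0.
Qed.

(** Up to the factor a^2 rho^2 the sum over both cones is a polynomial in t = X^2 + Y^2 = 1 - eps
    alone. Its value at t = 1 is the 9 of the homogeneous cones, and the deviation is divisible by 1
    - t; with 28 the remaining cubic factor is nonnegative on [0, 1]. *)
Lemma sum_hessian_le x :
  sum_sqr (cone_W2 a h 1 0) x + sum_sqr (cone_W2 a h 0 1) x <=
  a ^+ 2 * rho h x ^+ 2 * (9 + 28 * eps x).
Proof.
pose X := coord 0 x * rho h x; pose Y := coord 1 x * rho h x.
pose t := X ^+ 2 + Y ^+ 2.
have t0 : 0 <= t by rewrite addr_ge0 ?sqr_ge0.
have et : eps x = 1 - t by rewrite eps_eq.
have t1 : t <= 1 by have := eps_ge0 x; rewrite et; lra.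
have -> : sum_sqr (cone_W2 a h 1 0) x + sum_sqr (cone_W2 a h 0 1) x =
    a ^+ 2 * rho h x ^+ 2 * (9 * t ^+ 4 - 30 * t ^+ 3 + 46 * t ^+ 2 - 32 * t + 16).
  rewrite /sum_sqr /cone_W2 /ddpu /dpu /pu /t /X /Y /coord /=; ring.
apply: ler_wpM2l; first by rewrite mulr_ge0 ?sqr_ge0.
rewrite et -subr_ge0.
have -> : 9 + 28 * (1 - t) - (9 * t ^+ 4 - 30 * t ^+ 3 + 46 * t ^+ 2 - 32 * t + 16) =
  (1 - t) * (21 + 25 * t - 21 * t ^+ 2 + 9 * t ^+ 3) by ring.
apply: mulr_ge0; first by lra.
have t2 : 0 <= t ^+ 2 by rewrite sqr_ge0.
have t3 : 0 <= t ^+ 3 by rewrite exprn_ge0.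
have : t ^+ 2 <= t by rewrite expr2 ler_piMr.
lra.
Qed.

Definition cone_density al be : R * R -> R :=
  density h Delta (cone_U1 a h al be) (cone_W1 a h al be) (cone_W2 a h al be).

(** Eight strain entries, four for each cone, give 18^2 a^4 eps^2 each. The correction to the
    Hessian is of the same type, as h^2 rho^2 eps = eps^2. *)
Lemma cone_density_le x : cone_density 1 0 x + cone_density 0 1 x <=
  (8 * 18 ^+ 2 * a ^+ 4 + 28 * a ^+ 2) * h ^+ 4 * (sqnorm x + h ^+ 2) ^- 2
  + 9 * a ^+ 2 * h ^+ 2 * (sqnorm x + h ^+ 2)^-1.
Proof.
have s1 i j := @strain_le 1 0 i j x (or_introl (conj erefl erefl)).
have s2 i j := @strain_le 0 1 i j x (or_intror (conj erefl erefl)).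
have hh := ler_wpM2l (sqr_ge0 h) (sum_hessian_le x).
have L1 := lerD (lerD (s1 0 0) (s1 0 1)) (lerD (s1 1 0) (s1 1 1)).
have L2 := lerD (lerD (s2 0 0) (s2 0 1)) (lerD (s2 1 0) (s2 1 1)).
have := lerD (lerD L1 L2) hh.
have -> : (8 * 18 ^+ 2 * a ^+ 4 + 28 * a ^+ 2) * h ^+ 4 * (sqnorm x + h ^+ 2) ^- 2
  + 9 * a ^+ 2 * h ^+ 2 * (sqnorm x + h ^+ 2)^-1 =
  (8 * 18 ^+ 2 * a ^+ 4 + 28 * a ^+ 2) * h ^+ 4 * (rho h x ^+ 2) ^+ 2 + 9 * a ^+ 2 * h ^+ 2 * rho h x ^+ 2.
  by rewrite rho_sqr// exprVn.
rewrite /cone_density /density => H; apply: le_trans (le_trans _ H) _.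
  by rewrite /sum_sqr le_eqVlt; apply/orP; left; apply/eqP; ring.
by rewrite le_eqVlt; apply/orP; left; apply/eqP; ring.
Qed.

Lemma cone_density_measurable al be :
  measurable_fun (@disc R) (cone_density al be : plane -> measurableTypeR R).
Proof.
have ms f : elementary f -> measurable_fun (@disc R) (f : plane -> measurableTypeR R).
  by move=> ef; apply: measurable_funS (elementary_measurable ef).
have cW i := elementary_classical (elementary_cone_W a al be h_gt0) (is_derive_cone_W a al be h_gt0 i).
apply: measurable_density => [i j|i|i j]; apply: ms.
- by have [] := elementary_classical (elementary_cone_U a al be h_gt0 i)
    (is_derive_cone_U a al be h_gt0 i j).
- by have [] := cW i.
- have [e _ _] := cW i.
  by have [] := elementary_classical e (is_derive_cone_W1 a al be h_gt0 i j).
Qed.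

Lemma cone_density_ge0 al be x : 0 <= cone_density al be x.
Proof. exact: density_ge0. Qed.

(** In s = |x|^2 the term 1/(s + h^2) integrates to ln(1 + h^2) - ln(h^2) <= ln 2 - 2 ln h, while
    h^4/(s + h^2)^2 integrates to at most h^2: only bending carries the logarithm. *)
Lemma cone_energy_sum : h < 1 ->
  (\int[mu]_(x in @disc R) (cone_density 1 0 x)%:E +
   \int[mu]_(x in @disc R) (cone_density 0 1 x)%:E <=
   (pi * h ^+ 2 * (8 * 18 ^+ 2 * a ^+ 4 + 28 * a ^+ 2 + 9 * a ^+ 2 * (ln 2 - 2 * ln h)))%:E)%E.
Proof.
move=> h1; have mD := @measurable_disc R.
have m1 := cone_density_measurable 1 0; have m2 := cone_density_measurable 0 1.
have dle := cone_density_le.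
set K := 8 * 18 ^+ 2 * a ^+ 4 + 28 * a ^+ 2 in dle *.
have K0 : 0 <= K.
  have a4 : 0 <= a ^+ 4 by rewrite -[4%N]/(2 * 2)%N exprM sqr_ge0.
  by apply: addr_ge0; apply: mulr_ge0; rewrite ?sqr_ge0// mulr_ge0// sqr_ge0.
clearbody K.
have a2 := sqr_ge0 a; have h2 : 0 < h ^+ 2 by rewrite exprn_gt0.
pose f (t : R) := K * h ^+ 4 * (t + h ^+ 2) ^- 2 + 9 * a ^+ 2 * h ^+ 2 * (t + h ^+ 2)^-1.
pose F (t : R) := 9 * a ^+ 2 * h ^+ 2 * ln (t + h ^+ 2) - K * h ^+ 4 * (t + h ^+ 2)^-1.
have d1 (t : R) : is_derive t (1 : R) (fun t => t + h ^+ 2) 1.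
  by apply: is_derive_eq; rewrite addr0.
have dF (t : R) : 0 <= t <= 1 -> is_derive t (1 : R) F (f t).
  move=> /andP[t0 _]; have p := reg_gt0 h_gt0 t0.
  have pn : t + h ^+ 2 != 0 by rewrite gt_eqF.
  have d2 := @is_deriveV R (fun t => t + h ^+ 2) t 1 1 pn (d1 t).
  have d3 := @is_derive1_comp R (@ln R) (fun t => t + h ^+ 2) t _ _ (is_derive1_ln p) (d1 t).
  have d3' : is_derive t (1 : R) (fun t => ln (t + h ^+ 2)) ((t + h ^+ 2)^-1 * 1) := d3.
  by rewrite /F /f; apply: is_derive_eq; rewrite /GRing.scale /=; field.
have cf (t : R) : 0 <= t <= 1 -> {for t, continuous f}.
  move=> /andP[t0 _]; have pn : t + h ^+ 2 != 0 by rewrite gt_eqF ?reg_gt0.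
  have cd : {for t, continuous (fun t => t + h ^+ 2)}.
    by apply: cvgD; [exact: cvg_id|exact: cvg_cst].
  apply: cvgD; apply: cvgM; do ?exact: cvg_cst; apply: cvgV => //.
    by rewrite expf_neq0.
  by apply: cvgM; exact: cd.
have hM (t : R) : 0 <= t <= 1 -> `|f t| <= K + 9 * a ^+ 2.
  move=> /andP[t0 _]; have p := reg_gt0 h_gt0 t0.
  pose q := h ^+ 2 / (t + h ^+ 2).
  have q0 : 0 <= q by rewrite divr_ge0// ltW.
  have q1 : q <= 1 by rewrite ler_pdivrMr// mul1r lerDr.
  have -> : f t = K * q ^+ 2 + 9 * a ^+ 2 * q by rewrite /f /q; field; rewrite gt_eqF.
  have a9 : 0 <= 9 * a ^+ 2 by rewrite mulr_ge0.
  have p1 := mulr_ge0 K0 (sqr_ge0 q); have p2 := mulr_ge0 a9 q0.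
  rewrite ger0_norm; last exact: addr_ge0.
  apply: lerD; last by rewrite ler_piMr.
  by rewrite ler_piMr// expr_le1.
have [I E] := disc_radial hM dF cf.
rewrite -ge0_integralD//; last 4 first.
- by move=> x _; rewrite lee_fin cone_density_ge0.
- exact/measurable_EFinP.
- by move=> x _; rewrite lee_fin cone_density_ge0.
- exact/measurable_EFinP.
apply: (@le_trans _ _ (\int[mu]_(x in @disc R) (f (sqnorm x))%:E)%E).
  apply: ge0_le_integral => //.
  - by move=> x _; rewrite -EFinD lee_fin addr_ge0// cone_density_ge0.
  - by apply: emeasurable_funD; exact/measurable_EFinP.
  - exact: measurable_int I.
  - by move=> x _; rewrite -EFinD lee_fin; exact: dle.
have -> : (\int[mu]_(x in @disc R) (f (sqnorm x))%:E = (\int[mu]_(x in @disc R) f (sqnorm x))%:E)%E.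
  by rewrite /Rintegral fineK//; exact: integrable_fin_num.
rewrite lee_fin E -mulrA; apply: ler_wpM2l; first exact: pi_ge0.
rewrite /F add0r.
have hh : K * h ^+ 4 * (h ^+ 2)^-1 = K * h ^+ 2 by field; rewrite gt_eqF.
have i1 : 0 <= K * h ^+ 4 * (1 + h ^+ 2)^-1.
  by rewrite mulr_ge0 ?mulr_ge0 ?exprn_ge0 ?invr_ge0 ?(ltW h_gt0)// addr_ge0// ltW.
have l2 : ln (1 + h ^+ 2) <= ln 2.
  rewrite ler_ln ?posrE//; last by rewrite addr_gt0.
  have : h ^+ 2 <= 1 by rewrite expr_le1// ltW.
  lra.
have lh : ln (h ^+ 2) = 2 * ln h by rewrite lnXn// mulr_natl.
have a9 : 0 <= 9 * a ^+ 2 * h ^+ 2 by rewrite mulr_ge0 ?(ltW h2)// mulr_ge0.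
have := ler_wpM2l a9 l2.
rewrite hh lh; lra.
Qed.

End UpperBound.

Section InfEnergy.
Context {R : realType}.

(** Twice the infimum is at most the sum of the two cone energies. With a^2 = 2 Delta^2 / 3, half of
    8 * 18^2 a^4 is 24^2 Delta^4, and half of 9 a^2 is 3 Delta^2. *)
Lemma inf_energy_upper (h Delta : R) : 0 < h -> h < 1 ->
  (inf_energy_vK h Delta <= (6 * pi * Delta ^+ 2 * h ^+ 2 * - ln h
    + pi * h ^+ 2 * (24 ^+ 2 * Delta ^+ 4 + 10 * Delta ^+ 2 + 3 * Delta ^+ 2 * ln 2))%:E)%E.
Proof.
move=> h0 h1.
pose a := Delta * Num.sqrt (2 / 3).
have a2 : a ^+ 2 = 2 / 3 * Delta ^+ 2.
  by rewrite exprMn sqr_sqrtr ?divr_ge0// mulrC.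
have aE : Delta ^+ 2 = 3 / 2 * a ^+ 2 by rewrite a2; field.
have a4 : a ^+ 4 = 4 / 9 * Delta ^+ 4.
  have -> : a ^+ 4 = (a ^+ 2) ^+ 2 by ring.
  by rewrite a2; field.
have S := cone_energy_sum h0 aE h1.
have [U1 W1 E1] := cone_fields a 1 0 h0 Delta; have [U2 W2 E2] := cone_fields a 0 1 h0 Delta.
have i1 : (inf_energy_vK h Delta <= energy_vK h Delta (cone_Uvec a h 1 0) (cone_W a h 1 0))%E.
  apply: ereal_inf_lbound; exact: (ex_intro _ _ (ex_intro _ _ (And3 U1 W1 erefl))).
have i2 : (inf_energy_vK h Delta <= energy_vK h Delta (cone_Uvec a h 0 1) (cone_W a h 0 1))%E.
  apply: ereal_inf_lbound; exact: (ex_intro _ _ (ex_intro _ _ (And3 U2 W2 erefl))).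
rewrite E1 in i1; rewrite E2 in i2.
have := le_trans (leeD i1 i2) S.
case: (inf_energy_vK h Delta) => [r||]; last by move=> _; rewrite leNye.
  rewrite -EFinD !lee_fin a4 a2 => hr.
  (* 56/3 is rounded up to 20, half of which is the 10 of the statement. *)
  have : pi * h ^+ 2 * (28 * (2 / 3 * Delta ^+ 2)) <= pi * h ^+ 2 * (20 * Delta ^+ 2).
    by apply: ler_wpM2l; [rewrite mulr_ge0 ?pi_ge0 ?sqr_ge0|have := sqr_ge0 Delta; lra].
  lra.
by [].
Qed.

End InfEnergy.

Unset Implicit Arguments.
Theorem theorem2p1 (R : realType) (Delta : R) (Delta_gt0 : 0 < Delta) :
  exists C h0 : R,
    [/\ 0 < C, 0 < h0 &
      forall h : R, 0 < h -> h < h0 ->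
        ((2 * pi * Delta ^+ 2 * h ^+ 2
            * (ln h^-1 - 2 * ln (ln h^-1) - C))%:E <= inf_energy_vK h Delta)%E /\
        (inf_energy_vK h Delta
          <= (6 * pi * Delta ^+ 2 * h ^+ 2 * (ln h^-1 + C))%:E)%E].
Proof.
have [C1 C10 lower] := @energy_lower R.
have D2 : 0 < Delta ^+ 2 by rewrite exprn_gt0.
have pi0 := @pi_gt0 R.
have dn : Delta != 0 by rewrite gt_eqF.
have pn : pi != 0 :> R by rewrite gt_eqF.
have ln20 : 0 <= ln 2 :> R by rewrite ln_ge0// ler1n.
pose K := 24 ^+ 2 * Delta ^+ 4 + 10 * Delta ^+ 2 + 3 * Delta ^+ 2 * ln 2.
have K0 : 0 <= K.
  by apply: addr_ge0; [apply: addr_ge0|]; apply: mulr_ge0; rewrite ?exprn_ge0// ?mulr_ge0// ltW.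
pose c1 := C1 / (2 * pi * Delta ^+ 2).
pose c2 := K / (6 * Delta ^+ 2).
have c10 : 0 <= c1 by rewrite divr_ge0// ltW// !mulr_gt0.
have c20 : 0 <= c2 by rewrite divr_ge0// ltW// !mulr_gt0.
have Ec1 : 2 * pi * Delta ^+ 2 * c1 = C1 by rewrite /c1 mulrC divfK// !mulf_neq0// expf_neq0.
(* [c1] and [c2] are the errors of the two bounds divided by their leading factors, and ln 2 + 1 is
   the loss in phi(0). The choice of h0 gives - ln h >= 1, so that ln(- ln h) >= 0 and subtracting
   it only lowers the left-hand side. *)
exists (c1 + c2 + ln 2 + 1), (expR (-1)); split.
- by rewrite ltr_wpDl// addr_ge0// addr_ge0.
- exact: expR_gt0.
move=> h h0 h1.
have lnV : ln h^-1 = - ln h by rewrite lnV.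
have l1 : 1 <= - ln h.
  rewrite lerNr -(expRK (-1)) ler_ln ?posrE ?expR_gt0//; exact: ltW.
have h2 : 0 < h ^+ 2 by rewrite exprn_gt0.
have hlt1 : h < 1 by apply: lt_trans h1 _; rewrite expR_lt1; lra.
rewrite lnV; split.
  apply: le_ereal_inf_tmp => _ [U [W [hU hW ->]]].
  apply: le_trans (lower h Delta U W h0 hU hW); rewrite lee_fin.
  have -> : 2 * pi * Delta ^+ 2 * h ^+ 2 * (- ln h - 2 * ln (- ln h) - (c1 + c2 + ln 2 + 1)) =
      h ^+ 2 * (2 * pi * Delta ^+ 2 * (- ln h - ln 2 - 1) -
        (C1 + 2 * pi * Delta ^+ 2 * (c2 + 2 * ln (- ln h)))).
    by rewrite -Ec1; ring.
  apply: ler_wpM2l; first exact: ltW.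
  rewrite lerD2l lerN2 lerDl mulr_ge0//; first by rewrite ltW// !mulr_gt0.
  by rewrite addr_ge0// mulr_ge0// ln_ge0.
apply: (le_trans (inf_energy_upper Delta h0 hlt1)); rewrite lee_fin.
have -> : 6 * pi * Delta ^+ 2 * h ^+ 2 * - ln h + pi * h ^+ 2 *
    (24 ^+ 2 * Delta ^+ 4 + 10 * Delta ^+ 2 + 3 * Delta ^+ 2 * ln 2) =
    6 * pi * Delta ^+ 2 * h ^+ 2 * (- ln h + c2).
  by rewrite -/K /c2; field; rewrite dn.
apply: ler_wpM2l; first by rewrite ltW// !mulr_gt0.
by rewrite lerD2l; lra.
Qed.
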